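(* Let $\mathbb{F}$ be a field, $G$ a group, and $\mathcal{G}: A_G=\bigoplus_{g\in G}A_g$ a $G$-graded $\mathbb{F}$-algebra. There exist (1) an abelian monoid $\mathrm{Irr}^{\mathrm{inv}}_{G,\mathbb{F}}$, consisting of the graded equivariance classes of $G$-invariant and absolutely $\mathbb{F}$-graded-simple left graded modules over $G$-graded $\mathbb{F}$-algebras of bounded infinite cardinality, with multiplication induced by the graded product of graded modules; (2) a map $\iota_{\mathcal{G}}:\mathrm{Irr}_{\mathbb{F}}(A_e)^{\mathcal{G}}\to\mathrm{Irr}^{\mathrm{inv}}_{G,\mathbb{F}}$ sending $[M]$ to the graded equivariance class of $A_G\overline{\otimes}_{A_e}M$; and (3) a homomorphism of abelian monoids $\omega_{G,\mathbb{F}}:\mathrm{Irr}^{\mathrm{inv}}_{G,\mathbb{F}}\to H^2(G,\mathbb{F}^* )$, sending the class of $W_G$ (a graded module over $A'_G$) to the unique class $[\alpha]$ with $\mathrm{End}^{\mathrm{r}(G)}_{A'_G}(W_G)\stackrel{G}{\cong}\mathbb{F}^{\alpha}G$, such that $\omega_{\mathcal{G}}=\omega_{G,\mathbb{F}}\circ\iota_{\mathcal{G}}$.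
   Context: Algebras are associative and unital; modules are left modules; $e$ is the identity of $G$. A $G$-graded $\mathbb{F}$-algebra is an $\mathbb{F}$-algebra with a vector space decomposition $A_G=\bigoplus_{g\in G}A_g$ with $A_gA_h\subseteq A_{gh}$; $A_e$ is its base algebra. A $G$-graded left $A_G$-module is $W_G=\bigoplus_gW_g$ with $A_gW_h\subseteq W_{gh}$. Graded homomorphisms are degree-preserving homomorphisms; $\stackrel{G}{\cong}$ denotes graded isomorphism. $H^2(G,\mathbb{F}^* )$ is taken with trivial action. $\mathbb{F}^{\alpha}G=\bigoplus_g\mathbb{F}v_g$, $v_gv_h=\alpha(g,h)v_{gh}$, is the $G$-graded twisted group algebra of $\alpha\in Z^2(G,\mathbb{F}^* )$. Graded products: $A_G\otimes^G_{\mathbb{F}}A'_G=\bigoplus_gA_g\otimes_{\mathbb{F}}A'_g\subseteq A_G\otimes_{\mathbb{F}}A'_G$ for graded algebras; for graded modules $W_G$ over $A_G$ and $W'_G$ over $A'_G$, $W_G\otimes^G_{\mathbb{F}}W'_G=\bigoplus_gW_g\otimes_{\mathbb{F}}W'_g$, a graded $A_G\otimes^G_{\mathbb{F}}A'_G$-module by $(a_g\otimes a'_g)(w_h\otimes w'_h)=a_gw_h\otimes a'_gw'_h$. Graded left modules $W_G$ over $A_G$ and $W'_G$ over $A'_G$ are $G$-equivariant if there are a graded algebra isomorphism $\psi:A_G\to A'_G$ and a degree-preserving linear isomorphism $\varphi:W_G\to W'_G$ with $\varphi(xw)=\psi(x)\varphi(w)$ for all $x\in A_G,w\in W_G$; the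 class of $W_G$ is its graded equivariance class. The product of the classes of $W_G$ and $W'_G$ is the class of $W_G\otimes^G_{\mathbb{F}}W'_G$. To have a set, algebras and modules have cardinality bounded by fixed infinite cardinals, taken at least $\max(|\mathbb{F}|,|G|,|A_G|)$. The suspension $h(W_G)$ is the same module regraded by $h(W_G)_g:=W_{gh}$. $W_G$ is $G$-invariant if $W_G\stackrel{G}{\cong}g(W_G)$ as graded modules for all $g\in G$. $W_G$ is graded simple if it is non-zero with no proper non-zero graded submodules; it is absolutely $\mathbb{F}$-graded-simple if in addition its degree-preserving $A_G$-endomorphisms are just $\mathbb{F}\cdot\mathrm{Id}$. $\mathrm{End}^{\mathrm{r}(G)}_{A_G}(W_G)=\bigoplus_{h}\mathrm{End}^{\mathrm{r}(h)}_{A_G}(W_G)$, where $\mathrm{End}^{\mathrm{r}(h)}_{A_G}(W_G)$ is the set of $A_G$-endomorphisms $\varphi$ with $\varphi(W_g)\subseteq W_{gh}$ for all $g$; it acts from the right (product $\varphi\psi$: first $\varphi$, then $\psi$) and is a $G$-graded algebra. For an $A_e$-module $M$, $A_G\overline{\otimes}_{A_e}M:=(A_G\otimes_{A_e}M)/t$, where $(A_G\otimes_{A_e}M)_g=A_g\otimes_{A_e}M$ and $t$ is the largest graded submodule with zero $e$-component. $\mathrm{Irr}_{\mathbb{F}}(A_e)$ is the set of isomorphism classes of simple $A_e$-modules $M$ with $\mathrm{End}_{A_e}(M)=\mathbb{F}\cdot\mathrm{Id}_M$, and $\mathrm{Irr}_{\mathbb{F}}(A_e)^{\mathcal{G}}$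 is the subset of those $[M]$ for which $A_G\overline{\otimes}_{A_e}M$ is $G$-invariant. The obstruction map $\omega_{\mathcal{G}}:\mathrm{Irr}_{\mathbb{F}}(A_e)^{\mathcal{G}}\to H^2(G,\mathbb{F}^* )$ sends $[M]$ to the unique $[\omega]$ with $\mathrm{End}^{\mathrm{r}(G)}_{A_G}(A_G\overline{\otimes}_{A_e}M)\stackrel{G}{\cong}\mathbb{F}^{\omega}G$. *)

(* Defs.v *)
From HB Require Import structures.
From mathcomp Require Import all_boot all_algebra ring_quotient.
From mathcomp Require Import ring boolp classical_sets functions cardinality.

Set Implicit Arguments.
Unset Strict Implicit.
Unset Printing Implicit Defensive.

Import GRing.Theory.
Local Open Scope classical_set_scope.
Local Open Scope quotient_scope.
Local Open Scope card_scope.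
Local Open Scope ring_scope.

Lemma big_pred1_seq (I : eqType) (V : nmodType) (r : seq I) (i : I)
    (F : I -> V) :
  uniq r -> i \in r -> \sum_(j <- r | j == i) F j = F i.
Proof.
by move=> ur ir; rewrite -big_filter filter_pred1_uniq // big_seq1.
Qed.

Section Grading.
Context (G : groupType) (V : zmodType).
Implicit Types (comp : G -> set V) (s : seq G) (f : G -> V).

(* [s] may repeat degrees: each [comp g] is only used for additive subgroups,
   so this is membership in the sum of the subgroups [comp g]. *)
Definition homog_sum comp (x : V) : Prop :=
  exists s f, (forall g, comp g (f g)) /\ x = \sum_(g <- s) f g.

Definition independent comp : Prop :=
  forall s f, uniq s -> (forall g, comp g (f g)) ->
    \sum_(g <- s) f g = 0 -> forall g, g \in s -> f g = 0.

Record subgroups comp : Prop := {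
  comp0 : forall g, comp g 0;
  compB : forall g x y, comp g x -> comp g y -> comp g (x - y) }.

(* [V] is the internal direct sum of the [comp g] (as an abelian group); the
   stability under scalars is stated or derived separately. *)
Record grading comp : Prop := {
  gr_sub :> subgroups comp;
  gr_span : forall x, homog_sum comp x;
  gr_indep : independent comp }.

Section Subgroups.
Context comp (cs : subgroups comp).

Lemma compN g x : comp g x -> comp g (- x).
Proof. by move=> cx; rewrite -[- x]add0r; apply: compB => //; apply: comp0. Qed.

Lemma compD g x y : comp g x -> comp g y -> comp g (x + y).
Proof.
by move=> cx cy; rewrite -[y]opprK; apply: compB => //; apply: compN.
Qed.

Lemma comp_sum g (I : Type) (r : seq I) (P : pred I) (F : I -> V) :
  (forall i, P i -> comp g (F i)) -> comp g (\sum_(i <- r | P i) F i).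
Proof.
move=> cF; apply: big_ind => //; first exact: comp0.
by move=> x y; apply: compD.
Qed.

Lemma homog_sum_comp g x : comp g x -> homog_sum comp x.
Proof.
move=> cx; exists [:: g], (fun h => if h == g then x else 0); split.
  by move=> h; case: eqP => [->|_] //; apply: comp0.
by rewrite big_seq1 eqxx.
Qed.

Lemma homog_sum0 : homog_sum comp 0.
Proof. by apply: (@homog_sum_comp 1%g); apply: comp0. Qed.

Lemma sum_by_degree s (t : seq G) f : uniq t -> {subset s <= t} ->
  \sum_(h <- t) \sum_(k <- s | k == h) f k = \sum_(k <- s) f k.
Proof.
move=> ut st; under eq_bigr do rewrite big_mkcond.
rewrite exchange_big /= big_seq [RHS]big_seq; apply: eq_bigr => k ks.
rewrite -big_mkcond /= (eq_bigl (pred1 k)); last by move=> i; rewrite /= eq_sym.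
by rewrite big_pred1_seq ?st.
Qed.

Lemma homog_sumD x y :
  homog_sum comp x -> homog_sum comp y -> homog_sum comp (x + y).
Proof.
move=> [s [f [cf ->]]] [t [e [ce ->]]].
exists (undup (s ++ t)),
  (fun h => \sum_(k <- s | k == h) f k + \sum_(k <- t | k == h) e k); split.
  by move=> g; apply: compD; apply: comp_sum => i /eqP <-.
rewrite big_split /= !sum_by_degree ?undup_uniq // => k kst;
  by rewrite mem_undup mem_cat kst ?orbT.
Qed.

Lemma homog_sumN x : homog_sum comp x -> homog_sum comp (- x).
Proof.
move=> [s [f [cf ->]]]; exists s, (fun g => - f g); split.
  by move=> g; apply: compN.
by rewrite sumrN.
Qed.

Lemma homog_sum_sum (I : Type) (r : seq I) (P : pred I) (F : I -> V) :
  (forall i, P i -> homog_sum comp (F i)) ->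
  homog_sum comp (\sum_(i <- r | P i) F i).
Proof.
move=> cF; apply: big_ind => //; first exact: homog_sum0.
by move=> x y; apply: homog_sumD.
Qed.

Lemma indep_eq s (t : seq G) f e (g : G) : independent comp ->
  (forall g, comp g (f g)) -> (forall g, comp g (e g)) ->
  \sum_(h <- s) f h = \sum_(h <- t) e h ->
  \sum_(h <- s | h == g) f h = \sum_(h <- t | h == g) e h.
Proof.
move=> ic cf ce E; apply/eqP; rewrite -subr_eq0; apply/eqP.
pose u := undup (g :: s ++ t).
apply: (ic u
  (fun h => \sum_(k <- s | k == h) f k - \sum_(k <- t | k == h) e k)).
- exact: undup_uniq.
- by move=> h; apply: compB => //; apply: comp_sum => i /eqP <-.
- rewrite sumrB !sum_by_degree ?undup_uniq ?E ?subrr // => k kst;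
  by rewrite mem_undup in_cons mem_cat kst ?orbT.
- by rewrite mem_undup mem_head.
Qed.

Lemma indep_of_proj (P : G -> V -> V) :
  (forall g, {morph P g : x y / x + y}) ->
  (forall g x, comp g x -> P g x = x) ->
  (forall g h x, comp h x -> h != g -> P g x = 0) ->
  independent comp.
Proof.
move=> PD Pid P0 s f us cf E g gs.
have Pz : P g 0 = 0 by apply: (addrI (P g 0)); rewrite -PD !addr0.
have := congr1 (P g) E; rewrite Pz (big_morph _ (PD g) Pz).
rewrite (bigD1_seq g) //= Pid // big1 ?addr0 // => i ig.
by apply: P0.
Qed.

End Subgroups.

Section Proj.
Context comp (gr : grading comp).

Fact proj_key x : exists p : seq G * (G -> V),
  (forall g, comp g (p.2 g)) /\ x = \sum_(g <- p.1) p.2 g.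
Proof. by have [s [f ?]] := gr_span gr x; exists (s, f). Qed.

(* the homogeneous component of degree [g] of [x] *)
Definition proj (g : G) (x : V) : V :=
  let p := sval (cid (proj_key x)) in \sum_(h <- p.1 | h == g) p.2 h.

Lemma proj_sum s f g : (forall g, comp g (f g)) ->
  proj g (\sum_(h <- s) f h) = \sum_(h <- s | h == g) f h.
Proof.
move=> cf; rewrite /proj; case: cid => -[t e] /= [ce E].
by apply: (indep_eq gr) => //; apply: gr_indep gr.
Qed.

Lemma proj_comp g x : comp g (proj g x).
Proof.
rewrite /proj; case: cid => -[t e] /= [ce E].
by apply: (comp_sum gr) => i /eqP <-.
Qed.

Lemma proj_id g h x : comp g x -> proj h x = if h == g then x else 0.
Proof.
move=> cx; pose f k := if k == g then x else 0.
have cf k : comp k (f k).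
  by rewrite /f; case: eqP => [->|_] //; apply: comp0 gr _.
have {1}-> : x = \sum_(k <- [:: g]) f k by rewrite big_seq1 /f eqxx.
rewrite proj_sum // big_cons big_nil eq_sym /f eqxx addr0.
by case: eqP.
Qed.

Lemma projD g : {morph proj g : x y / x + y}.
Proof.
move=> x y.
have [s [f [cf Ex]]] := gr_span gr x; have [t [e [ce Ey]]] := gr_span gr y.
pose d h := \sum_(k <- s | k == h) f k + \sum_(k <- t | k == h) e k.
have [u [uu gu su tu]] : exists u : seq G,
    [/\ uniq u, g \in u, {subset s <= u} & {subset t <= u}].
  exists (undup (g :: s ++ t)); split; rewrite ?undup_uniq ?mem_undup ?mem_head //.
    by move=> k ks; rewrite mem_undup in_cons mem_cat ks ?orbT.
  by move=> k ks; rewrite mem_undup in_cons mem_cat ks ?orbT.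
have -> : x + y = \sum_(h <- u) d h.
  by rewrite big_split /= !sum_by_degree // Ex Ey.
rewrite proj_sum; last first.
  by move=> h; apply: (compD gr); apply: (comp_sum gr) => i /eqP <-.
rewrite big_pred1_seq //.
by rewrite Ex Ey !proj_sum.
Qed.

Lemma proj0 g : proj g 0 = 0.
Proof. by apply: (addrI (proj g 0)); rewrite -projD !addr0. Qed.

Lemma proj_big g (I : Type) (r : seq I) (P : pred I) (F : I -> V) :
  proj g (\sum_(i <- r | P i) F i) = \sum_(i <- r | P i) proj g (F i).
Proof. exact: (big_morph _ (projD g) (proj0 g)). Qed.

Lemma proj_decomp x : exists s, x = \sum_(g <- s) proj g x.
Proof.
have [s [f [cf Ex]]] := gr_span gr x; exists (undup s).
rewrite [in LHS]Ex -(sum_by_degree f (undup_uniq s)); last first.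
  by move=> k; rewrite mem_undup.
by apply: eq_bigr => h _; rewrite Ex proj_sum.
Qed.

End Proj.
End Grading.

Section GradingTransfer.
Context (G : groupType) (V U : zmodType).

Lemma proj_shift (comp : G -> set V) (comp' : G -> set U)
    (gr : grading comp) (gr' : grading comp') (m : V -> U) (sh : G -> G) :
  {morph m : x y / x + y} -> injective sh ->
  (forall g x, comp g x -> comp' (sh g) (m x)) ->
  forall g x, proj gr' (sh g) (m x) = m (proj gr g x).
Proof.
move=> mD shI mc g x.
have m0 : m 0 = 0 by apply: (addrI (m 0)); rewrite -mD !addr0.
have [s Ex] := proj_decomp gr x.
rewrite [in LHS]Ex (big_morph _ mD m0) proj_big.
rewrite [in RHS]Ex proj_big (big_morph _ mD m0).
apply: eq_bigr => h _.
rewrite (proj_id _ _ (mc h _ (proj_comp gr h x))) (inj_eq shI).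
rewrite (proj_id _ _ (proj_comp gr h x)); by case: eqP.
Qed.

Lemma sub_grading (S : pred V) (T : subZmodType S) (comp : G -> set V) :
  subgroups comp -> independent comp ->
  (forall g x, comp g x -> x \in S) ->
  (forall x, x \in S -> homog_sum comp x) ->
  grading (fun g => [set u : T | comp g (val u)]).
Proof.
move=> cs ci cS Sc; split.
- split=> [g|g x y] /=; first by rewrite raddf0; apply: comp0.
  by rewrite raddfB /=; apply: compB.
- move=> u; have [s [f [cf E]]] := Sc _ (valP u).
  exists s, (fun g => Sub (f g) (cS g _ (cf g)) : T); split.
    by move=> g; rewrite /mkset SubK.
  apply: val_inj; rewrite raddf_sum E; apply: eq_bigr => g _.
  exact: esym (SubK T _).
- move=> s f us cf E g gs; apply: val_inj; rewrite raddf0.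
  apply: (ci s (fun g => val (f g))) => //.
  by rewrite -raddf_sum E raddf0.
Qed.

End GradingTransfer.

Section Biadditive.
Context (G : groupType) (V W U : zmodType).

Definition biadditive (b : V -> W -> U) : Prop :=
  (forall v v' w, b (v + v') w = b v w + b v' w) /\
  (forall v w w', b v (w + w') = b v w + b v w').

Context (b : V -> W -> U) (bb : biadditive b).

Lemma biadd0l w : b 0 w = 0.
Proof. by apply: (addrI (b 0 w)); rewrite -(proj1 bb) !addr0. Qed.
Lemma biadd0r v : b v 0 = 0.
Proof. by apply: (addrI (b v 0)); rewrite -(proj2 bb) !addr0. Qed.
Lemma biadd_suml (I : Type) (r : seq I) (F : I -> V) w :
  b (\sum_(i <- r) F i) w = \sum_(i <- r) b (F i) w.
Proof. by apply: (big_morph (b^~ w)) => [x y|]; [apply: (proj1 bb)|apply: biadd0l]. Qed.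
Lemma biadd_sumr (I : Type) (r : seq I) (F : I -> W) v :
  b v (\sum_(i <- r) F i) = \sum_(i <- r) b v (F i).
Proof. by apply: (big_morph (b v)) => [x y|]; [apply: (proj2 bb)|apply: biadd0r]. Qed.

Lemma homog_sum_biadd (cV : G -> set V) (cW : G -> set W) (cU : G -> set U) :
  subgroups cU ->
  (forall g h v w, cV g v -> cW h w -> cU (g * h)%g (b v w)) ->
  forall v w, homog_sum cV v -> homog_sum cW w -> homog_sum cU (b v w).
Proof.
move=> cs H v w [s [f [cf ->]]] [t [e [ce ->]]].
rewrite biadd_suml; apply: homog_sum_sum => // i _.
rewrite biadd_sumr; apply: homog_sum_sum => // j _.
exact: homog_sum_comp (H _ _ _ _ (cf i) (ce j)).
Qed.

End Biadditive.

(* An F-algebra is a ring [A] with a ring morphism [ga_in : F -> A] into its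
   center; the scalar multiple k a is [ga_in A k * a]. The library's [algType F]
   is not used because it excludes the zero algebra, whereas e.g. the
   endomorphism algebra of an arbitrary module may vanish. Likewise F acts on an
   A-module by [ga_in A k *: w]. *)
Record grAlg (F : fieldType) (G : groupType) := GrAlg {
  ga_sort :> pzRingType;
  ga_in : {rmorphism F -> ga_sort};
  ga_central : forall k a, ga_in k * a = a * ga_in k;
  ga_comp : G -> set ga_sort;
  ga_grading : grading ga_comp;
  ga_scale : forall g k a, ga_comp g a -> ga_comp g (ga_in k * a);
  ga_mul : forall g h a b,
      ga_comp g a -> ga_comp h b -> ga_comp (g * h)%g (a * b) }.
Arguments ga_in {F G} A : rename.
Arguments ga_comp {F G} A : rename.

Record grMod (F : fieldType) (G : groupType) (A : grAlg F G) := GrMod {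
  gm_sort :> lmodType A;
  gm_comp : G -> set gm_sort;
  gm_grading : grading gm_comp;
  gm_act : forall g h (a : A) w,
      ga_comp A g a -> gm_comp h w -> gm_comp (g * h)%g (a *: w) }.
Arguments gm_comp {F G A} W : rename.

Section AlgFacts.
Context (F : fieldType) (G : groupType) (A : grAlg F G).

Lemma ga_one : ga_comp A 1%g 1.
Proof.
pose gr := ga_grading A; pose e := proj gr 1%g 1.
have hom (g : G) (a : A) : ga_comp A g a -> a * e = a.
  move=> ca; rewrite /e -(proj_shift gr gr (m := fun x => a * x) (sh := fun h => (g * h)%g)).
  - by rewrite mulr1 mulg1 (proj_id _ _ ca) eqxx.
  - exact: mulrDr.
  - exact: mulgI.
  - by move=> h x; apply: ga_mul.
suff -> : 1 = e :> A by apply: proj_comp.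
have [s [f [cf E]]] := gr_span gr 1.
rewrite -[e]mul1r [X in X * e]E mulr_suml [LHS]E.
by apply: eq_bigr => g _; rewrite (hom g).
Qed.

Lemma ga_in_comp k : ga_comp A 1%g (ga_in A k).
Proof. by rewrite -[ga_in A k]mulr1; apply: ga_scale; apply: ga_one. Qed.

Lemma ga_scal_central (W : lmodType A) k (a : A) (w : W) :
  ga_in A k *: (a *: w) = a *: (ga_in A k *: w).
Proof. by rewrite !scalerA ga_central. Qed.

Lemma gm_scale (W : grMod A) g k (w : W) :
  gm_comp W g w -> gm_comp W g (ga_in A k *: w).
Proof. by move=> cw; rewrite -[g]mul1g; apply: gm_act => //; apply: ga_in_comp. Qed.

Definition base_pred : {pred A} := fun a => `[< ga_comp A 1%g a >].

Fact base_closed : subring_closed base_pred.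
Proof.
split; rewrite ?unfold_in.
- by apply/asboolP; apply: ga_one.
- move=> a b; rewrite !unfold_in => /asboolP ca /asboolP cb.
  by apply/asboolP; apply: (compB (ga_grading A)).
- move=> a b; rewrite !unfold_in => /asboolP ca /asboolP cb.
  by apply/asboolP; rewrite -[1%g]mulg1; apply: ga_mul.
Qed.
HB.instance Definition _ := GRing.isSubringClosed.Build A base_pred base_closed.

Definition base : Type := {a : A | base_pred a}.
HB.instance Definition _ := SubChoice.on base.
HB.instance Definition _ := 
  GRing.SubChoice_isSubPzRing.Build A base_pred base base_closed.

Lemma base_comp (r : base) : ga_comp A 1%g (\val r).
Proof. by case: r => a /= /asboolP. Qed.

Definition base_in (k : F) : base := Sub (ga_in A k) (asboolT (ga_in_comp k)).

End AlgFacts.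

Section Tensor.
Context (R : Type) (V W : zmodType) (ra : V -> R -> V) (la : R -> W -> W).

(* The tensor product over R of a right R-module V (action [ra]) and a left
   R-module W (action [la]): finite formal sums of pairs modulo the congruence
   generated by biadditivity and R-balancedness. No formal inverses are needed:
   (- v, w) is an inverse of (v, w), by [tens_addl] and [tens_zero]. *)
Inductive tens_rel : seq (V * W) -> seq (V * W) -> Prop :=
| tens_refl s : tens_rel s s
| tens_sym s t : tens_rel s t -> tens_rel t s
| tens_trans s t u : tens_rel s t -> tens_rel t u -> tens_rel s u
| tens_cat s s' t t' :
    tens_rel s s' -> tens_rel t t' -> tens_rel (s ++ t) (s' ++ t')
| tens_comm s t : tens_rel (s ++ t) (t ++ s)
| tens_zero w : tens_rel [:: (0, w)] [::]
| tens_addl v v' w : tens_rel [:: (v + v', w)] [:: (v, w); (v', w)]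
| tens_addr v w w' : tens_rel [:: (v, w + w')] [:: (v, w); (v, w')]
| tens_bal v r w : tens_rel [:: (ra v r, w)] [:: (v, la r w)].

Definition tens_eq (s t : seq (V * W)) : bool := `[< tens_rel s t >].

Fact tens_eq_refl : reflexive tens_eq.
Proof. by move=> s; apply/asboolP; apply: tens_refl. Qed.
Fact tens_eq_sym : symmetric tens_eq.
Proof.
by move=> s t; apply/asboolP/asboolP; apply: tens_sym.
Qed.
Fact tens_eq_trans : transitive tens_eq.
Proof.
by move=> t s u /asboolP st /asboolP tu; apply/asboolP; apply: tens_trans tu.
Qed.
Canonical tens_equiv := EquivRel tens_eq tens_eq_refl tens_eq_sym tens_eq_trans.

Definition tensor : Type := {eq_quot tens_equiv}.
HB.instance Definition _ := Choice.on tensor.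
HB.instance Definition _ := EqQuotient.on tensor.

Lemma tens_piP (s t : seq (V * W)) :
  tens_rel s t <-> \pi_tensor s = \pi_tensor t.
Proof.
split=> [st|/eqquotP /asboolP //].
by apply/eqquotP; apply/asboolP.
Qed.

Definition tens_add (x y : tensor) : tensor := \pi_tensor (repr x ++ repr y).

Lemma tens_pi_cat s t :
  \pi_tensor (s ++ t) = tens_add (\pi_tensor s) (\pi_tensor t).
Proof.
by apply/tens_piP; apply: tens_cat; apply/tens_piP; rewrite reprK.
Qed.

Fact tens_addA : associative tens_add.
Proof.
elim/quotW=> s; elim/quotW=> t; elim/quotW=> u.
by rewrite -(tens_pi_cat t u) -(tens_pi_cat s t) -!tens_pi_cat catA.
Qed.
Fact tens_addC : commutative tens_add.
Proof.
elim/quotW=> s; elim/quotW=> t; rewrite -!tens_pi_cat.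
exact/tens_piP/tens_comm.
Qed.
Fact tens_add0 : left_id (\pi_tensor [::]) tens_add.
Proof. by elim/quotW=> s; rewrite -tens_pi_cat. Qed.
HB.instance Definition _ :=
  GRing.isNmodule.Build tensor tens_addA tens_addC tens_add0.

Definition tpure (v : V) (w : W) : tensor := \pi_tensor [:: (v, w)].

Lemma tens_pi_sum s : \pi_tensor s = \sum_(p <- s) tpure p.1 p.2.
Proof.
elim: s => [|[v w] s IH]; first by rewrite big_nil.
by rewrite big_cons -IH -cat1s tens_pi_cat.
Qed.

Lemma tpureDl v v' w : tpure (v + v') w = tpure v w + tpure v' w.
Proof. by rewrite -[RHS]tens_pi_cat; apply/tens_piP/tens_addl. Qed.
Lemma tpureDr v w w' : tpure v (w + w') = tpure v w + tpure v w'.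
Proof. by rewrite -[RHS]tens_pi_cat; apply/tens_piP/tens_addr. Qed.
Lemma tpure0l w : tpure 0 w = 0.
Proof. exact/tens_piP/tens_zero. Qed.
Lemma tpureZ v r w : tpure (ra v r) w = tpure v (la r w).
Proof. exact/tens_piP/tens_bal. Qed.

Definition tens_opp (x : tensor) : tensor :=
  \sum_(p <- repr x) tpure (- p.1) p.2.

Fact tens_addN : left_inverse 0 tens_opp +%R.
Proof.
move=> x; rewrite -[x in X in _ + X]reprK tens_pi_sum -big_split big1 // => p _.
by rewrite /= -tpureDl addNr tpure0l.
Qed.
HB.instance Definition _ := GRing.Nmodule_isZmodule.Build tensor tens_addN.

Lemma tens_ind (P : tensor -> Prop) :
  P 0 -> (forall x y, P x -> P y -> P (x + y)) ->
  (forall v w, P (tpure v w)) -> forall x, P x.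
Proof.
move=> P0 PD Pp x; rewrite -[x]reprK tens_pi_sum; exact: big_ind.
Qed.

Definition balanced (Z : zmodType) (b : V -> W -> Z) : Prop :=
  biadditive b /\ forall v r w, b (ra v r) w = b v (la r w).

Lemma tpure_balanced : balanced tpure.
Proof. by split; [split|]; [exact: tpureDl|exact: tpureDr|exact: tpureZ]. Qed.

(* the additive map induced by a balanced map [b] *)
Definition tlift (Z : zmodType) (b : V -> W -> Z) (x : tensor) : Z :=
  \sum_(p <- repr x) b p.1 p.2.

Section Lift.
Context (Z : zmodType) (b : V -> W -> Z) (bb : balanced b).

Lemma tlift_pi s : tlift b (\pi_tensor s) = \sum_(p <- s) b p.1 p.2.
Proof.
have [ba bz] := bb.
rewrite /tlift; set t := repr _.
have /tens_piP : \pi_tensor t = \pi_tensor s by rewrite /t reprK.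
elim=> {t s} //.
- by move=> s t u _ -> _ ->.
- by move=> s s' t t' _ E _ E'; rewrite !big_cat E E'.
- by move=> s t; rewrite !big_cat; apply: addrC.
- by move=> w; rewrite big_seq1 big_nil (biadd0l ba).
- by move=> v v' w; rewrite !big_cons !big_nil !addr0 (proj1 ba).
- by move=> v w w'; rewrite !big_cons !big_nil !addr0 (proj2 ba).
- by move=> v r w; rewrite !big_seq1 bz.
Qed.

Lemma tlift_pure v w : tlift b (tpure v w) = b v w.
Proof. by rewrite tlift_pi big_seq1. Qed.

Lemma tliftD : {morph tlift b : x y / x + y}.
Proof.
elim/quotW=> s; elim/quotW=> t; rewrite -[_ + _]tens_pi_cat !tlift_pi.
by rewrite big_cat.
Qed.

Lemma tlift0 : tlift b 0 = 0.
Proof. by rewrite -[0]/(\pi_tensor [::]) tlift_pi big_nil. Qed.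

End Lift.

(* span of the pure tensors [v (x) w] with [v] in [P] and [w] in [Q] *)
Definition tspan (P : set V) (Q : set W) : set tensor :=
  [set x | exists s : seq (V * W), (forall p, p \in s -> P p.1 /\ Q p.2) /\
                                   x = \sum_(p <- s) tpure p.1 p.2].

Lemma tspan0 P Q : tspan P Q 0.
Proof. by exists [::]; split => //; rewrite big_nil. Qed.

Lemma tspan_pure (P : set V) (Q : set W) v w : P v -> Q w -> tspan P Q (tpure v w).
Proof.
move=> Pv Qw; exists [:: (v, w)]; rewrite big_seq1; split => // p.
by rewrite inE => /eqP ->.
Qed.

Lemma tspanD P Q x y : tspan P Q x -> tspan P Q y -> tspan P Q (x + y).
Proof.
move=> [s [ps ->]] [t [pt ->]]; exists (s ++ t); rewrite big_cat; split => // p.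
by rewrite mem_cat => /orP[/ps|/pt].
Qed.

Lemma tspanB (P : set V) Q x y : (forall v, P v -> P (- v)) ->
  tspan P Q x -> tspan P Q y -> tspan P Q (x - y).
Proof.
move=> PN cx [t [pt ->]]; apply: tspanD => //.
exists [seq (- p.1, p.2) | p <- t]; split.
  by move=> _ /mapP[p /pt [Pp Qp] ->]; split => //; apply: PN.
rewrite big_map -sumrN; apply: eq_bigr => p _ /=.
by apply/eqP; rewrite eq_sym -subr_eq0 opprK -tpureDl addNr tpure0l.
Qed.

Lemma tspan_ind P Q (K : tensor -> Prop) : K 0 ->
  (forall x y, K x -> K y -> K (x + y)) ->
  (forall v w, P v -> Q w -> K (tpure v w)) -> forall x, tspan P Q x -> K x.
Proof.
move=> K0 KD Kp x [s [ps ->]]; rewrite big_seq; apply: big_ind => // p /ps[].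
exact: Kp.
Qed.

End Tensor.
Arguments tpure {R V W}.
Arguments tspan {R V W}.

Section Lift2.
Context (R R' : Type) (V W V' W' Z : zmodType).
Context (ra : V -> R -> V) (la : R -> W -> W).
Context (ra' : V' -> R' -> V') (la' : R' -> W' -> W').
Context (c : V -> W -> V' -> W' -> Z).
Hypothesis c1 : forall v w, balanced ra' la' (c v w).
Hypothesis c2 : forall v' w', balanced ra la (fun v w => c v w v' w').

Definition tlift2 (x : tensor ra la) (y : tensor ra' la') : Z :=
  tlift (fun v w => tlift (c v w) y) x.

Lemma tlift2_balanced (y : tensor ra' la') :
  balanced ra la (fun v w => tlift (c v w) y).
Proof.
elim/tens_ind: y => [|x y IHx IHy|v' w'].
- by split; [split|] => *; rewrite !tlift0 ?addr0.
- split; [split|] => *; rewrite !tliftD //.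
  + by rewrite (proj1 (proj1 IHx)) (proj1 (proj1 IHy)) addrACA.
  + by rewrite (proj2 (proj1 IHx)) (proj2 (proj1 IHy)) addrACA.
  + by rewrite (proj2 IHx) (proj2 IHy).
- have [[cl cr] cz] := c2 v' w'.
  by split; [split|] => *; rewrite !tlift_pure.
Qed.

Lemma tlift2_pure v w v' w' :
  tlift2 (tpure ra la v w) (tpure ra' la' v' w') = c v w v' w'.
Proof. by rewrite /tlift2 tlift_pure ?tlift_pure //; apply: tlift2_balanced. Qed.

Lemma tlift2_biadd : biadditive tlift2.
Proof.
split=> [x x' y|x y y']; first by rewrite /tlift2 tliftD //; apply: tlift2_balanced.
elim/tens_ind: x => [|x x' IH IH'|v w].
- by rewrite /tlift2 !tlift0 ?addr0 //; apply: tlift2_balanced.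
- rewrite /tlift2 !tliftD in IH IH' *; try exact: tlift2_balanced.
  by rewrite IH IH' addrACA.
- by rewrite /tlift2 !tlift_pure ?tliftD //; apply: tlift2_balanced.
Qed.

End Lift2.

Section GradedTensor.
Context (G : groupType) (R : Type) (V W : zmodType).
Context (ra : V -> R -> V) (la : R -> W -> W).
Context (cV : G -> set V) (cW : G -> set W).

(* V_g (x) W_g as a subgroup of V (x) W; for graded vector spaces over a field,
   V_g and W_g are direct summands, so that this is the tensor product of the
   components. *)
Definition tcomp (g : G) : set (tensor ra la) := tspan ra la (cV g) (cW g).

Lemma tcomp_subgroups : subgroups cV -> subgroups tcomp.
Proof.
move=> cs; split=> [g|g x y]; first exact: tspan0.
by apply: tspanB => v; apply: compN.
Qed.

Context (gV : grading cV) (gW : grading cW).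
Hypothesis raD : forall r, {morph ra^~ r : v v' / v + v'}.
Hypothesis laD : forall r, {morph la r : w w' / w + w'}.
Hypothesis raC : forall g v r, cV g v -> cV g (ra v r).
Hypothesis laC : forall g r w, cW g w -> cW g (la r w).

Lemma tcomp_indep : independent tcomp.
Proof.
pose b g v w := tpure ra la (proj gV g v) (proj gW g w).
have bb g : balanced ra la (b g).
  split; [split|] => *; rewrite /b.
  - by rewrite projD tpureDl.
  - by rewrite projD tpureDr.
  - rewrite (proj_shift gV gV (raD _) (sh := id)) //; last by move=> *; apply: raC.
    rewrite (proj_shift gW gW (laD _) (sh := id)) //; last by move=> *; apply: laC.
    by rewrite tpureZ.
apply: (indep_of_proj (P := fun g => tlift (b g))).
- by move=> g; apply: tliftD.
- move=> g; apply: tspan_ind => [|x y|v w cv cw].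
  + by rewrite tlift0.
  + by rewrite tliftD // => -> ->.
  + by rewrite tlift_pure // /b (proj_id _ _ cv) (proj_id _ _ cw) eqxx.
- move=> g h + + hg; apply: tspan_ind => [|x y|v w cv cw].
  + by rewrite tlift0.
  + by rewrite tliftD // => -> ->; rewrite addr0.
  + rewrite tlift_pure // /b (proj_id _ _ cv) eq_sym (negbTE hg).
    by rewrite tpure0l.
Qed.

End GradedTensor.
Arguments tcomp {G R V W}.

Section AlgTensor.
Context (F : fieldType) (G : groupType) (A B : grAlg F G).

Definition atens : Type :=
  tensor (fun (a : A) k => ga_in A k * a) (fun k (b : B) => ga_in B k * b).
HB.instance Definition _ := GRing.Zmodule.on atens.

Definition apure (a : A) (b : B) : atens := tpure _ _ a b.

Definition atens_mul (x y : atens) : atens :=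
  tlift2 (fun a b a' b' => apure (a * a') (b * b')) x y.

Fact atens_mul_bal1 a b : balanced (fun (a : A) k => ga_in A k * a)
  (fun k (b : B) => ga_in B k * b) (fun a' b' => apure (a * a') (b * b')).
Proof.
split; [split|] => *; rewrite /apure.
- by rewrite mulrDr tpureDl.
- by rewrite mulrDr tpureDr.
- by rewrite !mulrA -!ga_central -!mulrA tpureZ.
Qed.

Fact atens_mul_bal2 a' b' : balanced (fun (a : A) k => ga_in A k * a)
  (fun k (b : B) => ga_in B k * b) (fun a b => apure (a * a') (b * b')).
Proof.
split; [split|] => *; rewrite /apure.
- by rewrite mulrDl tpureDl.
- by rewrite mulrDl tpureDr.
- by rewrite -!mulrA tpureZ.
Qed.

Lemma atens_mulE a b a' b' :
  atens_mul (apure a b) (apure a' b') = apure (a * a') (b * b').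
Proof.
by rewrite /atens_mul tlift2_pure //; [apply: atens_mul_bal1|apply: atens_mul_bal2].
Qed.

Lemma atens_mulD : biadditive atens_mul.
Proof. by apply: tlift2_biadd; [apply: atens_mul_bal1|apply: atens_mul_bal2]. Qed.

Let mulDl : left_distributive atens_mul +%R.
Proof. by move=> x y z; apply: (proj1 atens_mulD). Qed.
Let mulDr : right_distributive atens_mul +%R.
Proof. by move=> x y z; apply: (proj2 atens_mulD). Qed.

Lemma atens_ind (P : atens -> Prop) :
  P 0 -> (forall x y, P x -> P y -> P (x + y)) ->
  (forall a b, P (apure a b)) -> forall x, P x.
Proof. exact: tens_ind. Qed.

Fact atens_mulA : associative atens_mul.
Proof.
move=> x y z; elim/atens_ind: x => [|x x' E E'|a b].
- by rewrite !(biadd0l atens_mulD).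
- by rewrite !mulDl E E'.
elim/atens_ind: y => [|y y' E E'|a' b'].
- by rewrite !(biadd0l atens_mulD) !(biadd0r atens_mulD) (biadd0l atens_mulD).
- by rewrite mulDl !mulDr E E' mulDl.
elim/atens_ind: z => [|z z' E E'|a'' b''].
- by rewrite !(biadd0r atens_mulD).
- by rewrite !mulDr E E'.
by rewrite !atens_mulE !mulrA.
Qed.

Fact atens_mul1 : left_id (apure 1 1) atens_mul.
Proof.
move=> x; elim/atens_ind: x => [|x x' E E'|a b].
- by rewrite (biadd0r atens_mulD).
- by rewrite mulDr E E'.
- by rewrite atens_mulE !mul1r.
Qed.

Fact atens_1mul : right_id (apure 1 1) atens_mul.
Proof.
move=> x; elim/atens_ind: x => [|x x' E E'|a b].
- by rewrite (biadd0l atens_mulD).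
- by rewrite mulDl E E'.
- by rewrite atens_mulE !mulr1.
Qed.

HB.instance Definition _ := GRing.Zmodule_isPzRing.Build atens
  atens_mulA atens_mul1 atens_1mul mulDl mulDr.

Lemma apureM a b a' b' : apure a b * apure a' b' = apure (a * a') (b * b').
Proof. exact: atens_mulE. Qed.

Definition atens_comp (g : G) : set atens :=
  tcomp _ _ (ga_comp A) (ga_comp B) g.

Lemma atens_comp_subgroups : subgroups atens_comp.
Proof. exact: tcomp_subgroups (ga_grading A). Qed.

Lemma atens_comp_mul g h x y :
  atens_comp g x -> atens_comp h y -> atens_comp (g * h)%g (x * y).
Proof.
have cs := atens_comp_subgroups.
move=> + cy; move: x; apply: tspan_ind => [|x x' cx cx'|a b ca cb].
- by rewrite mul0r; apply: comp0.
- by rewrite mulrDl; apply: compD.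
move: y cy; apply: tspan_ind => [|y y' cy cy'|a' b' ca' cb'].
- by rewrite mulr0; apply: comp0.
- by rewrite mulrDr; apply: compD.
by rewrite apureM; apply: tspan_pure; apply: ga_mul.
Qed.

Definition gtens_pred : {pred atens} := fun x => `[< homog_sum atens_comp x >].

Fact gtens_closed : subring_closed gtens_pred.
Proof.
have cs := atens_comp_subgroups.
split; rewrite ?unfold_in.
- apply/asboolP; apply: (@homog_sum_comp _ _ _ cs 1%g).
  by apply: tspan_pure; apply: ga_one.
- move=> x y; rewrite !unfold_in => /asboolP cx /asboolP cy.
  by apply/asboolP; apply: homog_sumD => //; apply: homog_sumN.
- move=> x y; rewrite !unfold_in => /asboolP cx /asboolP cy.
  apply/asboolP; apply: (homog_sum_biadd atens_mulD cs) cx cy.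
  by move=> *; apply: atens_comp_mul.
Qed.
HB.instance Definition _ :=
  GRing.isSubringClosed.Build atens gtens_pred gtens_closed.

Definition gtens : Type := {x : atens | gtens_pred x}.
HB.instance Definition _ := SubChoice.on gtens.
HB.instance Definition _ :=
  GRing.SubChoice_isSubPzRing.Build atens gtens_pred gtens gtens_closed.

Definition gtens_comp (g : G) : set gtens := [set x | atens_comp g (\val x)].

Lemma gtens_grading : grading gtens_comp.
Proof.
have cs := atens_comp_subgroups; apply: sub_grading => //.
- apply: (tcomp_indep (ga_grading A) (ga_grading B)).
  + by move=> r v w; rewrite mulrDr.
  + by move=> r v w; rewrite mulrDr.
  + by move=> *; apply: ga_scale.
  + by move=> *; apply: ga_scale.
- by move=> g x cx; apply/asboolP; apply: homog_sum_comp cx.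
- by move=> x /asboolP.
Qed.

Fact gtens_in_comp k : atens_comp 1%g (apure (ga_in A k) 1).
Proof. by apply: tspan_pure; [apply: ga_in_comp|apply: ga_one]. Qed.

Definition gtens_in (k : F) : gtens :=
  Sub (apure (ga_in A k) 1)
    (asboolT (homog_sum_comp atens_comp_subgroups (gtens_in_comp k))).

Fact gtens_in_zmod : zmod_morphism gtens_in.
Proof.
move=> k l; apply: val_inj; rewrite raddfB /= rmorphB /apure.
rewrite tpureDl; congr (_ + _); apply/eqP.
by rewrite -subr_eq0 opprK -tpureDl addNr tpure0l.
Qed.
Fact gtens_in_monoid : monoid_morphism gtens_in.
Proof.
split=> [|k l]; apply: val_inj; first by rewrite /= rmorph1.
by rewrite rmorphM /= apureM rmorphM mulr1.
Qed.
HB.instance Definition _ :=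
  GRing.isZmodMorphism.Build F gtens gtens_in gtens_in_zmod.
HB.instance Definition _ :=
  GRing.isMonoidMorphism.Build F gtens gtens_in gtens_in_monoid.

Fact gtens_central k (x : gtens) : gtens_in k * x = x * gtens_in k.
Proof.
apply: val_inj; rewrite !rmorphM /=; elim/atens_ind: (\val x).
- by rewrite mulr0 mul0r.
- by move=> y z; rewrite mulrDr mulrDl => -> ->.
- by move=> a b; rewrite !apureM mul1r mulr1 ga_central.
Qed.

Fact gtens_mul_comp g h (x y : gtens) :
  gtens_comp g x -> gtens_comp h y -> gtens_comp (g * h)%g (x * y).
Proof.
by rewrite /gtens_comp /mkset => cx cy; rewrite rmorphM; apply: atens_comp_mul.
Qed.

Fact gtens_scale_comp g k (x : gtens) :
  gtens_comp g x -> gtens_comp g (gtens_in k * x).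
Proof.
move=> cx; rewrite -[g]mul1g; apply: gtens_mul_comp => //.
exact: gtens_in_comp.
Qed.

Definition gtens_alg : grAlg F G :=
  @GrAlg F G gtens gtens_in gtens_central gtens_comp gtens_grading
    gtens_scale_comp gtens_mul_comp.

End AlgTensor.

Section ModTensor.
Context (F : fieldType) (G : groupType) (A B : grAlg F G).
Context (W : grMod A) (W' : grMod B).

Definition mtens : Type :=
  tensor (fun (w : W) k => ga_in A k *: w) (fun k (w : W') => ga_in B k *: w).
HB.instance Definition _ := GRing.Zmodule.on mtens.

Definition mpure (w : W) (w' : W') : mtens := tpure _ _ w w'.

Definition mtens_act (x : atens A B) (y : mtens) : mtens :=
  tlift2 (fun a b w w' => mpure (a *: w) (b *: w')) x y.

Fact mtens_act_bal1 a b : balanced (fun (w : W) k => ga_in A k *: w)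
  (fun k (w : W') => ga_in B k *: w) (fun w w' => mpure (a *: w) (b *: w')).
Proof.
split; [split|] => *; rewrite /mpure.
- by rewrite scalerDr tpureDl.
- by rewrite scalerDr tpureDr.
- by rewrite -!ga_scal_central tpureZ.
Qed.

Fact mtens_act_bal2 w w' : balanced (fun (a : A) k => ga_in A k * a)
  (fun k (b : B) => ga_in B k * b) (fun a b => mpure (a *: w) (b *: w')).
Proof.
split; [split|] => *; rewrite /mpure.
- by rewrite scalerDl tpureDl.
- by rewrite scalerDl tpureDr.
- by rewrite -!scalerA tpureZ.
Qed.

Lemma mtens_actE a b w w' :
  mtens_act (apure a b) (mpure w w') = mpure (a *: w) (b *: w').
Proof.
by rewrite /mtens_act tlift2_pure //; [apply: mtens_act_bal1|apply: mtens_act_bal2].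
Qed.

Lemma mtens_actD : biadditive mtens_act.
Proof. by apply: tlift2_biadd; [apply: mtens_act_bal1|apply: mtens_act_bal2]. Qed.

Lemma mtens_ind (P : mtens -> Prop) :
  P 0 -> (forall x y, P x -> P y -> P (x + y)) ->
  (forall w w', P (mpure w w')) -> forall x, P x.
Proof. exact: tens_ind. Qed.

Lemma mtens_actA x y z : mtens_act x (mtens_act y z) = mtens_act (x * y) z.
Proof.
have [aDl aDr] := mtens_actD.
elim/atens_ind: x => [|x x' E E'|a b].
- by rewrite mul0r !(biadd0l mtens_actD).
- by rewrite mulrDl !aDl E E'.
elim/atens_ind: y => [|y y' E E'|a' b'].
- by rewrite mulr0 !(biadd0l mtens_actD) (biadd0r mtens_actD).
- by rewrite mulrDr !aDl !aDr E E'.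
elim/mtens_ind: z => [|z z' E E'|a'' b''].
- by rewrite !(biadd0r mtens_actD).
- by rewrite !aDr E E'.
by rewrite apureM !mtens_actE !scalerA.
Qed.

Lemma mtens_act1 z : mtens_act 1 z = z.
Proof.
have [aDl aDr] := mtens_actD.
elim/mtens_ind: z => [|z z' E E'|a'' b''].
- by rewrite !(biadd0r mtens_actD).
- by rewrite !aDr E E'.
by rewrite mtens_actE !scale1r.
Qed.

Definition mtens_comp (g : G) : set mtens :=
  tcomp _ _ (gm_comp W) (gm_comp W') g.

Lemma mtens_comp_subgroups : subgroups mtens_comp.
Proof. exact: tcomp_subgroups (gm_grading W). Qed.

Lemma mtens_comp_act g h x y :
  atens_comp g x -> mtens_comp h y -> mtens_comp (g * h)%g (mtens_act x y).
Proof.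
have cs := mtens_comp_subgroups; have [aDl aDr] := mtens_actD.
move=> + cy; move: x; apply: tspan_ind => [|x x' cx cx'|a b ca cb].
- by rewrite (biadd0l mtens_actD); apply: comp0.
- by rewrite aDl; apply: compD.
move: y cy; apply: tspan_ind => [|y y' cy cy'|a' b' ca' cb'].
- by rewrite (biadd0r mtens_actD); apply: comp0.
- by rewrite aDr; apply: compD.
by rewrite mtens_actE; apply: tspan_pure; apply: gm_act.
Qed.

Definition gmtens_pred : {pred mtens} := fun x => `[< homog_sum mtens_comp x >].

Fact gmtens_closed : zmod_closed gmtens_pred.
Proof.
have cs := mtens_comp_subgroups.
split; rewrite ?unfold_in; first by apply/asboolP; apply: homog_sum0.
move=> x y; rewrite !unfold_in => /asboolP cx /asboolP cy.
by apply/asboolP; apply: homog_sumD => //; apply: homog_sumN.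
Qed.
HB.instance Definition _ :=
  GRing.isZmodClosed.Build mtens gmtens_pred gmtens_closed.

Definition gmtens : Type := {x : mtens | gmtens_pred x}.
HB.instance Definition _ := SubChoice.on gmtens.
HB.instance Definition _ := [SubChoice_isSubZmodule of gmtens by <:].

Fact gmtens_act_closed (x : gtens A B) (y : gmtens) :
  gmtens_pred (mtens_act (\val x) (\val y)).
Proof.
apply/asboolP.
apply: (homog_sum_biadd mtens_actD mtens_comp_subgroups mtens_comp_act).
  exact: (asboolW (valP x)).
exact: (asboolW (valP y)).
Qed.

Definition gmtens_act (x : gtens A B) (y : gmtens) : gmtens :=
  Sub (mtens_act (\val x) (\val y)) (gmtens_act_closed x y).

Fact gmtens_actA x y z :
  gmtens_act x (gmtens_act y z) = gmtens_act (x * y) z.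
Proof. by apply: val_inj; rewrite /= mtens_actA. Qed.
Fact gmtens_act1 : left_id 1 gmtens_act.
Proof. by move=> x; apply: val_inj; rewrite /= mtens_act1. Qed.
Fact gmtens_actDr : right_distributive gmtens_act +%R.
Proof. by move=> x y z; apply: val_inj; rewrite /= (proj2 mtens_actD). Qed.
Fact gmtens_actDl z : {morph gmtens_act^~ z : x y / x + y}.
Proof. by move=> x y; apply: val_inj; rewrite /= (proj1 mtens_actD). Qed.
HB.instance Definition _ := GRing.Zmodule_isLmodule.Build (gtens A B) gmtens
  gmtens_actA gmtens_act1 gmtens_actDr gmtens_actDl.

Definition gmtens_comp (g : G) : set gmtens := [set x | mtens_comp g (\val x)].

Lemma gmtens_grading : grading gmtens_comp.
Proof.
have cs := mtens_comp_subgroups; apply: sub_grading => //.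
- apply: (tcomp_indep (gm_grading W) (gm_grading W')).
  + by move=> r v w; rewrite scalerDr.
  + by move=> r v w; rewrite scalerDr.
  + by move=> *; apply: gm_scale.
  + by move=> *; apply: gm_scale.
- by move=> g x cx; apply/asboolP; apply: homog_sum_comp cx.
- by move=> x /asboolP.
Qed.

Fact gmtens_comp_act g h (x : gtens_alg A B) (y : gmtens) :
  ga_comp (gtens_alg A B) g x -> gmtens_comp h y ->
  gmtens_comp (g * h)%g ((x : gtens A B) *: y).
Proof. exact: mtens_comp_act. Qed.

Definition gtens_mod : grMod (gtens_alg A B) :=
  @GrMod F G (gtens_alg A B) gmtens gmtens_comp gmtens_grading gmtens_comp_act.

End ModTensor.

Section Suspension.
Context (F : fieldType) (G : groupType) (A : grAlg F G) (W : grMod A) (h : G).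

(* h(W)_g = W_{gh} *)
Definition susp_comp (g : G) : set W := gm_comp W (g * h)%g.

Fact susp_grading : grading susp_comp.
Proof.
have gr := gm_grading W; split.
- by split=> [g|g x y]; [apply: (comp0 gr)|apply: (compB gr)].
- move=> x; have [s [f [cf ->]]] := gr_span gr x.
  exists [seq (g * h^-1)%g | g <- s], (fun g => f (g * h)%g).
  split; first by move=> g; apply: cf.
  by rewrite big_map; apply: eq_bigr => g _; rewrite mulgVK.
- move=> s f us cf E g gs; have gI : injective (fun g : G => (g * h)%g).
    exact: mulIg.
  have := gr_indep gr (s := [seq (g * h)%g | g <- s])
    (f := fun g => f (g * h^-1)%g).
  move=> /(_ _ _ _ (g * h)%g); rewrite mulgK; apply.
  + by rewrite map_inj_uniq.
  + by move=> k; have := cf (k * h^-1)%g; rewrite /susp_comp mulgVK.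
  + by rewrite big_map -[RHS]E; apply: eq_bigr => k _; rewrite mulgK.
  + exact: map_f.
Qed.

Fact susp_act g k (a : A) (w : W) :
  ga_comp A g a -> susp_comp k w -> susp_comp (g * k)%g (a *: w).
Proof. by rewrite /susp_comp -mulgA; apply: gm_act. Qed.

Definition susp : grMod A := GrMod susp_grading susp_act.

End Suspension.

Section Modules.
Context (R : pzRingType) (V : lmodType R).

Record submodule (N : set V) : Prop := {
  subm0 : N 0;
  submD : forall v w, N v -> N w -> N (v + w);
  submZ : forall r v, N v -> N (r *: v) }.

Definition simple_module : Prop :=
  (exists v : V, v != 0) /\
  forall N : set V, submodule N -> N = [set 0] \/ N = setT.

End Modules.

Lemma linear_morphD (R : pzRingType) (V U : lmodType R) (phi : V -> U) :
  linear phi -> {morph phi : x y / x + y}.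
Proof. by move=> lp x y; rewrite -[x]scale1r lp !scale1r. Qed.

Section GradedModules.
Context (F : fieldType) (G : groupType) (A : grAlg F G).
Implicit Types W : grMod A.

Record graded_submodule W (N : set W) : Prop := {
  gsub_sub :> submodule N;
  gsub_homog : forall w, N w -> homog_sum (fun g => gm_comp W g `&` N) w }.

Definition graded_simple W : Prop :=
  (exists w : W, w != 0) /\
  forall N : set W, graded_submodule N -> N = [set 0] \/ N = setT.

Definition degree_preserving W W' (phi : W -> W') : Prop :=
  forall g w, gm_comp W g w -> gm_comp W' g (phi w).

Definition abs_graded_simple W : Prop :=
  graded_simple W /\
  forall phi : {linear W -> W}, degree_preserving phi ->
    exists k : F, forall w, phi w = ga_in A k *: w.

Definition gmod_iso W W' : Prop :=
  exists phi : {linear W -> W'}, bijective phi /\ degree_preserving phi.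

Definition G_invariant W : Prop := forall g : G, gmod_iso W (susp W g).

End GradedModules.

Section GradedAlgebraIso.
Context (F : fieldType) (G : groupType) (A B : grAlg F G).

Record is_galg_iso (psi : {rmorphism A -> B}) : Prop := {
  galg_iso_bij : bijective psi;
  galg_iso_in : forall k, psi (ga_in A k) = ga_in B k;
  galg_iso_comp : forall g a, ga_comp A g a -> ga_comp B g (psi a) }.

Definition galg_iso : Prop := exists psi : {rmorphism A -> B}, is_galg_iso psi.

End GradedAlgebraIso.

Section Endr.
Context (F : fieldType) (G : groupType) (A : grAlg F G) (W : grMod A).

Definition endr_deg (h : G) : set (W -> W) :=
  [set phi | linear phi /\
             forall g w, gm_comp W g w -> gm_comp W (g * h)%g (phi w)].

Lemma endr_deg_subgroups : subgroups endr_deg.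
Proof.
have gr := gm_grading W; split=> [h|h f f' [lf cf] [lf' cf']].
  split; last by move=> g w _; apply: (comp0 gr).
  by move=> a u v; rewrite -[RHS]/(a *: 0 + 0) scaler0 addr0.
split=> [a u v|g w cw].
  rewrite -[LHS]/(f _ - f' _) lf lf' -[RHS]/(a *: (_ - _) + (f v - f' v)).
  by rewrite scalerBr opprD addrACA.
by apply: (compB gr); [apply: cf|apply: cf'].
Qed.

Lemma endr_deg_indep : independent endr_deg.
Proof.
have gr := gm_grading W => s f us cf E h hs.
have linD k : {morph f k : x y / x + y}.
  by have [/linear_morphD] := cf k.
have lin0 k : f k 0 = 0 by apply: (addrI (f k 0)); rewrite -linD !addr0.
apply/funext => w; have [t [e [ce ->]]] := gr_span gr w.
rewrite (big_morph _ (linD h) (lin0 h)) big1 // => g _.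
have := gr_indep gr (s := [seq (g * k)%g | k <- s])
  (f := fun k => f (g^-1 * k)%g (e g)).
move=> /(_ _ _ _ (g * h)%g); rewrite mulKg; apply.
- by rewrite map_inj_uniq //; apply: mulgI.
- move=> k; have [_ ck] := cf (g^-1 * k)%g.
  by have := ck _ _ (ce g); rewrite mulgA mulgV mul1g.
- rewrite big_map.
  under eq_bigr do rewrite mulKg.
  by have := congr1 (fun u => u (e g)) E; rewrite fct_sumE.
- exact: map_f.
Qed.

Definition endr_pred : {pred (W -> W)} := fun phi => `[< homog_sum endr_deg phi >].

Fact endr_closed : zmod_closed endr_pred.
Proof.
have cs := endr_deg_subgroups.
split; rewrite ?unfold_in; first by apply/asboolP; apply: homog_sum0.
move=> x y; rewrite !unfold_in => /asboolP cx /asboolP cy.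
by apply/asboolP; apply: homog_sumD => //; apply: homog_sumN.
Qed.
HB.instance Definition _ :=
  GRing.isZmodClosed.Build (W -> W) endr_pred endr_closed.

Definition endr : Type := {phi : W -> W | endr_pred phi}.
HB.instance Definition _ := SubChoice.on endr.
HB.instance Definition _ := [SubChoice_isSubZmodule of endr by <:].

Lemma homog_endr_linear phi : homog_sum endr_deg phi -> linear phi.
Proof.
move=> [s [f [cf ->]]] a u v; rewrite !fct_sumE scaler_sumr -big_split.
by apply: eq_bigr => g _; have [lg _] := cf g; rewrite lg.
Qed.

Lemma endr_linear (phi : endr) : linear (\val phi).
Proof. exact: homog_endr_linear (asboolW (valP phi)). Qed.

Lemma endr_comp_closed f f' :
  homog_sum endr_deg f -> homog_sum endr_deg f' -> homog_sum endr_deg (f' \o f).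
Proof.
have cs := endr_deg_subgroups.
move=> hf hf'; have lf' := homog_endr_linear hf'.
have f'D := linear_morphD lf'.
have f'0 : f' 0 = 0 by apply: (addrI (f' 0)); rewrite -f'D !addr0.
have [s [e [ce Ef]]] := hf; have [t [e' [ce' Ef']]] := hf'.
have -> : f' \o f = \sum_(g <- s) \sum_(h <- t) (e' h \o e g).
  apply/funext => w; rewrite fct_sumE /= Ef fct_sumE.
  rewrite (big_morph _ f'D f'0); apply: eq_bigr => g _.
  by rewrite fct_sumE Ef' fct_sumE.
apply: homog_sum_sum => // g _; apply: homog_sum_sum => // h _.
apply: (@homog_sum_comp _ _ _ cs (g * h)%g).
have [lg cg] := ce g; have [lh ch] := ce' h; split=> [a u v|k w cw].
  by rewrite /= lg lh.
by rewrite mulgA; apply: ch; apply: cg.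
Qed.

(* Endomorphisms act from the right: in [phi * psi], [phi] is applied first. *)
Definition endr_mul (phi psi : endr) : endr :=
  Sub (\val psi \o \val phi)
    (asboolT (endr_comp_closed (asboolW (valP phi)) (asboolW (valP psi)))).

Fact endr_id_deg : endr_deg 1%g id.
Proof. by split=> // g w; rewrite mulg1. Qed.

Definition endr_one : endr :=
  Sub id (asboolT (homog_sum_comp endr_deg_subgroups endr_id_deg)).

Fact endr_mulA : associative endr_mul.
Proof. by move=> x y z; apply: val_inj. Qed.
Fact endr_mul1 : left_id endr_one endr_mul.
Proof. by move=> x; apply: val_inj. Qed.
Fact endr_1mul : right_id endr_one endr_mul.
Proof. by move=> x; apply: val_inj. Qed.
Fact endr_mulDl : left_distributive endr_mul +%R.
Proof.
move=> x y z; apply: val_inj; apply/funext => w.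
have lz := endr_linear z.
rewrite /= -[LHS]/(\val z (\val x w + \val y w)).
exact: linear_morphD.
Qed.
Fact endr_mulDr : right_distributive endr_mul +%R.
Proof. by move=> x y z; apply: val_inj; apply/funext. Qed.
HB.instance Definition _ := GRing.Zmodule_isPzRing.Build endr
  endr_mulA endr_mul1 endr_1mul endr_mulDl endr_mulDr.

Fact endr_in_deg k : endr_deg 1%g (fun w => ga_in A k *: w).
Proof.
split=> [a u v|g w cw]; first by rewrite scalerDr -ga_scal_central.
by rewrite mulg1; apply: gm_scale.
Qed.

Definition endr_in (k : F) : endr :=
  Sub (fun w : W => ga_in A k *: w)
    (asboolT (homog_sum_comp endr_deg_subgroups (endr_in_deg k))).

Fact endr_in_zmod : zmod_morphism endr_in.
Proof.
by move=> k l; apply: val_inj; apply/funext => w; rewrite /= rmorphB scalerBl.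
Qed.
Fact endr_in_monoid : monoid_morphism endr_in.
Proof.
split=> [|k l]; apply: val_inj; apply/funext => w.
  by rewrite /= rmorph1 scale1r.
by rewrite /= mulrC rmorphM scalerA.
Qed.
HB.instance Definition _ :=
  GRing.isZmodMorphism.Build F endr endr_in endr_in_zmod.
HB.instance Definition _ :=
  GRing.isMonoidMorphism.Build F endr endr_in endr_in_monoid.

Fact endr_central k (x : endr) : endr_in k * x = x * endr_in k.
Proof.
apply: val_inj; apply/funext => w /=.
have lx := endr_linear x; have x0 : \val x 0 = 0.
  by apply: (addrI (\val x 0)); rewrite -(linear_morphD lx) !addr0.
by rewrite -[_ *: w]addr0 lx x0 addr0.
Qed.

Definition endr_comp (h : G) : set endr := [set phi | endr_deg h (\val phi)].

Fact endr_grading : grading endr_comp.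
Proof.
apply: sub_grading; [exact: endr_deg_subgroups|exact: endr_deg_indep| |].
- move=> h x cx; apply/asboolP.
  exact: (homog_sum_comp endr_deg_subgroups cx).
- by move=> x /asboolP.
Qed.

Fact endr_mul_comp g h (x y : endr) :
  endr_comp g x -> endr_comp h y -> endr_comp (g * h)%g (x * y).
Proof.
move=> [lx cx] [ly cy]; split=> [|k w cw]; first exact: endr_linear.
by rewrite mulgA; apply: cy; apply: cx.
Qed.

Fact endr_scale_comp g k (x : endr) :
  endr_comp g x -> endr_comp g (endr_in k * x).
Proof.
move=> cx; rewrite -[g]mul1g; apply: endr_mul_comp => //.
exact: endr_in_deg.
Qed.

Definition endr_alg : grAlg F G :=
  @GrAlg F G endr endr_in endr_central endr_comp endr_grading
    endr_scale_comp endr_mul_comp.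

End Endr.

(* Cocycles are not assumed to be normalized. *)
Record cocycle (F : fieldType) (G : groupType) := Cocycle {
  cocycle_fun :> G -> G -> F;
  cocycle_neq0 : forall g h, cocycle_fun g h != 0;
  cocycleP : forall g h k,
    cocycle_fun g h * cocycle_fun (g * h)%g k =
    cocycle_fun h k * cocycle_fun g (h * k)%g }.
HB.instance Definition _ F G := gen_eqMixin (cocycle F G).
HB.instance Definition _ F G := gen_choiceMixin (cocycle F G).

Section Cohomology.
Context (F : fieldType) (G : groupType).
Implicit Types a b c : cocycle F G.

Lemma cocycle_ext a b : (forall g h, a g h = b g h) -> a = b.
Proof.
case: a b => [a a0 aP] [b b0 bP] /= E.
have {E} E : a = b by apply/funext => g; apply/funext => h; apply: E.
move: a0 aP; rewrite E => a0 aP.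
by congr Cocycle; apply: Prop_irrelevance.
Qed.

Definition cohomologous a b : Prop :=
  exists l : G -> F, (forall g, l g != 0) /\
    forall g h, a g h = l g * l h / l (g * h)%g * b g h.

Definition cohom a b : bool := `[< cohomologous a b >].

Fact cohom_refl : reflexive cohom.
Proof.
move=> a; apply/asboolP; exists (fun=> 1); split=> [g|g h].
  exact: oner_neq0.
by rewrite divr1 !mul1r.
Qed.

Let cohom_symW a b : cohomologous a b -> cohomologous b a.
Proof.
move=> [l [l0 E]]; exists (fun g => (l g)^-1); split=> [g|g h].
  by rewrite invr_eq0.
by rewrite E; field; rewrite !l0 ?oner_neq0.
Qed.

Fact cohom_sym : symmetric cohom.
Proof. by move=> a b; apply/asboolP/asboolP; apply: cohom_symW. Qed.

Fact cohom_trans : transitive cohom.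
Proof.
move=> b a c /asboolP[l [l0 E]] /asboolP[m [m0 E']]; apply/asboolP.
exists (fun g => l g * m g); split=> [g|g h]; first by rewrite mulf_neq0.
by rewrite E E'; field; rewrite ?l0 ?m0 ?oner_neq0.
Qed.
Canonical cohom_equiv := EquivRel cohom cohom_refl cohom_sym cohom_trans.

Definition H2 : Type := {eq_quot cohom_equiv}.
HB.instance Definition _ := Choice.on H2.
HB.instance Definition _ := EqQuotient.on H2.

Definition H2class a : H2 := \pi_H2 a.

Lemma H2classP a b : cohomologous a b <-> H2class a = H2class b.
Proof.
split=> [ab|/eqquotP /asboolP //].
by apply/eqquotP; apply/asboolP.
Qed.

Fact cocycle_mul_neq0 a b g h : a g h * b g h != 0.
Proof. by rewrite mulf_neq0 ?cocycle_neq0. Qed.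
Fact cocycle_mulP a b g h k :
  a g h * b g h * (a (g * h)%g k * b (g * h)%g k) =
  a h k * b h k * (a g (h * k)%g * b g (h * k)%g).
Proof. by rewrite mulrACA !cocycleP mulrACA. Qed.
Definition cocycle_mul a b := Cocycle (cocycle_mul_neq0 a b) (cocycle_mulP a b).

Fact cocycle_inv_neq0 a g h : (a g h)^-1 != 0.
Proof. by rewrite invr_eq0 cocycle_neq0. Qed.
Fact cocycle_invP a g h k :
  (a g h)^-1 * (a (g * h)%g k)^-1 = (a h k)^-1 * (a g (h * k)%g)^-1.
Proof. by rewrite -!invfM cocycleP. Qed.
Definition cocycle_inv a := Cocycle (cocycle_inv_neq0 a) (cocycle_invP a).

Definition cocycle_one : cocycle F G :=
  @Cocycle F G (fun _ _ => 1) (fun _ _ => oner_neq0 F) (fun _ _ _ => erefl).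

Definition H2_mul (x y : H2) : H2 := H2class (cocycle_mul (repr x) (repr y)).
Definition H2_inv (x : H2) : H2 := H2class (cocycle_inv (repr x)).

Lemma H2classM a b :
  H2_mul (H2class a) (H2class b) = H2class (cocycle_mul a b).
Proof.
have /H2classP[l [l0 E]] : H2class (repr (H2class a)) = H2class a.
  exact: reprK.
have /H2classP[m [m0 E']] : H2class (repr (H2class b)) = H2class b.
  exact: reprK.
apply/H2classP; exists (fun g => l g * m g); split=> [g|g h].
  by rewrite mulf_neq0.
by rewrite /= E E'; field; rewrite ?l0 ?m0 ?oner_neq0.
Qed.

Lemma H2classV a : H2_inv (H2class a) = H2class (cocycle_inv a).
Proof.
have /H2classP[l [l0 E]] : H2class (repr (H2class a)) = H2class a.
  exact: reprK.
apply/H2classP; exists (fun g => (l g)^-1); split=> [g|g h].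
  by rewrite invr_eq0.
by rewrite /= E; field; rewrite !l0 ?cocycle_neq0 ?oner_neq0.
Qed.

Lemma H2_ind (P : H2 -> Prop) : (forall a, P (H2class a)) -> forall x, P x.
Proof. by move=> H x; rewrite -[x]reprK; apply: H. Qed.

Fact H2_mulC : commutative H2_mul.
Proof.
elim/H2_ind=> a; elim/H2_ind=> b; rewrite !H2classM; congr H2class.
by apply: cocycle_ext => g h /=; rewrite mulrC.
Qed.
Fact H2_mulA : associative H2_mul.
Proof.
elim/H2_ind=> a; elim/H2_ind=> b; elim/H2_ind=> c.
rewrite (H2classM b c) (H2classM a b) !H2classM; congr H2class.
by apply: cocycle_ext => g h /=; rewrite mulrA.
Qed.
Fact H2_mul1 : left_id (H2class cocycle_one) H2_mul.
Proof.
elim/H2_ind=> a; rewrite !H2classM; congr H2class.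
by apply: cocycle_ext => g h /=; rewrite mul1r.
Qed.
Fact H2_1mul : right_id (H2class cocycle_one) H2_mul.
Proof. by move=> x; rewrite H2_mulC H2_mul1. Qed.
Fact H2_mulV : left_inverse (H2class cocycle_one) H2_inv H2_mul.
Proof.
elim/H2_ind=> a; rewrite H2classV H2classM; congr H2class.
by apply: cocycle_ext => g h /=; rewrite mulVf ?cocycle_neq0.
Qed.
Fact H2_Vmul : right_inverse (H2class cocycle_one) H2_inv H2_mul.
Proof. by move=> x; rewrite H2_mulC H2_mulV. Qed.
HB.instance Definition _ :=
  isGroup.Build H2 H2_mulA H2_mul1 H2_1mul H2_mulV H2_Vmul.

Lemma cocycle1l a g : a 1%g g = a 1%g 1%g.
Proof.
have := cocycleP a 1%g 1%g g; rewrite !mul1g => E.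
by apply: (mulIf (cocycle_neq0 a 1%g g)).
Qed.
Lemma cocycle1r a g : a g 1%g = a 1%g 1%g.
Proof.
have := cocycleP a g 1%g 1%g; rewrite !mulg1.
exact: (mulIf (cocycle_neq0 a g 1%g)).
Qed.

End Cohomology.

Section TwistedGroupAlgebra.
Context (F : fieldType) (G : groupType) (alpha : cocycle F G).

Definition finsupp_pred : {pred (G -> F)} := fun f =>
  `[< exists s : seq G, forall g, f g != 0 -> g \in s >].

Fact finsupp_closed : zmod_closed finsupp_pred.
Proof.
split; rewrite ?unfold_in.
  by apply/asboolP; exists [::] => g; rewrite eqxx.
move=> f f'; rewrite !unfold_in => /asboolP[s fs] /asboolP[s' fs'].
apply/asboolP; exists (s ++ s') => g.
rewrite mem_cat; apply: contraR; rewrite negb_or => /andP[gs gs'].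
have /eqP fg0 : f g == 0 by apply: contraNT gs => /fs.
have /eqP fg0' : f' g == 0 by apply: contraNT gs' => /fs'.
by rewrite -[(f - f') g]/(f g - f' g) fg0 fg0' subrr.
Qed.
HB.instance Definition _ :=
  GRing.isZmodClosed.Build (G -> F) finsupp_pred finsupp_closed.

Definition tga : Type := {f : G -> F | finsupp_pred f}.
HB.instance Definition _ := SubChoice.on tga.
HB.instance Definition _ := [SubChoice_isSubZmodule of tga by <:].

Fact mon_subproof (k : F) (g : G) :
  finsupp_pred (fun h => if h == g then k else 0).
Proof.
apply/asboolP; exists [:: g] => h; rewrite mem_seq1.
by case: (h == g); rewrite // eqxx.
Qed.
(* the homogeneous element k v_g *)
Definition mon (k : F) (g : G) : tga := Sub _ (mon_subproof k g).

Fact supp_key (f : tga) : exists s : seq G, forall g, \val f g != 0 -> g \in s.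
Proof. exact: asboolW (valP f). Qed.

Definition supp (f : tga) : seq G :=
  [seq g <- undup (sval (cid (supp_key f))) | \val f g != 0].

Lemma mem_supp f g : (g \in supp f) = (\val f g != 0).
Proof.
rewrite mem_filter mem_undup; case: cid => s fs /=.
by case: eqP => //= /eqP /fs.
Qed.
Lemma supp_uniq f : uniq (supp f).
Proof. exact: filter_uniq (undup_uniq _). Qed.

Lemma sum_supp (V : nmodType) (f : tga) (s : seq G) (H : G -> V) :
  uniq s -> {subset supp f <= s} -> (forall g, \val f g = 0 -> H g = 0) ->
  \sum_(g <- s) H g = \sum_(g <- supp f) H g.
Proof.
move=> us fs H0; rewrite (bigID (mem (supp f))) /= [X in _ + X]big1 ?addr0.
  rewrite -big_filter; apply: perm_big; apply: uniq_perm.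
  - exact: filter_uniq.
  - exact: supp_uniq.
  - move=> g; rewrite mem_filter; case: (boolP (g \in supp f)) => //=.
    exact: fs.
by move=> g; rewrite mem_supp negbK => /eqP /H0.
Qed.

Lemma monD k l g : mon (k + l) g = mon k g + mon l g.
Proof.
apply: val_inj; apply/funext => h.
rewrite raddfD /= -[RHS]/((if h == g then k else 0) + (if h == g then l else 0)).
by case: eqP; rewrite ?addr0.
Qed.
Lemma mon0 g : mon 0 g = 0.
Proof. by apply: (addrI (mon 0 g)); rewrite -monD !addr0. Qed.

Lemma tga_sum f : f = \sum_(g <- supp f) mon (\val f g) g.
Proof.
apply: val_inj; apply/funext => h; rewrite raddf_sum fct_sumE /=.
have [hs|] := boolP (h \in supp f).
  rewrite (bigD1_seq h) ?supp_uniq //= eqxx big1 ?addr0 // => g.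
  by rewrite eq_sym => /negbTE ->.
rewrite mem_supp negbK => /eqP fh0; rewrite [LHS]fh0 big1 // => g _.
by case: eqP => // <-.
Qed.

Lemma tga_ind (P : tga -> Prop) :
  P 0 -> (forall x y, P x -> P y -> P (x + y)) ->
  (forall k g, P (mon k g)) -> forall x, P x.
Proof. by move=> P0 PD Pm x; rewrite [x]tga_sum; apply: big_ind. Qed.

Definition tga_mul (f f' : tga) : tga :=
  \sum_(g <- supp f) \sum_(h <- supp f')
     mon (\val f g * \val f' h * alpha g h) (g * h)%g.

Lemma tga_mulE f f' s t :
  uniq s -> uniq t -> {subset supp f <= s} -> {subset supp f' <= t} ->
  tga_mul f f' = \sum_(g <- s) \sum_(h <- t)
     mon (\val f g * \val f' h * alpha g h) (g * h)%g.
Proof.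
move=> us ut fs ft; rewrite (sum_supp (f := f) (s := s)) //; last first.
  by move=> g ->; rewrite big1 // => h _; rewrite !mul0r mon0.
apply: eq_bigr => g _; rewrite (sum_supp (f := f') (s := t)) // => h ->.
by rewrite mulr0 mul0r mon0.
Qed.

Lemma tga_mulD : biadditive tga_mul.
Proof.
have cover (f f' : tga) : exists s, [/\ uniq s, {subset supp f <= s},
    {subset supp f' <= s} & {subset supp (f + f')%R <= s}].
  exists (undup (supp f ++ supp f' ++ supp (f + f')%R)).
  by split; rewrite ?undup_uniq // => g gs;
    rewrite mem_undup !mem_cat gs ?orbT.
split=> [f f' e|e f f'].
- have [s [us fs fs' fs'']] := cover f f'.
  rewrite !(tga_mulE (s := s) us (supp_uniq e)) // -big_split.
  apply: eq_bigr => g _; rewrite -big_split; apply: eq_bigr => h _.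
  by rewrite raddfD -[(_ + _) g]/(\val f g + \val f' g) !mulrDl monD.
- have [s [us fs fs' fs'']] := cover f f'.
  rewrite !(tga_mulE (t := s) (supp_uniq e) us) // -big_split.
  apply: eq_bigr => g _; rewrite -big_split; apply: eq_bigr => h _.
  by rewrite raddfD -[(_ + _) h]/(\val f h + \val f' h) mulrDr mulrDl monD.
Qed.

Lemma supp_mon k g : {subset supp (mon k g) <= [:: g]}.
Proof.
move=> h; rewrite mem_supp inE /=; apply: contraNT => /negbTE ->.
by rewrite eqxx.
Qed.

Lemma tga_mul_mon k g l h :
  tga_mul (mon k g) (mon l h) = mon (k * l * alpha g h) (g * h)%g.
Proof.
rewrite (tga_mulE (s := [:: g]) (t := [:: h])) //; try exact: supp_mon.
by rewrite !big_seq1 /= !eqxx.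
Qed.

Let mulDl : left_distributive tga_mul +%R.
Proof. by move=> x y z; apply: (proj1 tga_mulD). Qed.
Let mulDr : right_distributive tga_mul +%R.
Proof. by move=> x y z; apply: (proj2 tga_mulD). Qed.

(* the unit of the twisted group algebra is alpha(e, e)^-1 v_e *)
Definition tga_in (k : F) : tga := mon (k / alpha 1%g 1%g) 1%g.

Fact tga_mulA : associative tga_mul.
Proof.
move=> x y z; elim/tga_ind: x => [|x x' E E'|k g].
- by rewrite !(biadd0l tga_mulD).
- by rewrite !mulDl E E'.
elim/tga_ind: y => [|y y' E E'|l h].
- by rewrite !(biadd0l tga_mulD) !(biadd0r tga_mulD) (biadd0l tga_mulD).
- by rewrite mulDl !mulDr E E' mulDl.
elim/tga_ind: z => [|z z' E E'|m i].
- by rewrite !(biadd0r tga_mulD).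
- by rewrite !mulDr E E'.
rewrite !tga_mul_mon mulgA; congr mon.
transitivity (k * l * m * (alpha h i * alpha g (h * i)%g)); first by ring.
by rewrite -cocycleP; ring.
Qed.

Lemma tga_in_mul k l g : tga_mul (tga_in k) (mon l g) = mon (k * l) g.
Proof.
rewrite tga_mul_mon mul1g cocycle1l; congr mon; field.
exact: cocycle_neq0.
Qed.
Lemma tga_mul_in k l g : tga_mul (mon l g) (tga_in k) = mon (k * l) g.
Proof.
rewrite tga_mul_mon mulg1 cocycle1r; congr mon; field.
exact: cocycle_neq0.
Qed.

Fact tga_mul1 : left_id (tga_in 1) tga_mul.
Proof.
elim/tga_ind => [|x x' E E'|k g].
- by rewrite (biadd0r tga_mulD).
- by rewrite mulDr E E'.
- by rewrite tga_in_mul mul1r.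
Qed.
Fact tga_1mul : right_id (tga_in 1) tga_mul.
Proof.
elim/tga_ind => [|x x' E E'|k g].
- by rewrite (biadd0l tga_mulD).
- by rewrite mulDl E E'.
- by rewrite tga_mul_in mul1r.
Qed.
HB.instance Definition _ := GRing.Zmodule_isPzRing.Build tga
  tga_mulA tga_mul1 tga_1mul mulDl mulDr.

Fact tga_in_zmod : zmod_morphism tga_in.
Proof.
move=> k l; apply/eqP; rewrite eq_sym subr_eq; apply/eqP.
by rewrite /tga_in -monD -mulrDl subrK.
Qed.
Fact tga_in_monoid : monoid_morphism tga_in.
Proof. by split=> // k l; rewrite [RHS]tga_in_mul /tga_in mulrA. Qed.
HB.instance Definition _ :=
  GRing.isZmodMorphism.Build F tga tga_in tga_in_zmod.
HB.instance Definition _ :=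
  GRing.isMonoidMorphism.Build F tga tga_in tga_in_monoid.

Fact tga_central k (x : tga) : tga_in k * x = x * tga_in k.
Proof.
elim/tga_ind: x => [|x x' E E'|l g]; first by rewrite mulr0 mul0r.
- by rewrite mulrDl mulrDr E E'.
- by rewrite [LHS]tga_in_mul [RHS]tga_mul_in.
Qed.

Definition tga_comp (g : G) : set tga :=
  [set f | forall h, h != g -> \val f h = 0].

Lemma mon_comp k g : tga_comp g (mon k g).
Proof. by move=> h /= /negbTE ->. Qed.

Lemma tga_compE g f : tga_comp g f -> f = mon (\val f g) g.
Proof.
move=> cf; apply: val_inj; apply/funext => h /=.
by case: eqP => [-> //|/eqP /cf].
Qed.

Fact tga_grading : grading tga_comp.
Proof.
split.
- split=> [g|g x y cx cy] h hg; rewrite ?raddf0 // raddfB.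
  by rewrite -[LHS]/(\val x h - \val y h) cx // cy // subrr.
- move=> f; exists (supp f), (fun g => mon (\val f g) g).
  by split; [move=> g; apply: mon_comp|apply: tga_sum].
- move=> s f us cf E g gs; rewrite (tga_compE (cf g)).
  have := congr1 (fun u : tga => \val u g) E.
  rewrite raddf_sum fct_sumE raddf0 (bigD1_seq g) //= big1 ?addr0 => [->|h hg].
    exact: mon0.
  by apply: cf; rewrite eq_sym.
Qed.

Fact tga_mul_comp g h (x y : tga) :
  tga_comp g x -> tga_comp h y -> tga_comp (g * h)%g (x * y).
Proof.
move=> /tga_compE -> /tga_compE ->; rewrite -[_ * _]/(tga_mul _ _) tga_mul_mon.
exact: mon_comp.
Qed.

Fact tga_scale_comp g k (x : tga) : tga_comp g x -> tga_comp g (tga_in k * x).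
Proof.
by move=> cx; rewrite -[g]mul1g; apply: tga_mul_comp => //; apply: mon_comp.
Qed.

Definition twisted_group_alg : grAlg F G :=
  @GrAlg F G tga tga_in tga_central tga_comp tga_grading
    tga_scale_comp tga_mul_comp.

End TwistedGroupAlgebra.

Section Induction.
Context (F : fieldType) (G : groupType) (A : grAlg F G) (M : lmodType (base A)).

Definition ind : Type :=
  tensor (fun (a : A) (r : base A) => a * \val r)
         (fun (r : base A) (m : M) => r *: m).
HB.instance Definition _ := GRing.Zmodule.on ind.

Definition ipure (a : A) (m : M) : ind := tpure _ _ a m.

Definition ind_act (a : A) (x : ind) : ind :=
  tlift (fun b m => ipure (a * b) m) x.

Fact ind_act_bal a : balanced (fun (a : A) (r : base A) => a * \val r)
  (fun (r : base A) (m : M) => r *: m) (fun b m => ipure (a * b) m).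
Proof.
split; [split|] => *; rewrite /ipure.
- by rewrite mulrDr tpureDl.
- by rewrite tpureDr.
- by rewrite mulrA tpureZ.
Qed.

Lemma ind_actE a b m : ind_act a (ipure b m) = ipure (a * b) m.
Proof. by rewrite /ind_act tlift_pure //; apply: ind_act_bal. Qed.

Lemma ind_ind (P : ind -> Prop) :
  P 0 -> (forall x y, P x -> P y -> P (x + y)) ->
  (forall a m, P (ipure a m)) -> forall x, P x.
Proof. exact: tens_ind. Qed.

Fact ind_actDr : right_distributive ind_act +%R.
Proof. by move=> a x y; rewrite /ind_act tliftD //; apply: ind_act_bal. Qed.
Lemma ind_act0 a : ind_act a 0 = 0.
Proof. by apply: (addrI (ind_act a 0)); rewrite -ind_actDr !addr0. Qed.
Fact ind_actDl x : {morph ind_act^~ x : a b / a + b}.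
Proof.
move=> a b; elim/ind_ind: x => [|x y E E'|c m].
- by rewrite !ind_act0 addr0.
- by rewrite !ind_actDr E E' addrACA.
- by rewrite !ind_actE mulrDl /ipure tpureDl.
Qed.
Fact ind_actA a b x : ind_act a (ind_act b x) = ind_act (a * b) x.
Proof.
elim/ind_ind: x => [|x y E E'|c m].
- by rewrite !ind_act0.
- by rewrite !ind_actDr E E'.
- by rewrite !ind_actE mulrA.
Qed.
Fact ind_act1 : left_id 1 ind_act.
Proof.
elim/ind_ind => [|x y E E'|c m].
- by rewrite !ind_act0.
- by rewrite !ind_actDr E E'.
- by rewrite !ind_actE mul1r.
Qed.
HB.instance Definition _ := GRing.Zmodule_isLmodule.Build A ind
  ind_actA ind_act1 ind_actDr ind_actDl.

Definition ind_comp (g : G) : set ind := tspan _ _ (ga_comp A g) setT.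

Fact ind_grading : grading ind_comp.
Proof.
have gr := ga_grading A.
have cs : subgroups ind_comp.
  split=> [g|g x y]; first exact: tspan0.
  by apply: tspanB => v; apply: (compN gr).
split=> //.
- elim/ind_ind => [|x y|a m]; first exact: homog_sum0.
    exact: homog_sumD.
  have [s ->] := proj_decomp gr a.
  exists s, (fun g => ipure (proj gr g a) m); split.
    by move=> g; apply: tspan_pure => //; apply: proj_comp.
  apply: (big_morph (fun b => ipure b m)) => [b c|].
    exact: tpureDl.
  exact: tpure0l.
- pose b g (a : A) (m : M) := ipure (proj gr g a) m.
  have bb g : balanced (fun (a : A) (r : base A) => a * \val r)
      (fun (r : base A) (m : M) => r *: m) (b g).
    split; [split|] => [a a' m|a m m'|a r m]; rewrite /b /ipure.
    + by rewrite projD tpureDl.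
    + by rewrite tpureDr.
    + rewrite -tpureZ (proj_shift gr gr (m := fun a => a * \val r) (sh := id)) //.
        by move=> x y; rewrite mulrDl.
      move=> h x cx; rewrite -[h]mulg1; apply: ga_mul => //.
      exact: base_comp.
  apply: (indep_of_proj (P := fun g => tlift (b g))).
  + by move=> g; apply: tliftD.
  + move=> g; apply: tspan_ind => [|x y|v w cv _].
    * by rewrite tlift0.
    * by rewrite tliftD // => -> ->.
    * by rewrite tlift_pure // /b (proj_id _ _ cv) eqxx.
  + move=> g h + + hg; apply: tspan_ind => [|x y|v w cv _].
    * by rewrite tlift0.
    * by rewrite tliftD // => -> ->; rewrite addr0.
    * rewrite tlift_pure // /b (proj_id _ _ cv) eq_sym (negbTE hg).
      exact: tpure0l.
Qed.

Fact ind_comp_act g h (a : A) (x : ind) :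
  ga_comp A g a -> ind_comp h x -> ind_comp (g * h)%g (a *: x).
Proof.
move=> ca; move: x; apply: tspan_ind => [|x y cx cy|b m cb _].
- by rewrite scaler0; apply: tspan0.
- by rewrite scalerDr; apply: tspanD.
rewrite -[_ *: _]/(ind_act a (ipure b m)) ind_actE.
by apply: tspan_pure => //; apply: ga_mul.
Qed.

Definition ind_mod : grMod A := GrMod ind_grading ind_comp_act.

End Induction.

Section GradedQuotient.
Context (F : fieldType) (G : groupType) (A : grAlg F G) (W : grMod A).

Record gsubmod := GSubmod {
  gs_set :> W -> Prop;
  gs_proof : graded_submodule gs_set }.

Lemma gsub_proj (N : gsubmod) g w : N w -> N (proj (gm_grading W) g w).
Proof.
have [sN hN] := gs_proof N; move=> /hN [s [f [cf ->]]].
rewrite proj_sum; last by move=> h; have [] := cf h.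
apply: big_ind => [||h _]; [exact: (subm0 sN)|exact: (submD sN)|].
by have [] := cf h.
Qed.

Section Quot.
Context (N : gsubmod).

Definition gs_pred : {pred W} := fun w => `[< N w >].

Fact gs_closed : zmod_closed gs_pred.
Proof.
have [sN _] := gs_proof N; split; rewrite ?unfold_in.
  by apply/asboolP; apply: (subm0 sN).
move=> x y; rewrite !unfold_in => /asboolP Nx /asboolP Ny.
apply/asboolP; apply: (submD sN) => //; rewrite -scaleN1r.
exact: (submZ sN).
Qed.
HB.instance Definition _ := GRing.isZmodClosed.Build W gs_pred gs_closed.

Definition gquot : Type := Quotient.quot gs_pred.
HB.instance Definition _ := GRing.Zmodule.on gquot.
HB.instance Definition _ := EqQuotient.on gquot.

Definition gpi (w : W) : gquot := \pi_gquot w.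

Lemma gpiP v w : N (v - w) <-> gpi v = gpi w.
Proof.
split=> [Nvw|/eqquotP /asboolP //].
by apply/eqquotP; apply/asboolP.
Qed.
Lemma gpiD : {morph gpi : v w / v + w}.
Proof. exact: Quotient.pi_add. Qed.
Lemma gpiB : {morph gpi : v w / v - w}.
Proof. by move=> v w; rewrite gpiD; congr (_ + _); apply: Quotient.pi_opp. Qed.
Lemma gpi0 : gpi 0 = 0.
Proof. by apply: (addrI (gpi 0)); rewrite -gpiD !addr0. Qed.
Lemma gpi_sum (I : Type) (r : seq I) (f : I -> W) :
  gpi (\sum_(i <- r) f i) = \sum_(i <- r) gpi (f i).
Proof. exact: (big_morph _ gpiD gpi0). Qed.
Lemma gquot_ind (P : gquot -> Prop) : (forall w, P (gpi w)) -> forall x, P x.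
Proof. by move=> H x; rewrite -[x]reprK; apply: H. Qed.

Definition gquot_act (a : A) (x : gquot) : gquot := gpi (a *: repr x).

Lemma gquot_actE a w : gquot_act a (gpi w) = gpi (a *: w).
Proof.
have [sN _] := gs_proof N.
apply/gpiP; rewrite -scalerBr; apply: (submZ sN).
by apply/gpiP; apply: reprK.
Qed.

Fact gquot_actA a b x : gquot_act a (gquot_act b x) = gquot_act (a * b) x.
Proof. by elim/gquot_ind: x => w; rewrite !gquot_actE scalerA. Qed.
Fact gquot_act1 : left_id 1 gquot_act.
Proof. by elim/gquot_ind => w; rewrite !gquot_actE scale1r. Qed.
Fact gquot_actDr : right_distributive gquot_act +%R.
Proof.
move=> a; elim/gquot_ind => v; elim/gquot_ind => w.
by rewrite -gpiD !gquot_actE -gpiD scalerDr.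
Qed.
Fact gquot_actDl x : {morph gquot_act^~ x : a b / a + b}.
Proof.
by move=> a b; elim/gquot_ind: x => w; rewrite !gquot_actE -gpiD scalerDl.
Qed.
HB.instance Definition _ := GRing.Zmodule_isLmodule.Build A gquot
  gquot_actA gquot_act1 gquot_actDr gquot_actDl.

Definition gquot_comp (g : G) : set gquot := gpi @` gm_comp W g.

Fact gquot_grading : grading gquot_comp.
Proof.
pose gr := gm_grading W; split.
- split=> [g|g _ _ [v cv <-] [w cw <-]].
    by exists 0; [apply: (comp0 gr)|apply: gpi0].
  by exists (v - w); [apply: (compB gr)|apply: gpiB].
- elim/gquot_ind=> w; have [s [f [cf ->]]] := gr_span gr w.
  exists s, (fun g => gpi (f g)); split=> [g|]; first by exists (f g).
  exact: gpi_sum.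
- move=> s f us cf E g gs.
  have /choice[e ce] : forall h, exists w, gm_comp W h w /\ gpi w = f h.
    by move=> h; have [w cw fw] := cf h; exists w.
  have /gpiP : gpi (\sum_(h <- s) e h) = gpi 0.
    by rewrite gpi_sum gpi0 -[RHS]E; apply: eq_bigr => h _; case: (ce h).
  rewrite subr0 => /(gsub_proj g); rewrite proj_sum; last by move=> h; case: (ce h).
  rewrite big_pred1_seq // => Neg; have [_ <-] := ce g.
  by rewrite -gpi0; apply/gpiP; rewrite subr0.
Qed.

Fact gquot_comp_act g h (a : A) (x : gquot) :
  ga_comp A g a -> gquot_comp h x -> gquot_comp (g * h)%g (a *: x).
Proof.
move=> ca [w cw <-]; exists (a *: w); first exact: gm_act.
by rewrite -[RHS]/(gquot_act a (gpi w)) gquot_actE.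
Qed.

Definition gquot_mod : grMod A := GrMod gquot_grading gquot_comp_act.

End Quot.

Definition zero_e_comp (N : set W) : Prop :=
  forall w, N w -> gm_comp W 1%g w -> w = 0.

(* The union of all graded submodules with zero component in degree e is itself
   one of them (directedness under sums), hence the largest. *)
Definition max_zero_e : set W :=
  [set w | exists N, [/\ graded_submodule N, zero_e_comp N & N w]].

Fact max_zero_e_sub : graded_submodule max_zero_e.
Proof.
pose gr := gm_grading W; split; first split.
- exists [set 0]; split=> //; split; first split=> //.
  + by move=> v w /= -> ->; rewrite addr0.
  + by move=> r v /= ->; rewrite scaler0.
  + move=> w /= ->; exists [::], (fun=> 0); rewrite big_nil; split=> // g.
    by split=> //; apply: (comp0 gr).
- move=> v w [N [sN zN Nv]] [N' [sN' zN' Nw]].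
  exists [set x | exists y z, [/\ N y, N' z & x = y + z]]; split; last 1 first.
  + by exists v, w.
  + split; first split.
    * by exists 0, 0; rewrite addr0; split=> //; [apply: (subm0 sN)|apply: (subm0 sN')].
    * move=> _ _ [y [z [Ny N'z ->]]] [y' [z' [Ny' N'z' ->]]].
      by exists (y + y'), (z + z'); rewrite addrACA; split=> //; [apply: (submD sN)|apply: (submD sN')].
    * move=> r _ [y [z [Ny N'z ->]]].
      by exists (r *: y), (r *: z); rewrite scalerDr; split=> //; [apply: (submZ sN)|apply: (submZ sN')].
    * move=> _ [y [z [Ny N'z ->]]].
      have cs : subgroups (fun g : G => gm_comp W g `&`
          [set x | exists y z, [/\ N y, N' z & x = y + z]]).
        split=> [g|g x1 x2 [c1 [y1 [z1 [Ny1 Nz1 E1]]]] [c2 [y2 [z2 [Ny2 Nz2 E2]]]]].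
          split; first exact: (comp0 gr).
          by exists 0, 0; rewrite addr0; split=> //; [apply: (subm0 sN)|apply: (subm0 sN')].
        split; first exact: (compB gr).
        rewrite E1 E2 opprD addrACA; exists (y1 - y2), (z1 - z2); split=> //.
          by apply: (submD sN) => //; rewrite -scaleN1r; apply: (submZ sN).
        by apply: (submD sN') => //; rewrite -scaleN1r; apply: (submZ sN').
      apply: (homog_sumD cs).
        have [s [f [cf ->]]] := gsub_homog sN Ny; exists s, f; split=> // g.
        have [cg Ng] := cf g; split=> //; exists (f g), 0.
        by rewrite addr0; split=> //; apply: (subm0 sN').
      have [s [f [cf ->]]] := gsub_homog sN' N'z; exists s, f; split=> // g.
      have [cg Ng] := cf g; split=> //; exists 0, (f g).
      by rewrite add0r; split=> //; apply: (subm0 sN).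
  + move=> _ [y [z [Ny N'z ->]]] cyz.
    have yz : y + z = proj gr 1%g y + proj gr 1%g z.
      by rewrite -projD (proj_id gr 1%g cyz) eqxx.
    have Ey : proj gr 1%g y = 0.
      apply: (zN _ _ (proj_comp gr _ _)).
      exact: (gsub_proj (N := GSubmod sN)).
    have Ez : proj gr 1%g z = 0.
      apply: (zN' _ _ (proj_comp gr _ _)).
      exact: (gsub_proj (N := GSubmod sN')).
    by rewrite yz Ey Ez addr0.
- by move=> r v [N [sN zN Nv]]; exists N; split=> //; apply: (submZ sN).
- move=> w [N [sN zN Nw]]; have [s [f [cf ->]]] := gsub_homog sN Nw.
  exists s, f; split=> // g; have [cg Ng] := cf g; split=> //.
  by exists N.
Qed.

End GradedQuotient.

Definition ind_bar (F : fieldType) (G : groupType) (A : grAlg F G)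
    (M : lmodType (base A)) : grMod A :=
  gquot_mod (GSubmod (max_zero_e_sub (ind_mod M))).

(* The equivalence classes for [R] on the elements of [T] satisfying [P]. They
   are represented by predicates: [T] will be a type of modules, too large to be
   a [choiceType], which rules out [{eq_quot _}]. *)
Record eqclass (T : Type) (P : T -> Prop) (R : T -> T -> Prop) := EqClass {
  ec_mem :> T -> Prop;
  ec_proof : exists x, P x /\ forall y, ec_mem y <-> P y /\ R x y }.

Section Irr.
Context (F : fieldType) (G : groupType) (A : grAlg F G).

Definition module_iso (R : pzRingType) (M N : lmodType R) : Prop :=
  exists phi : {linear M -> N}, bijective phi.

(* absolutely simple over F: the A_e-endomorphisms are the scalars *)
Definition irr_module (M : lmodType (base A)) : Prop :=
  simple_module M /\
  forall phi : {linear M -> M}, exists k : F, forall m, phi m = base_in A k *: m.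

Definition Irr : Type := eqclass irr_module (@module_iso (base A)).

(* The property in [irrG_inv] depends only on the isomorphism class of [M]. *)
Record IrrG := MkIrrG {
  irrG_class : Irr;
  irrG_inv : exists2 M, irrG_class M & G_invariant (ind_bar M) }.

(* [xget] picks the class [alpha] with End^r(G)(ind_bar M) isomorphic to
   F^alpha G; it exists and is unique, so the default value is never used. *)
Definition obstruction (c : IrrG) : H2 F G :=
  xget 1%g [set x | exists M (alpha : cocycle F G), [/\ irrG_class c M, x = H2class alpha &
    galg_iso (endr_alg (ind_bar M)) (twisted_group_alg alpha)]].

End Irr.

Section IrrInv.
Context (F : fieldType) (G : groupType).

Record grPair := GrPair { gp_alg : grAlg F G; gp_mod :> grMod gp_alg }.

Definition G_equivariant (P Q : grPair) : Prop :=
  exists (psi : {rmorphism gp_alg P -> gp_alg Q}) (phi : {additive P -> Q}),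
    [/\ is_galg_iso psi,
        bijective phi,
        forall g w, gm_comp P g w -> gm_comp Q g (phi w),
        forall k w, phi (ga_in (gp_alg P) k *: w) =
                    ga_in (gp_alg Q) k *: phi w
      & forall x w, phi (x *: w) = psi x *: phi w].

Definition gprod (P Q : grPair) : grPair := GrPair (gtens_mod P Q).

(* The types [Kalg] and [Kmod] only serve as cardinal bounds. *)
Definition irr_inv (Kalg Kmod : Type) (P : grPair) : Prop :=
  [/\ [set: gp_alg P] #<= [set: Kalg], [set: P] #<= [set: Kmod],
      G_invariant P & abs_graded_simple P].

Definition IrrInv (Kalg Kmod : Type) : Type :=
  eqclass (irr_inv Kalg Kmod) G_equivariant.

End IrrInv.

(* Main.v *)
From HB Require Import structures.
Require Import Defs.
From mathcomp Require Import all_boot all_algebra.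
From mathcomp Require Import ring boolp classical_sets functions cardinality.

Set Implicit Arguments.
Unset Strict Implicit.
Unset Printing Implicit Defensive.

Import GRing.Theory.
Local Open Scope classical_set_scope.
Local Open Scope card_scope.
Local Open Scope ring_scope.

(** Three ideas carry the proof.

    Density.  Let [W] be absolutely graded simple and let [w <> 0] and [v] be
    homogeneous of the same degree [g].  If every element of [A_e] that kills
    [w] also kills [v], then [a w |-> a v] is a well-defined graded endomorphism
    of [W]: the elements [a v] with [a w = 0] form a graded submodule without
    component in degree [g], hence zero ([graded_extend]).  So [v] is a scalar
    multiple of [w], and an induction on the length of [s] turns this into a
    double annihilator theorem ([double_annihilator]): an element of [W_g] which
    is killed by all the [a] in [A_e] that kill a finite family [s] in [W_g] lies
    in the span of [s].  In a shortest expression of a homogeneous element of the graded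
    product as a sum of pure tensors, no factor lies in the span of the others
    ([minimal_rep]); therefore a suitable [a (x) 1] isolates one of the pure
    tensors.  This gives that the graded product of two G-invariant absolutely
    graded simple modules is absolutely graded simple ([gprod_simple],
    [gprod_abs_simple]).

    Universal property.  Additive maps out of a graded product amount to
    families of balanced forms on [U_g x V_g], one for each degree [g]
    ([graded_tensor]).  Functoriality ([gt_map]), commutativity ([gt_flip]) and
    associativity ([gt_assoc]) follow formally, for algebras and for modules at
    once, so that graded products induce a commutative and associative law on
    equivariance classes.  Its unit is the class of the group algebra acting on
    itself ([gprod_unit]).

    Obstructions.  For a G-invariant absolutely graded simple [W], the
    endomorphisms of each right degree [g] form a line spanned by a bijection
    [u_g], and [u_g u_h = alpha(g,h) u_(gh)] defines a cocycle [alpha].  Such a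
    family [u] ([realizes]) is the same thing as an isomorphism of the graded
    endomorphism algebra with the twisted group algebra of [alpha]
    ([realizes_of_iso], [iso_of_realizes]).  Families are determined up to
    rescaling ([realizes_cohomologous]), can be transported along equivariances
    ([realizes_equivariant]) and can be tensored, which multiplies the cocycles
    ([realizes_gprod]); so the class of [alpha] is a well-defined homomorphism.

    It remains to see that all the modules involved are admissible.  For a
    simple [M] with scalar endomorphisms, the quotient of the induced module by
    its largest graded submodule without component in degree [e] is generated by
    a copy of [M] in degree [e] that every nonzero graded submodule meets; hence
    it is absolutely graded simple ([ind_bar_abs_simple]).  It is also cyclic,
    which bounds its cardinality.  Graded products are quotients of sets of
    finite words, and an infinite set has no more finite words than elements
    ([infinite_seq_inj]). *)

(** * Words over an infinite set *)
Lemma card_leTTP T U :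
  [set: T] #<= [set: U] <-> exists f : T -> U, injective f.
Proof.
split=> [/card_leP[f]|[f fI]].
- pose g t := val (f (SigSub (mem_set I : t \in [set: T]))).
  exists g => a b /val_inj E.
  suff /(congr1 val) : SigSub (mem_set I : a \in [set: T])
    = SigSub (mem_set I : b \in [set: T]) by [].
  by apply: (@inj _ _ _ f) E; apply: mem_set.
- apply/inj_card_le/unsquash/injfunPex; exists f => // a b _ _; exact: fI.
Qed.

(** A maximal partial injection is defined everywhere on one of the two sides:
    otherwise it could be extended by one pair. *)
Lemma card_le_total T U :
  (exists f : T -> U, injective f) \/ (exists f : U -> T, injective f).
Proof.
pose P (S : set (T * U)) := forall p q, S p -> S q -> (p.1 = q.1 <-> p.2 = q.2).
have [|A [PA Amax]] := @Zorn_bigcup (T * U) P.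
  move=> S SP tot p q [X SX Xp] [Y SY Yq].
  by have [XY|YX] := tot X Y SX SY;
    [apply: (SP Y) => //; apply: XY|apply: (SP X) => //; apply: YX].
have [/choice[f Af]|/existsNP[t At]] :=
    pselect (forall t, exists u, A (t, u)).
  left; exists f => t t' E.
  by apply: (proj2 (PA (t, f t) (t', f t') (Af t) (Af t'))).
have [/choice[f Af]|/existsNP[u Au]] :=
    pselect (forall u, exists t, A (t, u)).
  right; exists f => u u' E.
  by apply: (proj1 (PA (f u, u) (f u', u') (Af u) (Af u'))).
exfalso; apply: (Amax (A `|` [set (t, u)])).
  split; first by move=> p Ap; left.
  move=> BA; have Atu : A (t, u) by apply: BA; right.
  by apply: At; exists u.
move=> [a b] [a' b'] [Ap|[-> ->]] [Aq|[-> ->]] /=; split=> E //.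
- exact: (proj1 (PA _ _ Ap Aq)).
- exact: (proj2 (PA _ _ Ap Aq)).
- by case: At; exists b; rewrite -E.
- by case: Au; exists a; rewrite -E.
- by case: At; exists b'; rewrite E.
- by case: Au; exists a'; rewrite E.
Qed.

Section SeqEmbedding.
Context (K : eqType).
Implicit Types (S : set (seq K * K)) (X : set K) (s : seq K).

Definition letters S : set K := [set x | exists y, S ([:: x], y)].

(** The graph of an injection from the words over a nonempty subset of [K] into
    that subset.  Using graphs makes a union of a chain of such codings a coding
    again, as needed for Zorn's lemma. *)
Definition word_coding S : Prop :=
  [/\ exists y, S ([::], y),
      forall p q, S p -> S q -> (p.1 = q.1 <-> p.2 = q.2),
      forall s y, S (s, y) -> letters S y
    & forall s, (exists y, S (s, y)) <-> forall x, x \in s -> letters S x].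

Lemma word_coding_bigcup (C : set (set (seq K * K))) : C !=set0 ->
  (forall S, C S -> word_coding S) -> total_on C subset ->
  word_coding (\bigcup_(S in C) S).
Proof.
move=> [S0 CS0] cC tot; set U := \bigcup_(S in C) S.
have sub S : C S -> letters S `<=` letters U.
  by move=> CS x [y Sy]; exists y, S.
split.
- by have [[y S0y] _ _ _] := cC _ CS0; exists y, S0.
- move=> p q [S CS Sp] [S' CS' Sq].
  have [SS|SS] := tot S S' CS CS'.
    by have [_ H _ _] := cC _ CS'; apply: H => //; apply: SS.
  by have [_ H _ _] := cC _ CS; apply: H => //; apply: SS.
- by move=> s y [S CS Sy]; apply: (sub S CS); have [_ _ H _] := cC _ CS; apply: H Sy.
- move=> s; split=> [[y [S CS Sy]] x xs|].
    apply: (sub S CS); have [_ _ _ H] := cC _ CS.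
    by apply: (proj1 (H s)) xs; exists y.
  move=> Us.
  have [S CS Ss] : exists2 S, C S & forall x, x \in s -> letters S x.
    elim: s Us => [|x s IH] Us; first by exists S0.
    have [|S CS Ss] := IH; first by move=> z zs; apply: Us; rewrite inE zs orbT.
    have [y [S' CS' Sx]] := Us x (mem_head _ _).
    have [SS|SS] := tot S S' CS CS'.
      exists S' => // z; rewrite inE => /orP[/eqP ->|zs]; first by exists y.
      by have [w Sw] := Ss z zs; exists w; apply: SS.
    exists S => // z; rewrite inE => /orP[/eqP ->|]; last exact: Ss.
    by exists y; apply: SS.
  have [_ _ _ H] := cC _ CS; have [y Sy] := proj2 (H s) Ss.
  by exists y, S.
Qed.

Lemma word_coding_nat (i : nat -> K) : injective i ->
  word_coding [set p | exists t : seq nat, p = (map i t, i (pickle t))].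
Proof.
move=> iI; set S := [set p | _].
have lS n : letters S (i n) by exists (i (pickle [:: n])), [:: n].
split.
- by exists (i (pickle ([::] : seq nat))), [::].
- move=> _ _ [t ->] [t' ->] /=; split=> [/(inj_map iI) -> //|/iI E].
  by rewrite (pcan_inj pickleK E).
- by move=> s y [t [_ ->]].
- move=> s; split=> [[y [t [-> _]]] _ /mapP[n _ ->] //|Ss].
  suff [t ->] : exists t, s = map i t by exists (i (pickle t)), t.
  elim: s Ss => [|x s IH] Ss; first by exists [::].
  have [|t ->] := IH; first by move=> z zs; apply: Ss; rewrite inE zs orbT.
  have [y [[|n [|m u]] []]] // := Ss x (mem_head _ _).
  by move=> -> _; exists (n :: t).
Qed.

(** The map whose graph is [S], extended arbitrarily to all words. *)
Lemma word_coding_code S : word_coding S -> exists f : seq K -> K,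
  [/\ forall s, (forall x, x \in s -> letters S x) -> S (s, f s),
      forall s, (forall x, x \in s -> letters S x) -> letters S (f s)
    & forall s t, (forall x, x \in s -> letters S x) ->
       (forall x, x \in t -> letters S x) -> f s = f t -> s = t].
Proof.
move=> [[y0 _] SI SX Sd].
have /choice[f Sf] : forall s, exists y,
    (forall x, x \in s -> letters S x) -> S (s, y).
  move=> s; have [/Sd[y Sy]|] := pselect (forall x, x \in s -> letters S x).
    by exists y.
  by exists y0.
exists f; split=> // [s Ss|s t Ss St E]; first exact: SX (Sf s Ss).
exact: (proj2 (SI (s, f s) (t, f t) (Sf _ Ss) (Sf _ St))).
Qed.

(** If [X] adds to the letters of [S] no more new elements than there were
    letters, then words over [X] can still be coded by letters of [S]. *)
Lemma code_two_copies S X (k : K -> K) : word_coding S ->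
  (forall x, X x -> ~ letters S x -> letters S (k x)) ->
  (forall x y, X x -> X y -> ~ letters S x -> ~ letters S y ->
     k x = k y -> x = y) ->
  exists c : seq K -> K,
    (forall s, (forall x, x \in s -> X x) -> letters S (c s)) /\
    (forall s t, (forall x, x \in s -> X x) -> (forall x, x \in t -> X x) ->
       c s = c t -> s = t).
Proof.
move=> /word_coding_code[f [_ fX fI]] kX kI.
(* letters of S and new elements get words of different lengths *)
pose w x := if `[< letters S x >] then [:: x] else [:: k x; k x].
have wX x : X x -> forall z, z \in w x -> letters S z.
  move=> Xx z; rewrite /w; case: asboolP => Sx.
    by rewrite inE => /eqP ->.
  by rewrite !inE orbb => /eqP ->; apply: kX.
have wI x y : X x -> X y -> w x = w y -> x = y.
  move=> Xx Xy; rewrite /w; case: asboolP => Sx; case: asboolP => Sy //.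
    by case.
  by case=> E _; apply: kI E.
have cX s : (forall x, x \in s -> X x) ->
    forall z, z \in map (f \o w) s -> letters S z.
  by move=> sX _ /mapP[x /sX Xx ->]; apply: fX; apply: wX.
exists (fun s => f (map (f \o w) s)); split=> [s sX|s t sX tX /fI].
  exact: fX (cX s sX).
move=> /(_ (cX s sX) (cX t tX)).
elim: s t sX tX => [|x s IH] [|y t] //= sX tX [/fI E E'].
have Xx : X x by apply: sX; rewrite mem_head.
have Xy : X y by apply: tX; rewrite mem_head.
rewrite (wI x y) //; last by apply: E; apply: wX.
by congr cons; apply: IH => // z zs; [apply: sX|apply: tX]; rewrite inE zs orbT.
Qed.

(** A copy of the letters outside of them leaves room to code the new words; so
    the letters of a maximal coding do not embed into their complement. *)
Lemma word_coding_extend S (j : K -> K) : word_coding S ->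
  (forall x, letters S x -> ~ letters S (j x)) ->
  (forall x y, letters S x -> letters S y -> j x = j y -> x = y) ->
  exists2 S', word_coding S' & S `<` S'.
Proof.
move=> cS jX jI; have [[y0 Sy0] SI SX Sd] := cS.
pose Y := [set y | exists2 x, letters S x & y = j x].
have NY y : Y y -> ~ letters S y by move=> [x Sx ->]; apply: jX.
have /choice[k kP] : forall y, exists x, Y y -> letters S x /\ y = j x.
  move=> y; have [[x Sx ->]|] := pselect (Y y); first by exists x.
  by exists y0.
pose X := letters S `|` Y.
have YX x : X x -> ~ letters S x -> Y x by case.
have [|x y Xx Xy Sx Sy E|c [cS' cI]] := @code_two_copies S X k cS.
- by move=> x Xx /(YX x Xx) /kP[].
- have [_ ->] := kP _ (YX _ Xx Sx); have [_ ->] := kP _ (YX _ Xy Sy).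
  by rewrite E.
(* words with a new letter are coded by new letters *)
pose N := [set p : seq K * K | [/\ forall x, x \in p.1 -> X x,
   ~ (forall x, x \in p.1 -> letters S x) & p.2 = j (c p.1)]].
have Ndom s : (forall x, x \in s -> X x) ->
    exists y, (S `|` N) (s, y).
  move=> sX; have [/Sd[y Sy]|NS] := pselect (forall x, x \in s -> letters S x).
    by exists y; left.
  by exists (j (c s)); right.
have lE : letters (S `|` N) = X.
  apply/seteqP; split=> x; last first.
    by move=> Xx; apply: Ndom => z; rewrite inE => /eqP ->.
  move=> [y [Sy|[/= NX _ _]]]; first by left; exists y.
  by apply: NX; rewrite mem_head.
have disj p q : S p -> N q -> p.1 <> q.1 /\ p.2 <> q.2.
  case: p => s y; case: q => s' y' Sy [/= s'X NS E]; split=> E'.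
    by apply: NS; rewrite -E'; apply/Sd; exists y.
  apply: (NY y'); first by exists (c s') => //; apply: cS'.
  by rewrite -E'; apply: SX Sy.
exists (S `|` N).
- split; rewrite ?lE.
  + by exists y0; left.
  + move=> p q [Sp|Np] [Sq|Nq].
    * exact: SI.
    * by have [d1 d2] := disj _ _ Sp Nq; split.
    * by have [d1 d2] := disj _ _ Sq Np; split=> /esym.
    * case: p q Np Nq => s y [s' y'] [/= sX _ ->] [/= s'X _ ->].
      split=> [-> //|/jI E]; apply: cI => //.
      by apply: E; apply: cS'.
  + move=> s y [/SX|[/= sX _ ->]]; first by left.
    by right; exists (c s) => //; apply: cS'.
  + move=> s; split=> [[y [Sy|[]]] //|/Ndom //].
    by move=> x xs; left; apply: (proj1 (Sd s)) xs; exists y.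
- split; first by move=> p; left.
  have Yj : Y (j y0) by exists y0 => //; apply: SX Sy0.
  have [|y Sy] := Ndom [:: j y0].
    by move=> x; rewrite inE => /eqP ->; right.
  by move=> /(_ _ Sy) Sj; apply: (NY _ Yj); exists y.
Qed.

(** Take a maximal coding.  Its letters do not embed into their complement by
    [word_coding_extend], so the complement embeds into the letters by
    [card_le_total], and [code_two_copies] codes all the words over [K]. *)
Lemma infinite_seq_inj :
  (exists i : nat -> K, injective i) -> exists f : seq K -> K, injective f.
Proof.
move=> [i /word_coding_nat]; set S0 := [set p | _] => cS0.
(* the empty set is included as the union of the empty chain *)
pose P S := S = set0 \/ word_coding S.
have [|S [PS Smax]] := @Zorn_bigcup (seq K * K) P.
  move=> C CP tot; pose C' := C `&` [set S | S !=set0].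
  have -> : \bigcup_(S in C) S = \bigcup_(S in C') S.
    apply/seteqP; split=> p [S CS Sp]; exists S => //; last by case: CS.
    by split=> //; exists p.
  have [C0|/set0P C'0] := eqVneq C' set0.
    by left; rewrite C0 bigcup_set0.
  right; apply: word_coding_bigcup.
  - by [].
  - by move=> X [/CP[->|//]] [].
  - by move=> X Y [CX _] [CY _]; apply: tot.
have cS : word_coding S.
  case: PS => // S_0; exfalso; apply: (Smax S0); last by right.
  rewrite S_0; split=> //; have [[y Sy] _ _ _] := cS0.
  by move=> /(_ _ Sy).
have [[y0 Sy0] _ SX _] := cS.
have Sy0' := SX _ _ Sy0.
case: (card_le_total {x | letters S x} {x | ~ letters S x}) => -[j jI].
- exfalso; pose j' x := if pselect (letters S x) is left Sx
    then sval (j (exist _ x Sx)) else x.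
  have [x Sx|x y Sx Sy|S' cS' SS'] := @word_coding_extend S j' cS.
  + by rewrite /j'; case: pselect => // Sx'; case: (j _).
  + rewrite /j'; case: pselect => // Sx'; case: pselect => // Sy' E.
    have /jI [//] : j (exist _ x Sx') = j (exist _ y Sy').
    by move: E; case: (j _) => a pa; case: (j _) => b pb ab; apply: eq_exist.
  + by apply: Smax SS' _; right.
- pose j' x := if pselect (letters S x) is right Sx
    then sval (j (exist _ x Sx)) else y0.
  have [x _ Sx|x y _ _ Sx Sy|c [_ cI]] := @code_two_copies S setT j' cS.
  + by rewrite /j'; case: pselect => // Sx'; case: (j _).
  + rewrite /j'; case: pselect => // Sx'; case: pselect => // Sy' E.
    have /jI [//] : j (exist _ x Sx') = j (exist _ y Sy').
    by move: E; case: (j _) => a pa; case: (j _) => b pb ab; apply: eq_exist.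
  + by exists c => s t; apply: cI.
Qed.

End SeqEmbedding.

Section Cardinals.
Context (K : Type) (Kinf : infinite_set [set: K]).

Lemma card_seq T : [set: T] #<= [set: K] -> [set: seq T] #<= [set: K].
Proof.
move/card_leTTP=> [f fI]; apply/card_leTTP.
have /card_leTTP iK : [set: nat] #<= [set: K] by apply/infiniteP.
have [c cI] : exists c : seq K -> K, injective c.
  by move: iK; elim/Peq: K => K' iK; apply: infinite_seq_inj.
by exists (fun s => c (map f s)) => s t /cI /(inj_map fI).
Qed.

Lemma card_prod T U : [set: T] #<= [set: K] -> [set: U] #<= [set: K] ->
  [set: T * U] #<= [set: K].
Proof.
move/card_leTTP=> [f fI] /card_leTTP[h hI].
apply: card_le_trans (card_seq (card_lexx [set: K])).
apply/card_leTTP; exists (fun q => [:: f q.1; h q.2]).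
by move=> [t u] [t' u'] /= [/fI -> /hI ->].
Qed.

Lemma card_tensor R (V W : zmodType) (ra : V -> R -> V) (la : R -> W -> W) :
  [set: V] #<= [set: K] -> [set: W] #<= [set: K] ->
  [set: tensor ra la] #<= [set: K].
Proof.
move=> VK WK; apply: card_le_trans (card_seq (card_prod VK WK)).
apply/card_leTTP; exists (fun x : tensor ra la => repr x).
by move=> x y E; rewrite -[x]reprK E reprK.
Qed.

Lemma card_gtens (F : fieldType) (G : groupType) (A B : grAlg F G) :
  [set: A] #<= [set: K] -> [set: B] #<= [set: K] ->
  [set: gtens_alg A B] #<= [set: K].
Proof.
move=> AK BK; apply: card_le_trans (card_tensor _ _ AK BK).
by apply/card_leTTP; exists (fun x : gtens A B => \val x); apply: val_inj.
Qed.

Lemma card_gmtens (F : fieldType) (G : groupType) (A B : grAlg F G)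
    (W : grMod A) (W' : grMod B) :
  [set: W] #<= [set: K] -> [set: W'] #<= [set: K] ->
  [set: gtens_mod W W'] #<= [set: K].
Proof.
move=> AK BK; apply: card_le_trans (card_tensor _ _ AK BK).
by apply/card_leTTP; exists (fun x : gmtens W W' => \val x); apply: val_inj.
Qed.

Lemma card_tga (F : fieldType) (G : groupType) :
  [set: F] #<= [set: K] -> [set: G] #<= [set: K] ->
  [set: tga F G] #<= [set: K].
Proof.
move=> FK GK; apply: card_le_trans (card_seq (card_prod GK FK)).
apply/card_leTTP; exists (fun x : tga F G => [seq (g, \val x g) | g <- supp x]).
have E (x : tga F G) :
    x = \sum_(q <- [seq (g, \val x g) | g <- supp x]) mon q.2 q.1.
  by rewrite big_map [LHS]tga_sum.
by move=> x y Exy; rewrite [x]E Exy -E.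
Qed.

End Cardinals.

(** * The universal property of graded tensor products *)
Lemma inj_surj_bij T U (f : T -> U) :
  injective f -> (forall y, exists x, f x = y) -> bijective f.
Proof.
move=> fI /choice[g fg]; exists g => // x.
by apply: fI; rewrite fg.
Qed.

Section AdditiveMap.
Context (V W : zmodType) (f : V -> W) (fD : {morph f : x y / x + y}).
Lemma morphD0 : f 0 = 0.
Proof. by apply: (addrI (f 0)); rewrite -fD !addr0. Qed.
Lemma morphDN x : f (- x) = - f x.
Proof. by apply: (addrI (f x)); rewrite -fD !subrr morphD0. Qed.
Lemma morphDB x y : f (x - y) = f x - f y.
Proof. by rewrite fD morphDN. Qed.
Lemma morphD_sum (I : Type) (r : seq I) (P : pred I) (F : I -> V) :
  f (\sum_(i <- r | P i) F i) = \sum_(i <- r | P i) f (F i).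
Proof. exact: (big_morph _ fD morphD0). Qed.
Lemma morphD_inj : (forall x, f x = 0 -> x = 0) -> injective f.
Proof.
move=> f0 x y E; apply/eqP; rewrite -subr_eq0; apply/eqP/f0.
by rewrite morphDB E subrr.
Qed.
End AdditiveMap.

Section ProjSupport.
Context (G : groupType) (V : zmodType) (comp : G -> set V) (gr : grading comp).

Lemma proj_supp x : exists s : seq G,
  uniq s /\ forall g, proj gr g x != 0 -> g \in s.
Proof.
have [s Ex] := proj_decomp gr x; exists (undup s); split=> [|g].
  exact: undup_uniq.
rewrite mem_undup; apply: contraR => gs; rewrite Ex proj_big big1_seq // => h /= hs.
rewrite (proj_id _ _ (proj_comp gr h x)); case: eqP => // E.
by rewrite E hs in gs.
Qed.

Lemma projB g x y : proj gr g (x - y) = proj gr g x - proj gr g y.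
Proof. by apply/eqP; rewrite eq_sym subr_eq -projD subrK. Qed.

Lemma eq_proj x y : (forall g, proj gr g x = proj gr g y) -> x = y.
Proof.
move=> E; apply/eqP; rewrite -subr_eq0; apply/eqP.
have [s ->] := proj_decomp gr (x - y).
by rewrite big1 // => g _; rewrite projB E subrr.
Qed.

Lemma proj_compK g x : comp g x -> proj gr g x = x.
Proof. by move=> cx; rewrite (proj_id _ _ cx) eqxx. Qed.

End ProjSupport.

(** The common abstraction of graded algebras and graded modules: only the
    grading and the degree-preserving action of scalars matter for tensor
    products. *)
Record gspace (R : Type) (G : groupType) := GSpace {
  sp_sort :> zmodType;
  sp_act : R -> sp_sort -> sp_sort;
  sp_comp : G -> set sp_sort;
  sp_grading : grading sp_comp;
  sp_actD : forall k, {morph sp_act k : x y / x + y};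
  sp_actC : forall g k x, sp_comp g x -> sp_comp g (sp_act k x) }.
Arguments sp_act {R G U} : rename.
Arguments sp_comp {R G} U : rename.
Arguments sp_grading {R G} U : rename.

Lemma sp_proj R G (U : gspace R G) g x :
  sp_comp U g (proj (sp_grading U) g x).
Proof. exact: proj_comp. Qed.

Section GradedTensorProduct.
Context (R : Type) (G : groupType).
Implicit Types U V W T : gspace R G.

(** Forms indexed by the degree, subject to conditions on homogeneous arguments
    of that degree only: [b g] has junk values elsewhere. *)
Definition hbalanced U V (Z : zmodType) (b : G -> U -> V -> Z) : Prop :=
  forall g, [/\
    forall u u' v, sp_comp U g u -> sp_comp U g u' -> sp_comp V g v ->
      b g (u + u') v = b g u v + b g u' v,
    forall u v v', sp_comp U g u -> sp_comp V g v -> sp_comp V g v' ->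
      b g u (v + v') = b g u v + b g u v'
  & forall k u v, sp_comp U g u -> sp_comp V g v ->
      b g (sp_act k u) v = b g u (sp_act k v)].

(** The universal property of the sum over [g] of the tensor products of [U_g]
    and [V_g].  The map [p] is meaningful only on pairs of homogeneous elements
    of the same degree. *)
Record graded_tensor U V T (p : U -> V -> T) : Prop := {
  gt_bal : hbalanced (fun=> p);
  gt_comp : forall g u v, sp_comp U g u -> sp_comp V g v -> sp_comp T g (p u v);
  gt_act : forall g k u v, sp_comp U g u -> sp_comp V g v ->
      sp_act k (p u v) = p (sp_act k u) v;
  gt_ind : forall K : T -> Prop, K 0 -> (forall x y, K x -> K y -> K (x + y)) ->
      (forall g u v, sp_comp U g u -> sp_comp V g v -> K (p u v)) ->
      forall x, K x;
  gt_lift : forall (Z : zmodType) (b : G -> U -> V -> Z), hbalanced b ->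
      exists2 f : T -> Z, {morph f : x y / x + y} &
        forall g u v, sp_comp U g u -> sp_comp V g v -> f (p u v) = b g u v }.

Lemma proj_act U g k (u : U) : proj (sp_grading U) g (sp_act k u) =
  sp_act k (proj (sp_grading U) g u).
Proof.
apply: (proj_shift (sp_grading U) (sp_grading U) (m := sp_act k) (sh := id)) => //.
  exact: sp_actD.
by move=> h x; apply: sp_actC.
Qed.

Lemma act0 U k : sp_act k 0 = 0 :> U.
Proof. by apply: (addrI (sp_act k 0)); rewrite -sp_actD !addr0. Qed.

Section Balanced.
Context U V (Z : zmodType) (b : G -> U -> V -> Z) (bb : hbalanced b).

Lemma hbal0l g v : sp_comp V g v -> b g 0 v = 0.
Proof.
move=> cv; have [bl _ _] := bb g; apply: (addrI (b g 0 v)).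
by rewrite -bl ?addr0 //; apply: (comp0 (sp_grading U)).
Qed.

Lemma hbal0r g u : sp_comp U g u -> b g u 0 = 0.
Proof.
move=> cv; have [_ br _] := bb g; apply: (addrI (b g u 0)).
by rewrite -br ?addr0 //; apply: (comp0 (sp_grading V)).
Qed.

Let P := proj (sp_grading U).
Let Q := proj (sp_grading V).

Lemma diag_key (u : U) : exists s : seq G, uniq s /\ forall g, P g u != 0 -> g \in s.
Proof. exact: proj_supp. Qed.

(** The form on all of [U x V] that pairs components of equal degree by [b]; it
    is balanced without restriction, and extends [b]. *)
Definition diag_form (u : U) (v : V) : Z :=
  \sum_(g <- sval (cid (diag_key u))) b g (P g u) (Q g v).

Lemma diag_formE u v s : uniq s -> (forall g, P g u != 0 -> g \in s) ->
  diag_form u v = \sum_(g <- s) b g (P g u) (Q g v).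
Proof.
rewrite /diag_form; case: cid => t [ut tu] us su /=.
rewrite (bigID (fun g => P g u == 0)) big1 /=; last first.
  by move=> g /eqP ->; rewrite hbal0l //; apply: sp_proj.
rewrite [RHS](bigID (fun g => P g u == 0)) [in RHS]big1 /=; last first.
  by move=> g /eqP ->; rewrite hbal0l //; apply: sp_proj.
rewrite !add0r -big_filter -[RHS]big_filter; apply: perm_big; apply: uniq_perm.
- exact: filter_uniq.
- exact: filter_uniq.
- move=> g; rewrite !mem_filter; case: (boolP (P g u != 0)) => //= gu.
  by rewrite tu ?su.
Qed.

Lemma diag_form_comp g u v : sp_comp U g u -> sp_comp V g v ->
  diag_form u v = b g u v.
Proof.
move=> cu cv; rewrite (@diag_formE _ _ [:: g]) //.
  by rewrite big_seq1 /P /Q !proj_compK.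
by move=> h; rewrite /P (proj_id _ _ cu) mem_seq1; case: (h =P g); rewrite ?eqxx.
Qed.

Lemma diag_form_balanced :
  balanced (fun (u : U) k => sp_act k u) (fun k (v : V) => sp_act k v) diag_form.
Proof.
split; [split|].
- move=> u u' v; pose s := undup (sval (cid (diag_key u)) ++ sval (cid (diag_key u'))).
  have su g : P g u != 0 -> g \in s.
    by rewrite mem_undup mem_cat; case: (cid (diag_key u)) => t [_ H] /H /= ->.
  have su' g : P g u' != 0 -> g \in s.
    rewrite mem_undup mem_cat; case: (cid (diag_key u')) => t [_ H] /H /= ->.
    by rewrite orbT.
  rewrite !(@diag_formE _ _ s) ?undup_uniq //.
    rewrite -big_split; apply: eq_bigr => g _; rewrite /P projD.
    by have [bl _ _] := bb g; apply: bl; apply: sp_proj.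
  move=> g; rewrite /P projD; case: (eqVneq (P g u) 0) => [E|/su //].
  by rewrite -/(P g u) E add0r; apply: su'.
- move=> u v v'; rewrite /diag_form -big_split; apply: eq_bigr => g _.
  by rewrite /P /Q projD; have [_ br _] := bb g; apply: br; apply: sp_proj.
- move=> u k v; have [s [us su]] := diag_key u.
  rewrite !(@diag_formE _ _ s) //.
    apply: eq_bigr => g _; rewrite /P /Q !proj_act.
    by have [_ _ bz] := bb g; apply: bz; apply: sp_proj.
  move=> g; rewrite /P proj_act => gu; apply: su; apply: contra_neq gu => E.
  by rewrite -/(P g u) E act0.
Qed.

End Balanced.

Section SubTensor.
Context (U V : gspace R G).
Let ten := tensor (fun (u : U) k => sp_act k u) (fun k (v : V) => sp_act k v).
Let tc := tcomp (fun (u : U) k => sp_act k u) (fun k (v : V) => sp_act k v)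
  (sp_comp U) (sp_comp V).
Context (S : pred ten) (T : subZmodType S).
Hypothesis S_homog : forall x, x \in S <-> homog_sum tc x.

(** A pure tensor need not be in the subtype [T] unless its factors are
    homogeneous of the same degree; other pairs are sent to 0. *)
Definition sub_pure (u : U) (v : V) : T := insubd 0 (tpure _ _ u v).

Lemma sub_pureE g u v : sp_comp U g u -> sp_comp V g v ->
  val (sub_pure u v) = tpure _ _ u v.
Proof.
move=> cu cv; rewrite val_insubd; case: ifPn => // /negP[].
suff : tpure (fun u0 k => sp_act k u0) (fun k v0 => sp_act k v0) u v \in S by [].
apply/S_homog; apply: (homog_sum_comp _ (g := g)).
  exact: tcomp_subgroups (sp_grading U).
exact: tspan_pure.
Qed.

(** Any family of balanced forms extends to the full tensor product by
    [diag_form], and then restricts to the graded part. *)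
Lemma sub_graded_tensor (act : R -> T -> T) gr actD actC :
  (forall g k u v, sp_comp U g u -> sp_comp V g v ->
     act k (sub_pure u v) = sub_pure (sp_act k u) v) ->
  graded_tensor (T := @GSpace R G T act (fun g => [set u : T | tc g (val u)]) gr actD actC)
    sub_pure.
Proof.
move=> actE; split=> //.
- move=> g; split=> [u u' v cu cu' cv|u v v' cu cv cv'|k u v cu cv];
    apply: val_inj; rewrite ?raddfD /=.
  + rewrite !(@sub_pureE g) //; first exact: tpureDl.
    exact: (compD (sp_grading U)).
  + rewrite !(@sub_pureE g) //; first exact: tpureDr.
    exact: (compD (sp_grading V)).
  + rewrite !(@sub_pureE g) //; try exact: sp_actC.
    exact: tpureZ.
- move=> g u v cu cv; rewrite /sp_comp /mkset (@sub_pureE g) //.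
  exact: tspan_pure.
- move=> K K0 KD Kp x.
  have /S_homog [s [f [cf Ex]]] := valP x.
  suff [y Ky Ey] : exists2 y : T, K y & val y = val x by rewrite -(val_inj Ey).
  have Kadd a b : (exists2 y, K y & val y = a) -> (exists2 y, K y & val y = b) ->
      exists2 y, K y & val y = a + b.
    move=> [y Ky <-] [z Kz <-]; exists (y + z); last exact: raddfD.
    exact: KD.
  have K0' : exists2 y, K y & val y = 0 by exists 0; rewrite ?raddf0.
  rewrite Ex; apply: (big_ind (fun a => exists2 y : T, K y & val y = a)) => // g _.
  move: (f g) (cf g); apply: tspan_ind => // u v cu cv.
  exists (sub_pure u v); first exact: Kp cu cv.
  exact: sub_pureE cu cv.
- move=> Z b bb.
  have db := diag_form_balanced bb.
  exists (fun x => tlift (diag_form b) (val x)).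
    by move=> x y; rewrite raddfD /= tliftD.
  move=> g u v cu cv; rewrite (@sub_pureE g) // tlift_pure //.
  exact: diag_form_comp.
Qed.

End SubTensor.
End GradedTensorProduct.

(** * Graded products of algebras and of modules *)
Section Spaces.
Context (F : fieldType) (G : groupType).

Definition alg_space (A : grAlg F G) : gspace F G :=
  @GSpace F G A (fun k a => ga_in A k * a) (ga_comp A) (ga_grading A)
    (fun k => mulrDr (ga_in A k)) (fun g k a => @ga_scale F G A g k a).

Definition mod_space (A : grAlg F G) (W : grMod A) : gspace F G :=
  @GSpace F G W (fun k w => ga_in A k *: w) (gm_comp W) (gm_grading W)
    (fun k => scalerDr (ga_in A k)) (fun g k w => @gm_scale F G A W g k w).

Section Alg.
Context (A B : grAlg F G).

Definition gpure (a : A) (b : B) : gtens_alg A B :=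
  @sub_pure F G (alg_space A) (alg_space B) (@gtens_pred F G A B)
    (gtens A B) a b.

Lemma val_gpure g (a : A) (b : B) : ga_comp A g a -> ga_comp B g b ->
  \val (gpure a b : gtens A B) = apure a b.
Proof.
apply: (@sub_pureE F G (alg_space A) (alg_space B)
  (@gtens_pred F G A B) (gtens A B)) => x.
by split=> /asboolP.
Qed.

Lemma gtens_in_pure k : ga_in (gtens_alg A B) k = gpure (ga_in A k) 1.
Proof.
by apply: val_inj; rewrite (val_gpure (ga_in_comp A k)) //; apply: ga_one.
Qed.

Lemma gtens_mul_pure g h (a : A) (b : B) (a' : A) (b' : B) :
  ga_comp A g a -> ga_comp B g b -> ga_comp A h a' -> ga_comp B h b' ->
  gpure a b * gpure a' b' = gpure (a * a') (b * b').
Proof.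
move=> ca cb ca' cb'; apply: val_inj.
rewrite rmorphM /= (val_gpure ca cb) (val_gpure ca' cb') apureM.
by rewrite (val_gpure (ga_mul ca ca')) //; apply: ga_mul.
Qed.

Lemma gtens_graded_tensor :
  graded_tensor (T := alg_space (gtens_alg A B)) (gpure : alg_space A -> alg_space B -> _).
Proof.
apply: sub_graded_tensor => [x|g k u v cu cv]; first by split=> /asboolP.
rewrite -[LHS]/(ga_in (gtens_alg A B) k * gpure u v) gtens_in_pure.
rewrite (gtens_mul_pure (ga_in_comp A k) (ga_one B) cu cv) mul1r.
by [].
Qed.

End Alg.

Section Mod.
Context (A B : grAlg F G) (W : grMod A) (W' : grMod B).

Definition gmpure (w : W) (w' : W') : gtens_mod W W' :=
  @sub_pure F G (mod_space W) (mod_space W') (@gmtens_pred F G A B W W')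
    (gmtens W W') w w'.

Lemma val_gmpure g (w : W) (w' : W') : gm_comp W g w -> gm_comp W' g w' ->
  \val (gmpure w w' : gmtens W W') = mpure w w'.
Proof.
apply: (@sub_pureE F G (mod_space W) (mod_space W')
  (@gmtens_pred F G A B W W') (gmtens W W')) => x.
by split=> /asboolP.
Qed.

Lemma gtens_act_pure g h (a : A) (b : B) (w : W) (w' : W') :
  ga_comp A g a -> ga_comp B g b -> gm_comp W h w -> gm_comp W' h w' ->
  gpure a b *: gmpure w w' = gmpure (a *: w) (b *: w').
Proof.
move=> ca cb cw cw'; apply: val_inj.
rewrite (val_gmpure (gm_act ca cw)); last exact: gm_act.
rewrite -mtens_actE.
rewrite -[LHS]/(mtens_act (\val (gpure a b : gtens A B)) (\val (gmpure w w' : gmtens W W'))).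
by rewrite (val_gpure ca cb) (val_gmpure cw cw').
Qed.

Lemma gmtens_graded_tensor :
  graded_tensor (T := mod_space (gtens_mod W W'))
   (gmpure : mod_space W -> mod_space W' -> _).
Proof.
apply: sub_graded_tensor => [x|g k u v cu cv]; first by split=> /asboolP.
rewrite -[LHS]/(ga_in (gtens_alg A B) k *: gmpure u v) gtens_in_pure.
by rewrite (gtens_act_pure (ga_in_comp A k) (ga_one B) cu cv) scale1r.
Qed.

End Mod.
End Spaces.

(** * Symmetry, functoriality and associativity of graded tensor products *)
Section GTheory.
Context (R : Type) (G : groupType).
Implicit Types U V W T : gspace R G.

(** Degree shifts on the right cover both the degree-preserving maps ([k = 1])
    and the isomorphisms with suspensions that express invariance. *)
Record shift_hom (k : G) U V (f : U -> V) : Prop := {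
  shD : {morph f : x y / x + y};
  shZ : forall r x, f (sp_act r x) = sp_act r (f x);
  shC : forall g x, sp_comp U g x -> sp_comp V (g * k)%g (f x) }.

Section One.
Context (U V T : gspace R G) (p : U -> V -> T) (gt : graded_tensor p).

Lemma gt_ext (Z : zmodType) (f f' : T -> Z) :
  {morph f : x y / x + y} -> {morph f' : x y / x + y} ->
  (forall g u v, sp_comp U g u -> sp_comp V g v -> f (p u v) = f' (p u v)) ->
  f =1 f'.
Proof.
move=> fD f'D E; apply: (gt_ind gt) => [|x y Ex Ey|g u v cu cv].
- by rewrite !morphD0.
- by rewrite fD f'D Ex Ey.
- exact: E cu cv.
Qed.

Lemma gt_0l g v : sp_comp V g v -> p 0 v = 0.
Proof. exact: (hbal0l (gt_bal gt)). Qed.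
Lemma gt_0r g u : sp_comp U g u -> p u 0 = 0.
Proof. exact: (hbal0r (gt_bal gt)). Qed.

Lemma gt_comp_rep g x : sp_comp T g x -> exists s : seq (U * V),
  (forall q, q \in s -> sp_comp U g q.1 /\ sp_comp V g q.2) /\
  x = \sum_(q <- s) p q.1 q.2.
Proof.
move=> cx; rewrite -[x](proj_compK (sp_grading T) cx); move: x {cx}.
apply: (gt_ind gt) => [|x y [s [sc Ex]] [t [tc Ey]]|h u v cu cv].
- by exists [::]; rewrite proj0 big_nil.
- exists (s ++ t); rewrite projD big_cat Ex Ey; split=> // q.
  by rewrite mem_cat => /orP[/sc|/tc].
- rewrite (proj_id _ _ (gt_comp gt cu cv)); case: eqP => [->|_].
    by exists [:: (u, v)]; rewrite big_seq1; split=> // q; rewrite inE => /eqP ->.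
  by exists [::]; rewrite big_nil.
Qed.

Lemma gt_comp_ind_comp g (K : T -> Prop) : K 0 ->
  (forall x y, sp_comp T g x -> sp_comp T g y -> K x -> K y -> K (x + y)) ->
  (forall u v, sp_comp U g u -> sp_comp V g v -> K (p u v)) ->
  forall x, sp_comp T g x -> K x.
Proof.
move=> K0 KD Kp x /gt_comp_rep[s [sc ->]]; rewrite big_seq.
suff [] : sp_comp T g (\sum_(q <- s | q \in s) p q.1 q.2) /\
    K (\sum_(q <- s | q \in s) p q.1 q.2) by [].
apply: (big_ind (fun x => sp_comp T g x /\ K x)).
- by split=> //; apply: (comp0 (sp_grading T)).
- move=> y z [cy Ky] [cz Kz]; split; last exact: KD.
  exact: (compD (sp_grading T)).
- by move=> q /sc[cu cv]; split; [apply: gt_comp|apply: Kp].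
Qed.

Lemma gt_comp_ind g (K : T -> Prop) : K 0 -> (forall x y, K x -> K y -> K (x + y)) ->
  (forall u v, sp_comp U g u -> sp_comp V g v -> K (p u v)) ->
  forall x, sp_comp T g x -> K x.
Proof. by move=> K0 KD Kp; apply: gt_comp_ind_comp => // x y _ _; apply: KD. Qed.

Lemma shift_hom_pure k W (f : T -> W) : {morph f : x y / x + y} ->
  (forall g u v, sp_comp U g u -> sp_comp V g v ->
     sp_comp W (g * k)%g (f (p u v))) ->
  (forall g r u v, sp_comp U g u -> sp_comp V g v ->
     f (p (sp_act r u) v) = sp_act r (f (p u v))) ->
  shift_hom k f.
Proof.
move=> fD fC fZ; split=> // [r|g].
- apply: gt_ext => [x y|x y|g u v cu cv].
  + by rewrite sp_actD fD.
  + by rewrite fD sp_actD.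
  + by rewrite (gt_act gt _ cu cv) (fZ _ _ _ _ cu cv).
- apply: gt_comp_ind => [|x y cx cy|u v cu cv]; last exact: fC.
    by rewrite morphD0 //; apply: (comp0 (sp_grading W)).
  by rewrite fD; apply: (compD (sp_grading W)).
Qed.

Lemma gt_flip : graded_tensor (fun v u => p u v).
Proof.
split.
- move=> g; have [bl br bz] := gt_bal gt g; split=> [v v' u cv cv' cu|v u u' cv cu cu'|r v u cv cu].
  + exact: br.
  + exact: bl.
  + by rewrite bz.
- by move=> g v u cv cu; apply: gt_comp.
- move=> g r v u cv cu; rewrite (gt_act gt _ cu cv).
  by have [_ _ bz] := gt_bal gt g; apply: bz.
- by move=> K K0 KD Kp; apply: (gt_ind gt) => // g u v cu cv; apply: (Kp g).
- move=> Z b bb; have [g|f fD fE] := gt_lift gt (b := fun g u v => b g v u).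
    have [bl br bz] := bb g; split=> [u u' v cu cu' cv|u v v' cu cv cv'|r u v cu cv].
    + exact: br.
    + exact: bl.
    + by rewrite bz.
  by exists f => // g v u cv cu; apply: fE.
Qed.

End One.

Lemma gt_map k U V T (p : U -> V -> T) (U' V' T' : gspace R G) (p' : U' -> V' -> T')
    (f : U -> U') (f' : V -> V') :
  graded_tensor p -> graded_tensor p' -> shift_hom k f -> shift_hom k f' ->
  exists2 h : T -> T', shift_hom k h &
    forall g u v, sp_comp U g u -> sp_comp V g v -> h (p u v) = p' (f u) (f' v).
Proof.
move=> gt gt' [fD fZ fC] [f'D f'Z f'C].
have [g|h hD hE] := gt_lift gt (b := fun g u v => p' (f u) (f' v)).
  have [bl br bz] := gt_bal gt' (g * k)%g.
  split=> [u u' v cu cu' cv|u v v' cu cv cv'|r u v cu cv].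
  + by rewrite fD; apply: bl; auto.
  + by rewrite f'D; apply: br; auto.
  + by rewrite fZ f'Z; apply: bz; auto.
exists h => //; apply: (shift_hom_pure gt) => // [g u v cu cv|g r u v cu cv].
  by rewrite (hE _ _ _ cu cv); apply: gt_comp; auto.
rewrite (hE _ _ _ cu cv) (hE _ _ _ (sp_actC r cu) cv) fZ.
by rewrite (gt_act gt' _ (fC _ _ cu) (f'C _ _ cv)).
Qed.

(** For fixed [w], the form [(u, v) |-> u (x) (v (x) w_g)] in degree [g] gives a
    map [L w] on [UV]; then [(x, w) |-> L w x] is balanced in each degree. *)
Lemma gt_assoc U V W (UV T VW T' : gspace R G) (pUV : U -> V -> UV) (p : UV -> W -> T)
    (pVW : V -> W -> VW) (p' : U -> VW -> T') :
  graded_tensor pUV -> graded_tensor p -> graded_tensor pVW ->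
  graded_tensor p' ->
  exists2 h : T -> T', shift_hom 1%g h &
    forall g u v w, sp_comp U g u -> sp_comp V g v -> sp_comp W g w ->
      h (p (pUV u v) w) = p' u (pVW v w).
Proof.
move=> gUV gp gVW gp'.
have /choice[L LP] : forall w, exists L : UV -> T', {morph L : x y / x + y} /\
    forall g u v, sp_comp U g u -> sp_comp V g v ->
      L (pUV u v) = p' u (pVW v (proj (sp_grading W) g w)).
  move=> w; pose b g u v := p' u (pVW v (proj (sp_grading W) g w)).
  have [g|L LD LE] := gt_lift gUV (b := b); last by exists L.
  have cw := @sp_proj _ _ W g w.
  have [bl br bz] := gt_bal gp' g; have [bl' br' bz'] := gt_bal gVW g.
  split=> [u u' v cu cu' cv|u v v' cu cv cv'|r u v cu cv]; rewrite /b.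
  + by apply: bl => //; apply: gt_comp.
  + by rewrite bl' // br //; apply: gt_comp.
  + rewrite bz //; last exact: gt_comp.
    by rewrite (gt_act gVW _ cv cw).
have LD w : {morph L w : x y / x + y} by have [] := LP w.
have LE g u v w : sp_comp U g u -> sp_comp V g v -> sp_comp W g w ->
    L w (pUV u v) = p' u (pVW v w).
  by move=> cu cv cw; have [_ E] := LP w; rewrite (E g) // (proj_compK _ cw).
have [g|h hD hE] := gt_lift gp (b := fun g x w => L w x).
  have [bl br bz] := gt_bal gp' g; have [bl' br' bz'] := gt_bal gVW g.
  split=> [x y w _ _ _|x w w' cx cw cw'|r x w cx cw].
  + exact: LD.
  + have cww := compD (sp_grading W) cw cw'.
    move: x cx; apply: (gt_comp_ind gUV) => [|x y Ex Ey|u v cu cv].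
    * by rewrite !(morphD0 (LD _)) addr0.
    * by rewrite !LD Ex Ey addrACA.
    * by rewrite !(LE g) // br' // br //; apply: gt_comp.
  + have crw := sp_actC r cw.
    move: x cx; apply: (gt_comp_ind gUV) => [|x y Ex Ey|u v cu cv].
    * by rewrite act0 !(morphD0 (LD _)).
    * by rewrite sp_actD !LD Ex Ey.
    * have cru := sp_actC r cu.
      rewrite (gt_act gUV _ cu cv) !(LE g) // bz ?(gt_act gVW _ cv cw) ?bz' //.
      exact: gt_comp.
have E g u v w : sp_comp U g u -> sp_comp V g v -> sp_comp W g w ->
    h (p (pUV u v) w) = p' u (pVW v w).
  by move=> cu cv cw; rewrite (hE _ _ _ (gt_comp gUV cu cv) cw) (LE g).
exists h => //; apply: (shift_hom_pure gp) => // [g x w cx cw|g r x w cx cw].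
- have [bl _ _] := gt_bal gp g.
  rewrite mulg1 (hE _ _ _ cx cw); move: x cx.
  apply: (gt_comp_ind gUV) => [|x y cx cy|u v cu cv].
  + by rewrite morphD0 //; apply: (comp0 (sp_grading T')).
  + by rewrite LD; apply: (compD (sp_grading T')).
  + by rewrite (LE g) //; apply: (gt_comp gp') => //; apply: (gt_comp gVW).
- rewrite (hE _ _ _ cx cw) (hE _ _ _ (sp_actC r cx) cw); move: x cx.
  apply: (gt_comp_ind gUV) => [|x y Ex Ey|u v cu cv].
  + by rewrite act0 (morphD0 (LD w)) act0.
  + by rewrite sp_actD !LD sp_actD Ex Ey.
  + have cru := sp_actC r cu.
    rewrite (gt_act gUV _ cu cv) !(LE g) //.
    by rewrite (gt_act gp' _ cu (gt_comp gVW cv cw)).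
Qed.

Lemma shift_hom_proj k U V (f : U -> V) : shift_hom k f -> forall g x,
  proj (sp_grading V) (g * k)%g (f x) = f (proj (sp_grading U) g x).
Proof.
move=> [fD fZ fC] g x.
by apply: (proj_shift (sp_grading U) (sp_grading V) (sh := fun g => (g * k)%g)) => //;
   apply: mulIg.
Qed.

End GTheory.

Section Functional.
Context (F : fieldType) (V : zmodType) (act : F -> V -> V).

(** Scalars act on modules through their image in the algebra, so that a module
    is not an [F]-vector space in the sense of the algebraic hierarchy. *)
Record vs_axioms : Prop := {
  vs1 : forall x, act 1 x = x;
  vsA : forall k l x, act k (act l x) = act (k * l) x;
  vsDl : forall k l x, act (k + l) x = act k x + act l x;
  vsDr : forall k x y, act k (x + y) = act k x + act k y }.

Context (vs : vs_axioms).

Lemma vs0 x : act 0 x = 0.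
Proof. by apply: (addrI (act 0 x)); rewrite -(vsDl vs) !addr0. Qed.
Lemma vsr0 k : act k 0 = 0.
Proof. by apply: (addrI (act k 0)); rewrite -(vsDr vs) !addr0. Qed.
Lemma vsN k x : act (- k) x = - act k x.
Proof. by apply: (addrI (act k x)); rewrite -(vsDl vs) !subrr vs0. Qed.
Lemma vsrN k x : act k (- x) = - act k x.
Proof. by apply: (addrI (act k x)); rewrite -(vsDr vs) !subrr vsr0. Qed.

(** A subspace that is maximal among those avoiding [w] is a hyperplane
    complementary to the line of [w]. *)
Lemma exists_functional w : w != 0 -> exists f : V -> F,
  [/\ {morph f : x y / x + y}, forall k x, f (act k x) = k * f x & f w = 1].
Proof.
move=> w0; pose P (U : set V) := [/\ forall x y, U x -> U y -> U (x + y),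
  forall k x, U x -> U (act k x) & ~ U w].
have [C CP tot|U [[UD UZ Uw] Umax]] := @Zorn_bigcup V P.
  split=> [x y [X CX Xx] [Y CY Yy]|k x [X CX Xx]|[X CX Xw]].
  - have [XY|YX] := tot X Y CX CY.
      by exists Y => //; have [D _ _] := CP _ CY; apply: D => //; apply: XY.
    by exists X => //; have [D _ _] := CP _ CX; apply: D => //; apply: YX.
  - by exists X => //; have [_ Z _] := CP _ CX; apply: Z.
  - by have [_ _] := CP _ CX.
have U0 : U 0.
  apply: contrapT => NU0; apply: (Umax (U `|` [set 0])).
    split=> [x Ux|]; first by left.
    by move=> UU; apply: NU0; apply: UU; right.
  split=> [x y [Ux|->] [Uy|->]|k x [Ux|->]|[//|/eqP]].
  - by left; apply: UD.
  - by rewrite addr0; left.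
  - by rewrite add0r; left.
  - by rewrite add0r; right.
  - by left; apply: UZ.
  - by rewrite vsr0; right.
  - by rewrite (negbTE w0).
have UB x y : U x -> U y -> U (x - y).
  move=> Ux Uy; apply: UD => //; rewrite -[y](vs1 vs) -vsN; exact: UZ.
(* otherwise the sum of [U] and the line of [x] would also avoid [w] *)
have /choice[f Uf] : forall x, exists k, U (x - act k w).
  move=> x; apply: contrapT => /forallNP Nx.
  apply: (Umax [set z | exists u c, U u /\ z = u + act c x]).
    split=> [u Uu|UU]; first by exists u, 0; rewrite vs0 addr0.
    apply: (Nx 0); rewrite vs0 subr0; apply: UU.
    by exists 0, 1; rewrite add0r (vs1 vs).
  split=> [_ _ [u [c [Uu ->]]] [v [d [Uv ->]]]|k _ [u [c [Uu ->]]]|[u [c [Uu E]]]].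
  - by exists (u + v), (c + d); rewrite addrACA (vsDl vs); split=> //; apply: UD.
  - by exists (act k u), (k * c); rewrite (vsDr vs) (vsA vs); split=> //; apply: UZ.
  - have [c0|c0] := eqVneq c 0.
      by apply: Uw; rewrite E c0 vs0 addr0.
    apply: (Nx c^-1); rewrite E (vsDr vs) (vsA vs) mulVf // (vs1 vs).
    rewrite opprD addrCA subrr addr0 -vsN; exact: UZ.
have fU k x : U (x - act k w) -> f x = k.
  move=> Ux; apply: contrapT => /eqP; rewrite -subr_eq0 => d0.
  apply: Uw; rewrite -[w](vs1 vs) -(mulVf d0) -(vsA vs); apply: UZ.
  rewrite (vsDl vs) vsN.
  have -> : act (f x) w - act k w = (x - act k w) - (x - act (f x) w).
    by rewrite opprB [RHS]addrC addrA subrK.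
  exact: UB.
exists f; split=> [x y|k x|].
- apply: fU; rewrite (vsDl vs) opprD addrACA; exact: UD.
- apply: fU; rewrite -(vsA vs) -vsrN -(vsDr vs); exact: UZ.
- by apply: fU; rewrite (vs1 vs) subrr.
Qed.

End Functional.

Section PureNonzero.
Context (F : fieldType) (G : groupType) (U V T : gspace F G).
Context (p : U -> V -> T) (gt : graded_tensor p).
Hypothesis vU : vs_axioms (@sp_act F G U).
Hypothesis vV : vs_axioms (@sp_act F G V).

(** A functional [f] with [f u = 1] induces [x (x) y |-> f x y], which maps
    [u (x) v] to [v]. *)
Lemma gt_pure_neq0 g u v : sp_comp U g u -> sp_comp V g v ->
  u != 0 -> v != 0 -> p u v != 0.
Proof.
move=> cu cv u0; apply: contra_neq => E.
have [f [fD fZ f1]] := exists_functional vU u0.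
have [h|m mD mE] := gt_lift gt (b := fun g x y => sp_act (f x) y).
  split=> [x x' y _ _ _|x y y' _ _ _|k x y _ _].
  - by rewrite fD (vsDl vV).
  - exact: (vsDr vV).
  - by rewrite fZ mulrC (vsA vV).
by have := mE _ _ _ cu cv; rewrite E (morphD0 mD) f1 (vs1 vV).
Qed.

End PureNonzero.

Lemma mod_space_vs (F : fieldType) (G : groupType) (A : grAlg F G) (W : grMod A) :
  vs_axioms (@sp_act F G (mod_space W)).
Proof.
split=> [x|k l x|k l x|k x y] /=.
- by rewrite rmorph1 scale1r.
- by rewrite scalerA rmorphM.
- by rewrite rmorphD scalerDl.
- exact: scalerDr.
Qed.

(** * Graded equivariance and the graded product *)
Section Packaging.

Lemma additive_pack (V W : zmodType) (f : V -> W) :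
  {morph f : x y / x + y} -> exists h : {additive V -> W}, h = f :> (V -> W).
Proof.
move=> fD.
pose h : {additive V -> W} := HB.pack f
  (GRing.isZmodMorphism.Build V W f (morphDB fD)).
by exists h.
Qed.

Lemma linear_pack (R : pzRingType) (V W : lmodType R) (f : V -> W) :
  {morph f : x y / x + y} -> (forall a x, f (a *: x) = a *: f x) ->
  exists h : {linear V -> W}, h = f :> (V -> W).
Proof.
move=> fD fZ.
pose h : {linear V -> W} := HB.pack f
  (GRing.isZmodMorphism.Build V W f (morphDB fD))
  (GRing.isScalable.Build R V W *:%R f fZ).
by exists h.
Qed.

Lemma rmorphism_pack (R S : pzRingType) (f : R -> S) :
  {morph f : x y / x + y} -> {morph f : x y / x * y} -> f 1 = 1 ->
  exists h : {rmorphism R -> S}, h = f :> (R -> S).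
Proof.
move=> fD fM f1.
pose h : {rmorphism R -> S} := HB.pack f
  (GRing.isZmodMorphism.Build R S f (morphDB fD))
  (GRing.isMonoidMorphism.Build R S f (conj f1 fM)).
by exists h.
Qed.

End Packaging.

Section ShiftHom.
Context (R : Type) (G : groupType).

Lemma shift_hom_inv k (U V : gspace R G) (f : U -> V) g : shift_hom k f ->
  cancel f g -> cancel g f -> shift_hom k^-1%g g.
Proof.
move=> fh fg gf; have [fD fZ fC] := fh; split=> [x y|r x|h x cx].
- by apply: (can_inj fg); rewrite fD !gf.
- by apply: (can_inj fg); rewrite fZ !gf.
- have E := shift_hom_proj fh (h * k^-1)%g (g x).
  rewrite gf mulgVK (proj_compK _ cx) in E.
  have -> : g x = proj (sp_grading U) (h * k^-1)%g (g x).
    by apply: (can_inj fg); rewrite -E gf.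
  exact: sp_proj.
Qed.

Lemma gt_map_bij k (U V T U' V' T' : gspace R G) (p : U -> V -> T)
    (p' : U' -> V' -> T') (f : U -> U') (f' : V -> V') (h : T -> T') :
  graded_tensor p -> graded_tensor p' ->
  shift_hom k f -> shift_hom k f' -> shift_hom k h ->
  (forall g u v, sp_comp U g u -> sp_comp V g v -> h (p u v) = p' (f u) (f' v)) ->
  bijective f -> bijective f' -> bijective h.
Proof.
move=> gt gt' fh fh' hh hE [e fe ef] [e' fe' ef'].
have eh := shift_hom_inv fh fe ef; have eh' := shift_hom_inv fh' fe' ef'.
have [d dh dE] := gt_map gt' gt eh eh'.
have hD := shD hh; have dD := shD dh.
exists d.
  apply: (gt_ext gt) => // [x y|g u v cu cv]; first by rewrite hD dD.
  by rewrite (hE g) // (dE _ _ _ (shC fh cu) (shC fh' cv)) fe fe'.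
apply: (gt_ext gt') => // [x y|g u v cu cv]; first by rewrite dD hD.
by rewrite (dE g) // (hE _ _ _ (shC eh cu) (shC eh' cv)) ef ef'.
Qed.

End ShiftHom.

Section Equivariance.
Context (F : fieldType) (G : groupType).
Implicit Types (A B C : grAlg F G) (P Q : grPair F G).

(** Preservation of 1 follows from [gah_in]. *)
Record galg_hom A B (psi : A -> B) : Prop := {
  gahD : {morph psi : x y / x + y};
  gahM : {morph psi : x y / x * y};
  gah_in : forall k, psi (ga_in A k) = ga_in B k;
  gahC : forall g x, ga_comp A g x -> ga_comp B g (psi x) }.

Lemma galg_hom_shift A B (psi : A -> B) : galg_hom psi ->
  shift_hom 1%g (psi : alg_space A -> alg_space B).
Proof.
move=> [pD pM pin pC]; split=> //= [k x|g x cx]; first by rewrite pM pin.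
by rewrite mulg1; apply: pC.
Qed.

Lemma galg_hom_inv A B (psi : A -> B) psi' : galg_hom psi ->
  cancel psi psi' -> cancel psi' psi -> galg_hom psi'.
Proof.
move=> ph K K'; have ph' := galg_hom_shift ph.
have [eD eZ eC] := shift_hom_inv ph' K K'; have [pD pM pin pC] := ph.
split=> // [x y|k|g x cx].
- by apply: (can_inj K); rewrite pM !K'.
- by apply: (can_inj K); rewrite pin K'.
- by have := eC g x cx; rewrite invg1 mulg1.
Qed.

Lemma galg_hom_comp A B C (psi : A -> B) (psi' : B -> C) :
  galg_hom psi -> galg_hom psi' -> galg_hom (psi' \o psi).
Proof.
move=> [pD pM pin pC] [qD qM qin qC]; split=> [x y|x y|k|g x cx] /=.
- by rewrite pD qD.
- by rewrite pM qM.
- by rewrite pin qin.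
- by apply: qC; apply: pC.
Qed.

Lemma galg_isoP A B : galg_iso A B <->
  exists2 psi : A -> B, galg_hom psi & bijective psi.
Proof.
split=> [[psi [b pin pC]]|[psi [pD pM pin pC] b]].
  exists psi => //; split=> // [x y|x y]; [exact: rmorphD|exact: rmorphM].
have [|f fE] := rmorphism_pack pD pM.
  by have := pin 1; rewrite !rmorph1.
exists f; split; rewrite fE //.
Qed.

(** Equivariance up to a shift of the degrees by [k]: for [k = 1] this is graded
    equivariance, and for [psi] the identity it is an isomorphism with the
    suspension by [k].  Products are compatible with both for one reason,
    [gprod_equiv]. *)
Record pair_equiv (k : G) P Q (psi : gp_alg P -> gp_alg Q) (phi : P -> Q) : Prop := {
  pe_hom : galg_hom psi;
  pe_bij : bijective psi;
  peD : {morph phi : x y / x + y};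
  peA : forall a x, phi (a *: x) = psi a *: phi x;
  peC : forall g x, gm_comp P g x -> gm_comp Q (g * k)%g (phi x);
  pe_mod_bij : bijective phi }.

Lemma pe_shift k P Q psi phi : @pair_equiv k P Q psi phi ->
  shift_hom k (phi : mod_space P -> mod_space Q).
Proof.
by move=> [[_ _ pin _] _ pD pA pC _]; split=> //= r x; rewrite pA pin.
Qed.

Lemma G_equivariantP P Q : G_equivariant P Q <->
  exists psi phi, @pair_equiv 1%g P Q psi phi.
Proof.
split=> [[psi [phi [[b pin pC] b' phC phZ phA]]]|[psi [phi [[pD pM pin pC] b phD phA phC b']]]].
  exists psi, phi; split=> //.
  - split=> // [x y|x y]; [exact: rmorphD|exact: rmorphM].
  - by move=> x y; apply: raddfD.
  - by move=> g x cx; rewrite mulg1; apply: phC.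
have [|f fE] := rmorphism_pack pD pM.
  by have := pin 1; rewrite !rmorph1.
have [e eE] := additive_pack phD.
exists f, e; split.
- by split; rewrite fE.
- by rewrite eE.
- by move=> g w cw; rewrite eE -[g]mulg1; apply: phC.
- by move=> k w; rewrite eE phA pin.
- by move=> x w; rewrite eE fE phA.
Qed.

Lemma G_invariantP A (W : grMod A) : G_invariant W <->
  forall g, exists phi, @pair_equiv g (GrPair W) (GrPair W) id phi.
Proof.
have id_hom : galg_hom (id : A -> A) by split.
have id_bij : bijective (id : A -> A) by exists id.
split=> H g; have := H g.
  move=> [phi [b pC]]; exists phi; split=> //.
  - by move=> x y; apply: raddfD.
  - by move=> a x; apply: linearZ.
move=> [phi [_ _ pD pA pC b]].
have [f fE] := @linear_pack A W (susp W g) phi pD pA.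
by exists f; rewrite fE.
Qed.

Lemma G_equivariant_refl P : G_equivariant P P.
Proof.
apply/G_equivariantP; exists id, id; split=> //; try by exists id.
by move=> g x; rewrite mulg1.
Qed.

Lemma G_equivariant_sym P Q : G_equivariant P Q -> G_equivariant Q P.
Proof.
move=> /G_equivariantP[psi [phi pe]]; apply/G_equivariantP.
have [ph [psi' K K'] pD pA pC [phi' L L']] := pe.
have [eD eZ eC] := shift_hom_inv (pe_shift pe) L L'.
exists psi', phi'; split=> //.
- exact: galg_hom_inv ph K K'.
- by exists psi.
- by move=> a x; apply: (can_inj L); rewrite pA K' !L'.
- by move=> g x /eC; rewrite invg1.
- by exists phi.
Qed.

Lemma G_equivariant_trans P Q S :
  G_equivariant P Q -> G_equivariant Q S -> G_equivariant P S.
Proof.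
move=> /G_equivariantP[psi [phi [ph b pD pA pC b']]].
move=> /G_equivariantP[psi' [phi' [qh c qD qA qC c']]].
apply/G_equivariantP; exists (psi' \o psi), (phi' \o phi); split.
- exact: galg_hom_comp.
- exact: bij_comp.
- by move=> x y /=; rewrite pD qD.
- by move=> a x /=; rewrite pA qA.
- by move=> g x cx; have := qC _ _ (pC _ _ cx); rewrite !mulg1.
- exact: bij_comp.
Qed.

Section GtensHom.
Context A B C (h : gtens_alg A B -> C).
Hypothesis hh : shift_hom 1%g (h : alg_space (gtens_alg A B) -> alg_space C).
Hypothesis hM : forall g g' (a : A) (b : B) (a' : A) (b' : B),
  ga_comp A g a -> ga_comp B g b -> ga_comp A g' a' -> ga_comp B g' b' ->
  h (gpure (a * a') (b * b')) = h (gpure a b) * h (gpure a' b').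
Hypothesis h_in : forall k, h (gpure (ga_in A k) 1) = ga_in C k.

Lemma gtens_hom : galg_hom h.
Proof.
have [hD hZ hC] := hh.
split=> // [x y|k|g x cx].
- move: x; apply: (gt_ext (gtens_graded_tensor A B)) => [x x'|x x'|g a b ca cb].
  + by rewrite mulrDl hD.
  + by rewrite hD mulrDl.
  + move: y; apply: (gt_ext (gtens_graded_tensor A B)) => [y y'|y y'|g' a' b' ca' cb'].
    * by rewrite mulrDr hD.
    * by rewrite hD mulrDr.
    * by rewrite -(hM ca cb ca' cb') -(gtens_mul_pure ca cb ca' cb').
- by rewrite gtens_in_pure.
- by have := hC g x cx; rewrite mulg1.
Qed.

End GtensHom.

Lemma gtens_act_hom A B C (W : grMod A) (W' : grMod B) (Z : grMod C)
    (psi : gtens_alg A B -> C) (phi : gtens_mod W W' -> Z) :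
  {morph psi : x y / x + y} -> {morph phi : x y / x + y} ->
  (forall g g' (a : A) (b : B) (w : W) (w' : W'),
    ga_comp A g a -> ga_comp B g b -> gm_comp W g' w -> gm_comp W' g' w' ->
    phi (gmpure (a *: w) (b *: w')) = psi (gpure a b) *: phi (gmpure w w')) ->
  forall x y, phi (x *: y) = psi x *: phi y.
Proof.
move=> sD hD H x y.
move: x; apply: (gt_ext (gtens_graded_tensor A B)) => [x x'|x x'|g a b ca cb].
- by rewrite scalerDl hD.
- by rewrite sD scalerDl.
- move: y; apply: (gt_ext (gmtens_graded_tensor W W')) => [y y'|y y'|g' w w' cw cw'].
  + by rewrite scalerDr hD.
  + by rewrite hD scalerDr.
  + by rewrite -(H _ _ _ _ _ _ ca cb cw cw') -(gtens_act_pure ca cb cw cw').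
Qed.

Lemma gprod_equiv k P P' Q Q' psi phi psi' phi' :
  @pair_equiv k P P' psi phi -> @pair_equiv k Q Q' psi' phi' ->
  exists Psi Phi, [/\ @pair_equiv k (gprod P Q) (gprod P' Q') Psi Phi,
    forall g a b, ga_comp (gp_alg P) g a -> ga_comp (gp_alg Q) g b ->
      Psi (gpure a b) = gpure (psi a) (psi' b)
  & forall g w w', gm_comp P g w -> gm_comp Q g w' ->
      Phi (gmpure w w') = gmpure (phi w) (phi' w')].
Proof.
move=> pe qe.
have [ph b pD pA pC b'] := pe; have [qh c qD qA qC c'] := qe.
have [sD sM sin sC] := ph; have [tD tM tin tC] := qh.
have gA := gtens_graded_tensor (gp_alg P) (gp_alg Q).
have gA' := gtens_graded_tensor (gp_alg P') (gp_alg Q').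
have gM := gmtens_graded_tensor P Q; have gM' := gmtens_graded_tensor P' Q'.
have [Psi sh shE] := gt_map gA gA' (galg_hom_shift ph) (galg_hom_shift qh).
have [Phi mh mhE] := gt_map gM gM' (pe_shift pe) (pe_shift qe).
exists Psi, Phi; split=> //; split.
- apply: gtens_hom => // [g g' x y x' y' cx cy cx' cy'|r].
    rewrite (shE (g * g')%g); [|exact: ga_mul|exact: ga_mul].
    rewrite (shE g) // (shE g') // (@gtens_mul_pure _ _ _ _ g g'); auto.
    by rewrite sM tM.
  rewrite (shE 1%g); [|exact: ga_in_comp|exact: ga_one].
  by rewrite sin gtens_in_pure -(rmorph1 (ga_in _)) tin rmorph1.
- exact: (gt_map_bij gA gA' (galg_hom_shift ph) (galg_hom_shift qh) sh).
- exact: shD mh.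
- apply: gtens_act_hom; [exact: shD sh|exact: shD mh|].
  move=> g g' x y w w' cx cy cw cw'.
  rewrite (mhE (g * g')%g); [|exact: gm_act|exact: gm_act].
  rewrite (shE g) // (mhE g') // (@gtens_act_pure _ _ _ _ _ _ g (g' * k)%g); auto.
  by rewrite pA qA.
- exact: shC mh.
- exact: (gt_map_bij gM gM' (pe_shift pe) (pe_shift qe) mh).
Qed.

Lemma gprod_congr P P' Q Q' : G_equivariant P P' -> G_equivariant Q Q' ->
  G_equivariant (gprod P Q) (gprod P' Q').
Proof.
move=> /G_equivariantP[psi [phi pe]] /G_equivariantP[psi' [phi' qe]].
have [Psi [Phi [PE _ _]]] := gprod_equiv pe qe.
by apply/G_equivariantP; exists Psi, Phi.
Qed.

Lemma gprod_invariant A B (W : grMod A) (W' : grMod B) :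
  G_invariant W -> G_invariant W' -> G_invariant (gtens_mod W W').
Proof.
move=> /G_invariantP IW /G_invariantP IW'; apply/G_invariantP => g.
have [phi pe] := IW g; have [phi' qe] := IW' g.
have [Psi [Phi [PE PsiE _]]] := gprod_equiv pe qe.
have E : Psi = id.
  apply/funext; apply: (gt_ext (gtens_graded_tensor A B)) => //.
  by have [[]] := PE.
by rewrite E in PE; exists Phi.
Qed.

Lemma gprod_comm P Q : G_equivariant (gprod P Q) (gprod Q P).
Proof.
have gA := gtens_graded_tensor (gp_alg P) (gp_alg Q).
have gA' := gtens_graded_tensor (gp_alg Q) (gp_alg P).
have gM := gmtens_graded_tensor P Q; have gM' := gmtens_graded_tensor Q P.
have idh (U : gspace F G) : shift_hom 1%g (id : U -> U).
  by split=> // g x; rewrite mulg1.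
have idb T : bijective (id : T -> T) by exists id.
have [Psi sh shE] := gt_map gA (gt_flip gA') (idh _) (idh _).
have [Phi mh mhE] := gt_map gM (gt_flip gM') (idh _) (idh _).
apply/G_equivariantP; exists Psi, Phi; split.
- apply: gtens_hom => // [g g' x y x' y' cx cy cx' cy'|r].
    rewrite (shE (g * g')%g); [|exact: ga_mul|exact: ga_mul].
    by rewrite (shE g) // (shE g') // (@gtens_mul_pure _ _ _ _ g g').
  rewrite (shE 1%g); [|exact: ga_in_comp|exact: ga_one].
  rewrite gtens_in_pure; have [_ _ bz] := gt_bal gA' 1%g.
  have := bz r 1 1 (ga_one _) (ga_one _).
  by rewrite /= !mulr1.
- exact: (gt_map_bij gA (gt_flip gA') (idh _) (idh _) sh).
- exact: shD mh.
- apply: gtens_act_hom; [exact: shD sh|exact: shD mh|].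
  move=> g g' x y w w' cx cy cw cw'.
  rewrite (mhE (g * g')%g); [|exact: gm_act|exact: gm_act].
  by rewrite (shE g) // (mhE g') // (@gtens_act_pure _ _ _ _ _ _ g g').
- exact: shC mh.
- exact: (gt_map_bij gM (gt_flip gM') (idh _) (idh _) mh).
Qed.

End Equivariance.

(** * Associativity and the unit of the graded product *)
Section Triple.
Context (R : Type) (G : groupType) (U V W UV T VW T' : gspace R G).
Context (pUV : U -> V -> UV) (p : UV -> W -> T).
Context (pVW : V -> W -> VW) (p' : U -> VW -> T').
Hypothesis (gUV : graded_tensor pUV) (gp : graded_tensor p).
Hypothesis (gVW : graded_tensor pVW) (gp' : graded_tensor p').

(** Threefold tensors [(u (x) v) (x) w] of homogeneous elements of one degree
    generate. *)
Lemma gt_ind3 (K : T -> Prop) : K 0 -> (forall x y, K x -> K y -> K (x + y)) ->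
  (forall g u v w, sp_comp U g u -> sp_comp V g v -> sp_comp W g w ->
     K (p (pUV u v) w)) -> forall x, K x.
Proof.
move=> K0 KD Kp; apply: (gt_ind gp) => // g x w + cw; move: x.
have [bl _ _] := gt_bal gp g.
apply: (gt_comp_ind_comp gUV) => [|x y cx cy Kx Ky|u v cu cv].
- by rewrite (gt_0l gp cw).
- by rewrite bl //; apply: KD.
- exact: (Kp g).
Qed.

(** The inverse is the associativity map of the reversed product
    [W (x) V (x) U]. *)
Lemma gt_assoc_bij (h : T -> T') : {morph h : x y / x + y} ->
  (forall g u v w, sp_comp U g u -> sp_comp V g v -> sp_comp W g w ->
      h (p (pUV u v) w) = p' u (pVW v w)) ->
  bijective h.
Proof.
move=> hD hE.
have [d dh dE] := gt_assoc (gt_flip gVW) (gt_flip gp') (gt_flip gUV) (gt_flip gp).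
have dD := shD dh; exists d.
  apply: gt_ind3 => [|x y Ex Ey|g u v w cu cv cw].
  - by rewrite !morphD0.
  - by rewrite hD dD Ex Ey.
  - by rewrite (hE g) // (dE g).
have [h' hh' h'E] := gt_assoc gUV gp gVW gp'.
suff : forall y, h' (d y) = y.
  suff E : h =1 h' by move=> H y; rewrite E.
  apply: gt_ind3 => [|x y Ex Ey|g u v w cu cv cw].
  - by rewrite !morphD0 //; apply: shD hh'.
  - by rewrite hD (shD hh') Ex Ey.
  - by rewrite (hE g) // (h'E g).
have h'D := shD hh'.
apply: (gt_ind gp') => [|x y Ex Ey|g u y cu].
- by rewrite !morphD0.
- by rewrite dD h'D Ex Ey.
- have [_ br _] := gt_bal gp' g; move: y.
  apply: (gt_comp_ind_comp gVW) => [|x y cx cy Ex Ey|v w cv cw].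
  + by rewrite (gt_0r gp' cu) !morphD0.
  + by rewrite br // dD h'D Ex Ey.
  + by rewrite (dE g) // (h'E g).
Qed.

End Triple.

Section UnitSpace.
Context (F : fieldType) (G : groupType) (E U T : gspace F G).
Context (p : E -> U -> T) (gt : graded_tensor p).
Context (e : G -> E) (c : G -> E -> F).
Hypothesis e_comp : forall g, sp_comp E g (e g).
Hypothesis c_e : forall g, c g (e g) = 1.
Hypothesis E_comp : forall g x, sp_comp E g x -> x = sp_act (c g x) (e g).
Hypothesis act1 : forall u : U, sp_act 1 u = u.

(** If each [E_g] is the line of a unit vector [e g], then [u |-> e g (x) u]
    inverts [h] in degree [g]. *)
Lemma gt_unit_bij (h : T -> U) : shift_hom 1%g h ->
  (forall g x u, sp_comp E g x -> sp_comp U g u -> h (p x u) = sp_act (c g x) u) ->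
  bijective h.
Proof.
move=> hh hE; have [hD hZ hC] := hh.
have hC1 g x : sp_comp T g x -> sp_comp U g (h x).
  by move=> /hC; rewrite mulg1.
have K g x : sp_comp T g x -> x = p (e g) (h x).
  have [_ br bz] := gt_bal gt g.
  move: x; apply: (gt_comp_ind_comp gt) => [|x y cx cy Ex Ey|x u cx cu].
  - by rewrite morphD0 // (gt_0r gt (e_comp g)).
  - by rewrite hD br; auto; rewrite -Ex -Ey.
  - by rewrite (hE g) // [in LHS](E_comp cx) bz.
apply: inj_surj_bij.
  apply: morphD_inj => // x h0; apply: (eq_proj (gr := sp_grading T)) => g.
  rewrite proj0 (K g (proj (sp_grading T) g x)); last exact: sp_proj.
  rewrite -(shift_hom_proj hh) h0 proj0.
  exact: gt_0r gt _ _ (e_comp g).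
move=> u; have [s ->] := proj_decomp (sp_grading U) u.
exists (\sum_(g <- s) p (e g) (proj (sp_grading U) g u)).
rewrite (morphD_sum hD); apply: eq_bigr => g _.
by rewrite (hE g) ?c_e ?act1 //; apply: sp_proj.
Qed.

End UnitSpace.

Section AssocUnit.
Context (F : fieldType) (G : groupType).
Implicit Types (A B C : grAlg F G) (P Q S : grPair F G).

Lemma gprod_assoc P Q S :
  G_equivariant (gprod (gprod P Q) S) (gprod P (gprod Q S)).
Proof.
pose A := gp_alg P; pose B := gp_alg Q; pose C := gp_alg S.
have gAB := gtens_graded_tensor A B.
have gAB_C := gtens_graded_tensor (gtens_alg A B) C.
have gBC := gtens_graded_tensor B C.
have gA_BC := gtens_graded_tensor A (gtens_alg B C).
have mAB := gmtens_graded_tensor P Q.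
have mAB_C := gmtens_graded_tensor (gprod P Q) S.
have mBC := gmtens_graded_tensor Q S.
have mA_BC := gmtens_graded_tensor P (gprod Q S).
have [Psi sh sE] := gt_assoc gAB gAB_C gBC gA_BC.
have [Phi mh mE] := gt_assoc mAB mAB_C mBC mA_BC.
have [sD sZ sC] := sh; have [mD mZ mC] := mh.
have pcomp g (a : A) (b : B) : ga_comp A g a -> ga_comp B g b ->
  ga_comp (gtens_alg A B) g (gpure a b) by move=> *; apply: (gt_comp gAB).
have pcomp' g (a : B) (b : C) : ga_comp B g a -> ga_comp C g b ->
  ga_comp (gtens_alg B C) g (gpure a b) by move=> *; apply: (gt_comp gBC).
have mcomp g (a : P) (b : Q) : gm_comp P g a -> gm_comp Q g b ->
  gm_comp (gprod P Q) g (gmpure a b) by move=> *; apply: (gt_comp mAB).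
have mcomp' g (a : Q) (b : S) : gm_comp Q g a -> gm_comp S g b ->
  gm_comp (gprod Q S) g (gmpure a b) by move=> *; apply: (gt_comp mBC).
apply/G_equivariantP; exists Psi, Phi; split=> //.
- split=> // [x y|k|g x cx].
  + move: x; apply: (gt_ind3 gAB gAB_C) => [|x x' E E'|g a b c ca cb cc].
    * by rewrite mul0r !(morphD0 sD) mul0r.
    * by rewrite mulrDl !sD E E' mulrDl.
    move: y; apply: (gt_ind3 gAB gAB_C) => [|y y' E E'|h a' b' c' ca' cb' cc'].
    * by rewrite mulr0 !(morphD0 sD) mulr0.
    * by rewrite mulrDr !sD E E' mulrDr.
    rewrite (sE g) // (sE h) // (@gtens_mul_pure _ _ _ _ g h); auto.
    rewrite (@gtens_mul_pure _ _ _ _ g h); auto.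
    rewrite (@gtens_mul_pure _ _ _ _ g h); auto.
    rewrite (@gtens_mul_pure _ _ _ _ g h); auto.
    by rewrite (sE (g * h)%g) //; apply: ga_mul.
  + rewrite !gtens_in_pure (sE 1%g); [|exact: ga_in_comp|exact: ga_one|exact: ga_one].
    have : ga_in (gtens_alg B C) 1 = gpure (ga_in B 1) 1 by apply: gtens_in_pure.
    by rewrite !rmorph1 => <-.
  + by have := sC g x cx; rewrite mulg1.
- exact: (gt_assoc_bij gAB gAB_C gBC gA_BC sD sE).
- move=> x y; move: x; apply: (gt_ind3 gAB gAB_C) => [|x x' E E'|g a b c ca cb cc].
  + by rewrite scale0r (morphD0 mD) (morphD0 sD) scale0r.
  + by rewrite scalerDl mD E E' sD scalerDl.
  move: y; apply: (gt_ind3 mAB mAB_C) => [|y y' E E'|h w w' w'' cw cw' cw''].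
  + by rewrite scaler0 (morphD0 mD) scaler0.
  + by rewrite scalerDr !mD E E' scalerDr.
  rewrite (sE g) // (mE h) //.
  rewrite (@gtens_act_pure _ _ _ _ _ _ g h); auto.
  rewrite (@gtens_act_pure _ _ _ _ _ _ g h); auto.
  rewrite (@gtens_act_pure _ _ _ _ _ _ g h); auto.
  rewrite (@gtens_act_pure _ _ _ _ _ _ g h); auto.
  by rewrite (mE (g * h)%g) //; apply: gm_act.
- exact: (gt_assoc_bij mAB mAB_C mBC mA_BC mD mE).
Qed.

Definition group_alg : grAlg F G := twisted_group_alg (cocycle_one F G).

Fact regular_act A g h (a : A) (x : (A : pzRingType)^o) :
  ga_comp A g a -> ga_comp A h x -> ga_comp A (g * h)%g (a *: x).
Proof. exact: ga_mul. Qed.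

Definition regular_mod A : grMod A :=
  @GrMod F G A (A : pzRingType)^o (ga_comp A) (ga_grading A) (@regular_act A).

Definition unit_pair : grPair F G := GrPair (regular_mod group_alg).

Definition coef (g : G) (x : group_alg) : F := \val (x : tga F G) g.

Lemma coefD g : {morph coef g : x y / x + y}.
Proof. by move=> x y; rewrite /coef raddfD. Qed.

Lemma group_alg_comp g (x : group_alg) : ga_comp group_alg g x ->
  x = mon (coef g x) g.
Proof. exact: tga_compE. Qed.

Lemma mon_mul (alpha : cocycle F G) k g l h :
  (mon k g : twisted_group_alg alpha) * mon l h =
  mon (k * l * alpha g h) (g * h)%g.
Proof. exact: tga_mul_mon. Qed.

Lemma coef_mon g k : coef g (mon k g) = k.
Proof. by rewrite /coef /= eqxx. Qed.

Lemma coefM g h (x y : group_alg) : ga_comp group_alg g x ->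
  ga_comp group_alg h y -> coef (g * h)%g (x * y) = coef g x * coef h y.
Proof.
move=> /group_alg_comp-> /group_alg_comp ->.
by rewrite mon_mul !coef_mon mulr1.
Qed.

Lemma coef_in k : coef 1%g (ga_in group_alg k) = k.
Proof. by rewrite [LHS]coef_mon divr1. Qed.

Lemma coef_scale g k x : coef g (ga_in group_alg k * x) = k * coef g x.
Proof.
move: x; apply: tga_ind => [|x y Ex Ey|l h].
- by rewrite mulr0 (morphD0 (coefD g)) mulr0.
- by rewrite mulrDr !coefD Ex Ey mulrDr.
- rewrite -[ga_in _ _ * _]/(tga_mul (cocycle_one F G) (tga_in (cocycle_one F G) k) _) tga_in_mul /coef /=.
  by case: eqP => // _; rewrite mulr0.
Qed.

Lemma coef_scale' g k (x : regular_mod group_alg) :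
  coef g (ga_in group_alg k *: x) = k * coef g x.
Proof. exact: coef_scale. Qed.

(** The isomorphism is induced by the augmentation: [v_g (x) a |-> a] on [A_g],
    and likewise on the module. *)
Lemma gprod_unit P : G_equivariant (gprod unit_pair P) P.
Proof.
pose A := gp_alg P.
have gA := gtens_graded_tensor group_alg A.
have gM := gmtens_graded_tensor unit_pair P.
have [g|psi pD pE] := gt_lift gA (b := fun g x (a : A) => ga_in A (coef g x) * a).
  split=> [u u' v _ _ _|u v v' _ _ _|k u v _ _].
  - by rewrite coefD rmorphD mulrDl.
  - by rewrite mulrDr.
  - by rewrite /= coef_scale rmorphM mulrA -rmorphM mulrC rmorphM.
have [g|phi mD mE] := gt_lift gM (b := fun g x (w : P) => ga_in A (coef g x) *: w).
  split=> [u u' v _ _ _|u v v' _ _ _|k u v _ _].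
  - by rewrite coefD rmorphD scalerDl.
  - by rewrite scalerDr.
  - by rewrite [sp_act k u]/(_ *: _) coef_scale' scalerA -rmorphM mulrC.
have ph : shift_hom 1%g (psi : alg_space (gtens_alg group_alg A) -> alg_space A).
  apply: (shift_hom_pure gA) => // [g x a cx ca|g k x a cx ca].
    by rewrite (pE g) // mulg1; apply: ga_scale.
  have ckx := sp_actC k cx.
  by rewrite !(pE g) //= coef_scale rmorphM mulrA.
have mh : shift_hom 1%g (phi : mod_space (gprod unit_pair P) -> mod_space P).
  apply: (shift_hom_pure gM) => // [g x a cx ca|g k x a cx ca].
    by rewrite (mE g) // mulg1; apply: gm_scale.
  have ckx := sp_actC k cx.
  rewrite !(mE g) // [sp_act k x]/(_ *: _) coef_scale'.
  by rewrite [RHS]scalerA rmorphM.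
have mon_comp g : ga_comp group_alg g (mon 1 g).
  exact: mon_comp.
apply/G_equivariantP; exists psi, phi; split=> //.
- apply: gtens_hom => // [g h a b a' b' ca cb ca' cb'|k].
    rewrite (pE (g * h)%g); [|exact: ga_mul|exact: ga_mul].
    rewrite (pE g) // (pE h) // coefM // rmorphM -!mulrA; congr (_ * _).
    by rewrite !mulrA; congr (_ * _); rewrite ga_central.
  by rewrite (pE 1%g) ?coef_in ?mulr1 //; [exact: ga_in_comp|exact: ga_one].
- apply: (gt_unit_bij gA (e := mon 1) (c := coef)) ph _ => //.
  + by move=> g; rewrite coef_mon.
  + move=> g x cx; rewrite [LHS](group_alg_comp cx).
    by rewrite [RHS]tga_in_mul mulr1.
  + by move=> a /=; rewrite rmorph1 mul1r.
- apply: gtens_act_hom => // g h a b w w' ca cb cw cw'.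
  rewrite (mE (g * h)%g); [|exact: (@gm_act _ _ _ unit_pair)|exact: gm_act].
  rewrite (pE g) // (mE h) //.
  rewrite [a *: w]/((a : group_alg) * (w : group_alg)) coefM // rmorphM !scalerA.
  by congr (_ *: _); rewrite -!mulrA; congr (_ * _); rewrite ga_central.
- by have [] := mh.
- apply: (gt_unit_bij gM (e := mon 1) (c := coef)) mh _ => //.
  + by move=> g; rewrite coef_mon.
  + move=> g x cx; rewrite [LHS](group_alg_comp cx).
    by rewrite [RHS]tga_in_mul mulr1.
  + by move=> a /=; rewrite rmorph1 scale1r.
Qed.

End AssocUnit.

(** * Density and absolute simplicity *)
Section GradedSimple.
Context (F : fieldType) (G : groupType) (A : grAlg F G).
Implicit Types (V W : grMod A).

Lemma proj_actl V g h (a : A) (v : V) : gm_comp V g v ->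
  proj (gm_grading V) (h * g)%g (a *: v) = proj (ga_grading A) h a *: v.
Proof.
move=> cv; apply: (proj_shift (ga_grading A) (gm_grading V)
  (m := fun a => a *: v) (sh := fun h => (h * g)%g)).
- by move=> x y; rewrite scalerDl.
- exact: mulIg.
- by move=> k x cx; apply: gm_act.
Qed.

(** For [I] a graded left ideal, [I v] is a graded submodule. *)
Lemma orbit_graded V g (v : V) (I : set A) : gm_comp V g v ->
  I 0 -> (forall a b, I a -> I b -> I (a + b)) -> (forall b a, I a -> I (b * a)) ->
  (forall h a, I a -> I (proj (ga_grading A) h a)) ->
  graded_submodule [set x : V | exists2 a, I a & x = a *: v].
Proof.
move=> cv I0 ID IM IP; split; first split.
- by exists 0; rewrite ?scale0r.
- move=> _ _ [a Ia ->] [b Ib ->]; exists (a + b); rewrite ?scalerDl //; exact: ID.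
- move=> b _ [a Ia ->]; exists (b * a); rewrite ?scalerA //; exact: IM.
- move=> _ [a Ia ->]; have [s Ea] := proj_decomp (ga_grading A) a.
  exists [seq (h * g)%g | h <- s],
    (fun k => proj (ga_grading A) (k * g^-1)%g a *: v); split=> [k|].
    split; last by exists (proj (ga_grading A) (k * g^-1)%g a) => //; apply: IP.
    rewrite -{1}(mulgVK g k); apply: gm_act => //; exact: proj_comp.
  rewrite big_map [in LHS]Ea scaler_suml; apply: eq_bigr => h _.
  by rewrite mulgK.
Qed.

Lemma homog_gen V g (w v : V) : graded_simple V -> gm_comp V g w -> w != 0 ->
  exists a : A, v = a *: w.
Proof.
move=> [_ sV] cw w0.
have [||||E|E] := sV _ (@orbit_graded V g w setT cw _ _ _ _) => //.
  have : [set x : V | exists2 a, setT a & x = a *: w] w.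
    by exists 1; rewrite ?scale1r.
  by rewrite E /= => E'; rewrite E' eqxx in w0.
have : [set x : V | exists2 a, setT a & x = a *: w] v by rewrite E.
by move=> [a _ ->]; exists a.
Qed.

Lemma homog_gen_deg V g h (w v : V) : graded_simple V -> gm_comp V g w -> w != 0 ->
  gm_comp V h v -> exists2 a : A, ga_comp A (h * g^-1)%g a & v = a *: w.
Proof.
move=> sV cw w0 cv; have [a E] := homog_gen v sV cw w0.
exists (proj (ga_grading A) (h * g^-1)%g a); first exact: proj_comp.
by rewrite -(proj_actl _ _ cw) -E mulgVK (proj_compK _ cv).
Qed.

Lemma graded_simple_intro V : (exists v : V, v != 0) ->
  (forall (N : set V) g v, graded_submodule N -> N v -> gm_comp V g v ->
     v != 0 -> forall x, N x) ->
  graded_simple V.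
Proof.
move=> V0 Vgen; split=> // N gN.
have [[y Ny y0]|Nex] := pselect (exists2 y, N y & y != 0); last first.
  left; apply/seteqP; split=> [y Ny /=|y /= ->]; last exact: subm0 gN.
  by apply: contrapT => /eqP y0; apply: Nex; exists y.
right; have [g xg] : exists g, proj (gm_grading V) g y != 0.
  apply: contrapT => /forallNP H0; move: y0; suff -> : y = 0 by rewrite eqxx.
  apply: (eq_proj (gr := gm_grading V)) => h; rewrite proj0.
  by apply: contrapT => /eqP /H0.
apply/seteqP; split=> // z _.
apply: (Vgen N g _ gN _ _ xg z); last exact: proj_comp.
exact: (gsub_proj (N := GSubmod gN)).
Qed.

(** The isomorphism is [a v |-> a w].  It is well defined because the elements
    [a w] with [a v = 0] form a graded submodule, which is proper since it has no
    component in the degree of [w]; for injectivity the roles of [v] and [w] are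
    exchanged. *)
Lemma graded_extend V W g (v : V) (w : W) : graded_simple V -> graded_simple W ->
  gm_comp V g v -> v != 0 -> gm_comp W g w -> w != 0 ->
  (forall a : A, ga_comp A 1%g a -> a *: v = 0 -> a *: w = 0) ->
  exists phi : V -> W, [/\ {morph phi : x y / x + y},
    forall a x, phi (a *: x) = a *: phi x, bijective phi,
    forall h x, gm_comp V h x -> gm_comp W h (phi x) & phi v = w].
Proof.
move=> sV sW cv v0 cw w0 ann_e.
have ann_graded (U : grMod A) (u : U) : gm_comp U g u -> forall h a, a *: u = 0 ->
    proj (ga_grading A) h a *: u = 0.
  by move=> cu h a E; rewrite -(proj_actl _ _ cu) E proj0.
have orb (U U' : grMod A) (u : U) (u' : U') : gm_comp U g u -> gm_comp U' g u' ->
  graded_submodule [set x : U' | exists2 a, a *: u = 0 & x = a *: u'].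
  move=> cu cu'; apply: (orbit_graded (I := [set a | a *: u = 0]) cu').
  - by rewrite /mkset scale0r.
  - by move=> a b /= Ea Eb; rewrite scalerDl Ea Eb addr0.
  - by move=> b a /= Ea; rewrite -scalerA Ea scaler0.
  - by move=> h a; apply: ann_graded.
have ann a : a *: v = 0 -> a *: w = 0.
  move=> Ea; have [_ /(_ _ (orb _ _ _ _ cv cw))[E|E]] := sW.
    have : [set x : W | exists2 a, a *: v = 0 & x = a *: w] (a *: w) by exists a.
    by rewrite E.
  have : [set x : W | exists2 a, a *: v = 0 & x = a *: w] w by rewrite E.
  move=> [b Eb Ew]; have := proj_actl 1%g b cw.
  rewrite mul1g -Ew (proj_compK _ cw) ann_e ?(ann_graded _ _ cv) //.
    by move=> w00; rewrite w00 eqxx in w0.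
  exact: proj_comp.
have ann' a : a *: w = 0 -> a *: v = 0.
  move=> Ea; have [_ /(_ _ (orb _ _ _ _ cw cv))[E|E]] := sV.
    have : [set x : V | exists2 a, a *: w = 0 & x = a *: v] (a *: v) by exists a.
    by rewrite E.
  have : [set x : V | exists2 a, a *: w = 0 & x = a *: v] v by rewrite E.
  move=> [b Eb Ev]; have : (1 - b) *: w = 0.
    by apply: ann; rewrite scalerBl scale1r -Ev subrr.
  by rewrite scalerBl Eb subr0 scale1r => w00; rewrite w00 eqxx in w0.
have /choice[c cE] : forall x, exists a : A, x = a *: v.
  by move=> x; apply: homog_gen cv v0.
pose phi x := c x *: w.
have phiE a : phi (a *: v) = a *: w.
  apply/eqP; rewrite -subr_eq0 -scalerBl; apply/eqP/ann.
  by rewrite scalerBl -cE subrr.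
exists phi; split.
- by move=> x y; rewrite (cE x) (cE y) -scalerDl !phiE scalerDl.
- by move=> a x; rewrite (cE x) scalerA !phiE scalerA.
- apply: inj_surj_bij => [x y|y].
    rewrite (cE x) (cE y) !phiE => E; apply/eqP; rewrite -subr_eq0 -scalerBl.
    by apply/eqP/ann'; rewrite scalerBl E subrr.
  by have [a ->] := homog_gen y sW cw w0; exists (a *: v).
- move=> h x cx; have [a ca ->] := homog_gen_deg sV cv v0 cx.
  by rewrite phiE -[h](mulgVK g); apply: gm_act.
- by rewrite -[v]scale1r phiE scale1r.
Qed.

Lemma abs_simple_scalar W g (w v : W) : abs_graded_simple W ->
  gm_comp W g w -> w != 0 -> gm_comp W g v ->
  (forall a : A, ga_comp A 1%g a -> a *: w = 0 -> a *: v = 0) ->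
  exists k, v = ga_in A k *: w.
Proof.
move=> [sW eW] cw w0 cv ann.
have [->|v0] := eqVneq v 0; first by exists 0; rewrite rmorph0 scale0r.
have [phi [pD pA _ pC <-]] := graded_extend sW sW cw w0 cv v0 ann.
have [f fE] := linear_pack pD pA.
have [|k kE] := eW f; first by rewrite fE.
by exists k; rewrite -kE fE.
Qed.

Fixpoint in_span (U : gspace F G) (s : seq U) (w : U) : Prop :=
  if s is u :: s' then exists k, in_span s' (w - sp_act k u) else w = 0.

(** Induction on [s].  Let [J] be the ideal of [A_e] killing the tail of [u :: s].
    If [a0] in [J] does not kill [u], then [a0 u] and [a0 w] satisfy
    [abs_simple_scalar], so that [a0 w = k a0 u]; since [a0 u] generates [W_g],
    this yields [a w = k a u] for all [a] in [J], and [w - k u] is covered by the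
    induction hypothesis. *)
Lemma double_annihilator W g (s : seq W) (w : W) : abs_graded_simple W ->
  (forall u, u \in s -> gm_comp W g u) -> gm_comp W g w ->
  (forall a : A, ga_comp A 1%g a -> (forall u, u \in s -> a *: u = 0) -> a *: w = 0) ->
  in_span (U := mod_space W) s w.
Proof.
move=> sW; elim: s w => [|u s IH] w sc cw ann.
  by rewrite /= -[w]scale1r; apply: ann => //; apply: ga_one.
have cu : gm_comp W g u by apply: sc; rewrite mem_head.
have sc' x : x \in s -> gm_comp W g x by move=> xs; apply: sc; rewrite inE xs orbT.
have annU a : ga_comp A 1%g a -> (forall x, x \in s -> a *: x = 0) ->
    a *: u = 0 -> a *: w = 0.
  move=> ca as0 au0; apply: ann => // x; rewrite inE => /orP[/eqP -> //|]; exact: as0.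
have [[a0 [ca0 a0s a0u]]|Nex] := pselect (exists a : A, [/\ ga_comp A 1%g a,
    forall x, x \in s -> a *: x = 0 & a *: u != 0]); last first.
  exists 0; rewrite /= rmorph0 scale0r subr0; apply: IH => // a ca as0.
  apply: annU => //; apply: contrapT => /eqP au; apply: Nex.
  by exists a.
have c0u : gm_comp W g (a0 *: u) by rewrite -[g]mul1g; apply: gm_act.
have c0w : gm_comp W g (a0 *: w) by rewrite -[g]mul1g; apply: gm_act.
have [b cb|k kE] := abs_simple_scalar sW c0u a0u c0w.
  rewrite !scalerA; apply: annU => [|x xs]; last by rewrite -scalerA a0s ?scaler0.
  by rewrite -[1%g]mul1g; apply: ga_mul.
exists k; apply: IH => //.
  by apply: (compB (gm_grading W)) => //; apply: gm_scale.
move=> a ca as0.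
have cau : gm_comp W g (a *: u) by rewrite -[g]mul1g; apply: gm_act.
have [b] := homog_gen_deg (proj1 sW) c0u a0u cau; rewrite mulgV => cb Eb.
have : (a - b * a0) *: w = 0.
  apply: annU => [|x xs|].
  - apply: (compB (ga_grading A)) => //; rewrite -[1%g]mul1g; exact: ga_mul.
  - by rewrite scalerBl as0 // -scalerA a0s // scaler0 subrr.
  - by rewrite scalerBl Eb -scalerA subrr.
rewrite scalerBl -scalerA kE => /eqP; rewrite subr_eq0 => /eqP Ew.
by rewrite scalerBr Ew -!ga_scal_central Eb subrr.
Qed.

(** Invariance identifies all the components with each other. *)
Lemma invariant_comp_neq0 W : G_invariant W -> (exists w : W, w != 0) ->
  forall g, exists2 w : W, gm_comp W g w & w != 0.
Proof.
move=> /G_invariantP IW [w w0] g.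
have [h wh] : exists h, proj (gm_grading W) h w != 0.
  apply: contrapT => /forallNP N0; move: w0; suff -> : w = 0 by rewrite eqxx.
  apply: (eq_proj (gr := gm_grading W)) => h; rewrite proj0.
  by apply: contrapT => /eqP /N0.
have [phi [_ _ pD _ pC b]] := IW (h^-1 * g)%g.
exists (phi (proj (gm_grading W) h w)).
  by have := pC _ _ (proj_comp (gm_grading W) h w); rewrite mulgA mulgV mul1g.
by apply: contra_neq wh => E; apply: (bij_inj b); rewrite E (morphD0 pD).
Qed.

End GradedSimple.

Section MinimalRep.
Context (F : fieldType) (G : groupType) (U V T : gspace F G).
Context (p : U -> V -> T) (gt : graded_tensor p).
Hypothesis vU : vs_axioms (@sp_act F G U).

Definition tensor_rep (g : G) (x : T) (s : seq (U * V)) : Prop :=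
  (forall q, q \in s -> sp_comp U g q.1 /\ sp_comp V g q.2) /\
  x = \sum_(q <- s) p q.1 q.2.

Lemma in_span0 (s : seq U) : in_span s 0.
Proof.
elim: s => //= u s IH; exists 0.
have -> : sp_act (0 : F) u = 0 by apply: (vs0 vU).
by rewrite subrr.
Qed.

(** If [u] is a combination of the [u_i], then [u (x) v] is distributed over the
    terms [u_i (x) v_i]. *)
Lemma in_span_absorb g x (q : U * V) t :
  tensor_rep g x (q :: t) -> in_span (map fst t) q.1 ->
  exists2 s, size s = size t & tensor_rep g x s.
Proof.
case: q => u v [tc ->]; rewrite big_cons /=.
have [cu cv] := tc _ (mem_head _ _); move: cu cv => /= cu cv.
have {tc} : forall q, q \in t -> sp_comp U g q.1 /\ sp_comp V g q.2.
  by move=> q qt; apply: tc; rewrite inE qt orbT.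
have [bl br bz] := gt_bal gt g.
elim: t u cu => [|[u1 v1] t IH] u cu tc /=.
  by move=> ->; exists [::]; rewrite ?big_nil // (gt_0l gt cv); split; rewrite ?big_nil ?addr0.
move=> [k spk]; have [/= cu1 cv1] := tc _ (mem_head _ _).
have cd : sp_comp U g (u - sp_act k u1).
  by apply: (compB (sp_grading U)) => //; apply: sp_actC.
have [|s Es [sc Ex]] := IH _ cd _ spk.
  by move=> q qt; apply: tc; rewrite inE qt orbT.
exists ((u1, v1 + sp_act k v) :: s); first by rewrite /= Es.
have ckv := sp_actC k cv; have cku := sp_actC k cu1.
split.
  move=> q; rewrite inE => /orP[/eqP -> /=|/sc //].
  by split=> //; apply: (compD (sp_grading V)).
have Ep : p u v = p (sp_act k u1) v + p (u - sp_act k u1) v.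
  by rewrite -bl // addrC subrK.
by rewrite !big_cons /= br // -Ex -bz // Ep addrACA [p u1 v1 + _]addrC.
Qed.

End MinimalRep.

Section MinimalRep2.
Context (F : fieldType) (G : groupType) (U V T : gspace F G).
Context (p : U -> V -> T) (gt : graded_tensor p).

(** A representation of minimal length qualifies; the right factors are treated
    by exchanging the roles of [U] and [V]. *)
Lemma minimal_rep g x : sp_comp T g x -> exists2 s, tensor_rep p g x s &
  forall q t, perm_eq s (q :: t) ->
    ~ in_span (map fst t) q.1 /\ ~ in_span (map snd t) q.2.
Proof.
move=> cx; have [s0 rs0] := gt_comp_rep gt cx.
have exn : exists n, `[< exists2 s, size s = n & tensor_rep p g x s >].
  by exists (size s0); apply/asboolP; exists s0.
have [n /asboolP[s sn rs] nmin] := ex_minnP exn.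
exists s => // q t st.
have rqt : tensor_rep p g x (q :: t).
  have [sc ->] := rs; split; last exact: perm_big.
  by move=> r; rewrite -(perm_mem st); apply: sc.
have tn : (size t < n)%N by rewrite -sn (perm_size st).
have Nsz t' : size t' = size t -> ~ tensor_rep p g x t'.
  move=> E rt'; have /nmin : `[< exists2 s, size s = size t & tensor_rep p g x s >].
    by apply/asboolP; exists t'.
  by rewrite leqNgt tn.
split=> sp.
  by have [t' /Nsz] := in_span_absorb gt rqt sp.
pose swap (Y Z : Type) (r : Y * Z) := (r.2, r.1).
have rsw : tensor_rep (fun v u => p u v) g x (map (@swap _ _) (q :: t)).
  have [sc ->] := rqt; split; last by rewrite big_map.
  by move=> _ /mapP[r /sc[cu cv] ->].
have [|t' t'n [sc Ex]] := in_span_absorb (gt_flip gt) rsw.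
  by rewrite -map_comp.
apply: (Nsz (map (@swap _ _) t')); first by rewrite size_map t'n size_map.
split; last by rewrite big_map.
by move=> _ /mapP[r /sc[cu cv] ->].
Qed.

End MinimalRep2.

Section TensorSimple.
Context (F : fieldType) (G : groupType) (A B : grAlg F G).
Context (W : grMod A) (W' : grMod B).
Hypothesis (sW : abs_graded_simple W) (sW' : abs_graded_simple W').
Hypothesis (iW : G_invariant W) (iW' : G_invariant W').

Let gM := gmtens_graded_tensor W W'.
Let T := gtens_mod W W'.

Lemma gmpure_neq0 g (w : W) (w' : W') : gm_comp W g w -> gm_comp W' g w' ->
  w != 0 -> w' != 0 -> gmpure w w' != 0.
Proof.
exact: (gt_pure_neq0 gM (mod_space_vs W) (mod_space_vs W')).
Qed.

Lemma exists_separating g (E : grAlg F G) (Z : grMod E) (s : seq Z) (w : Z) :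
  abs_graded_simple Z -> (forall u, u \in s -> gm_comp Z g u) ->
  gm_comp Z g w -> ~ in_span (U := mod_space Z) s w ->
  exists a : E, [/\ ga_comp E 1%g a, forall u, u \in s -> a *: u = 0 & a *: w != 0].
Proof.
move=> sZ sc cw nsp; apply: contrapT => Nex; apply: nsp.
apply: (double_annihilator sZ sc cw) => a ca as0.
by apply: contrapT => /eqP aw; apply: Nex; exists a.
Qed.

Lemma gmpure_gen g (w : W) (w' : W') : gm_comp W g w -> gm_comp W' g w' ->
  w != 0 -> w' != 0 -> forall K : T -> Prop, K 0 ->
  (forall x y, K x -> K y -> K (x + y)) ->
  (forall c : gtens_alg A B, K (c *: gmpure w w')) -> forall x, K x.
Proof.
move=> cw cw' w0 w'0 K K0 KD KZ; apply: (gt_ind gM) => // h v v' cv cv'.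
have [a ca ->] := homog_gen_deg (proj1 sW) cw w0 cv.
have [b cb ->] := homog_gen_deg (proj1 sW') cw' w'0 cv'.
by rewrite -(gtens_act_pure ca cb cw cw').
Qed.

(** In a minimal representation of a nonzero [x] in the submodule [N], density
    gives [a] killing all left factors but one, so that [(a (x) 1) x] is a nonzero
    pure tensor in [N]; and any nonzero pure tensor generates. *)
Lemma gprod_simple : graded_simple T.
Proof.
apply: graded_simple_intro => [|N g x gN Nx cx xg].
  have [w cw w0] := invariant_comp_neq0 iW (proj1 (proj1 sW)) 1%g.
  have [w' cw' w'0] := invariant_comp_neq0 iW' (proj1 (proj1 sW')) 1%g.
  by exists (gmpure w w'); apply: gmpure_neq0 cw cw' w0 w'0.
have [[N0 ND NZ] _] := gN.
have [[|q t] [sc Ex] smin] := minimal_rep gM cx.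
  by rewrite Ex big_nil eqxx in xg.
have [nsp1 nsp2] := smin q t (perm_refl _).
have [cq1 cq2] := sc _ (mem_head _ _).
have tc r : r \in t -> gm_comp W g r.1 /\ gm_comp W' g r.2.
  by move=> rt; apply: sc; rewrite inE rt orbT.
have [|a [ca at0 aq]] := exists_separating sW _ cq1 nsp1.
  by move=> _ /mapP[r /tc[] ? _ ->].
have q20 : q.2 != 0.
  apply/eqP => E; apply: nsp2; rewrite E.
  exact: in_span0 (mod_space_vs W') _.
have Ncx : N (gmpure (a *: q.1) q.2).
  suff <- : gpure a 1 *: x = gmpure (a *: q.1) q.2 by apply: NZ.
  rewrite Ex big_cons scalerDr (gtens_act_pure ca (ga_one B) cq1 cq2) scale1r.
  rewrite scaler_sumr big_seq big1 ?addr0 // => r rt.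
  have [cr1 cr2] := tc _ rt.
  rewrite (gtens_act_pure ca (ga_one B) cr1 cr2) at0 ?map_f //.
  by rewrite scale1r (gt_0l gM cr2).
have caq : gm_comp W g (a *: q.1) by rewrite -[g]mul1g; apply: gm_act.
by apply: (gmpure_gen caq cq2 aq q20) => // c; apply: NZ.
Qed.

(** Let [phi] be an endomorphism and [x] the image of a nonzero pure tensor
    [u (x) v].  Isolating one term of a minimal representation of [x] by an
    element acting on the right factor shows that whatever kills [u] kills each
    left factor; so these are multiples of [u] and [x = u (x) v1].  In the same way [v1] is
    a multiple of [v]. *)
Lemma gprod_abs_simple : abs_graded_simple T.
Proof.
split; first exact: gprod_simple.
move=> phi pC.
have [u cu u0] := invariant_comp_neq0 iW (proj1 (proj1 sW)) 1%g.
have [v cv v0] := invariant_comp_neq0 iW' (proj1 (proj1 sW')) 1%g.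
pose x := phi (gmpure u v).
have cx : gm_comp T 1%g x by apply: pC; apply: (gt_comp gM).
have comp1 (E : grAlg F G) (Z : grMod E) (a : E) (z : Z) : ga_comp E 1%g a ->
    gm_comp Z 1%g z -> gm_comp Z 1%g (a *: z).
  by move=> ca cz; rewrite -[1%g]mul1g; apply: gm_act.
have pure0l (w' : W') : gm_comp W' 1%g w' -> gmpure 0 w' = 0 :> T.
  exact: (gt_0l gM (g := 1%g)).
have pure0r (w : W) : gm_comp W 1%g w -> gmpure w 0 = 0 :> T.
  exact: (gt_0r gM (g := 1%g)).
have [bl br bz] := gt_bal gM 1%g.
have pure_eq0 (w : W) (w' : W') : gm_comp W 1%g w -> gm_comp W' 1%g w' ->
    w' != 0 -> gmpure w w' = 0 -> w = 0.
  move=> cw cw' w'0 E; apply: contrapT => /eqP w0.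
  by have := gmpure_neq0 cw cw' w0 w'0; rewrite E eqxx.
have pure_eq0' (w : W) (w' : W') : gm_comp W 1%g w -> gm_comp W' 1%g w' ->
    w != 0 -> gmpure w w' = 0 -> w' = 0.
  move=> cw cw' w0 E; apply: contrapT => /eqP w'0.
  by have := gmpure_neq0 cw cw' w0 w'0; rewrite E eqxx.
have [s [sc Ex] smin] := minimal_rep gM cx.
have [v1 cv1 Ev1] : exists2 v1, gm_comp W' 1%g v1 & x = gmpure u v1.
  (* an element [b] isolates the term [q] through its right factor *)
  have scal q : q \in s -> exists k, q.1 = ga_in A k *: u.
    move=> qs; have st := perm_to_rem qs; have [_ nsp] := smin _ _ st.
    have [cq1 cq2] := sc _ qs.
    have tc r : r \in rem q s -> gm_comp W 1%g r.1 /\ gm_comp W' 1%g r.2.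
      by move=> rt; apply: sc; rewrite (perm_mem st) inE rt orbT.
    have [|b [cb bt0 bq]] := exists_separating sW' _ cq2 nsp.
      by move=> _ /mapP[r /tc[] _ ? ->].
    apply: (abs_simple_scalar sW cu u0 cq1) => a ca au0.
    apply: (pure_eq0 _ (b *: q.2)); [exact: comp1|exact: comp1|exact: bq|].
    transitivity (gpure a b *: x).
      rewrite Ex (perm_big _ st) big_cons scalerDr /=.
      rewrite (gtens_act_pure ca cb cq1 cq2).
      rewrite scaler_sumr big_seq big1 ?addr0 // => r rt.
      have [cr1 cr2] := tc _ rt.
      rewrite (gtens_act_pure ca cb cr1 cr2) bt0 ?map_f //.
      by rewrite pure0r //; apply: comp1.
    rewrite /x -linearZ /= (gtens_act_pure ca cb cu cv) au0 pure0l ?linear0 //.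
    exact: comp1.
  rewrite Ex; clear -scal sc br bz cu pure0r.
  elim: s sc scal => [|q s IH] sc scal.
    by exists 0; rewrite ?big_nil ?pure0r //; apply: (comp0 (gm_grading W')).
  have [||v2 cv2 E2] := IH.
    by move=> r rs; apply: sc; rewrite inE rs orbT.
    by move=> r rs; apply: scal; rewrite inE rs orbT.
  have [k kE] := scal _ (mem_head _ _); have [_ cq2] := sc _ (mem_head _ _).
  have ck : gm_comp W' 1%g (ga_in B k *: q.2) by apply: gm_scale.
  exists (ga_in B k *: q.2 + v2); first exact: (compD (gm_grading W')).
  by rewrite big_cons E2 br // kE; congr (_ + _); apply: bz.
have [b cb bv0|k kE] := abs_simple_scalar sW' cv v0 cv1.
  apply: (pure_eq0' u); [exact: cu|exact: comp1|exact: u0|].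
  rewrite -[u in LHS]scale1r -(gtens_act_pure (ga_one A) cb cu cv1) -Ev1.
  rewrite /x -linearZ /= (gtens_act_pure (ga_one A) cb cu cv) bv0 pure0r ?linear0 //.
  exact: comp1 (ga_one A) cu.
exists k => y; move: y; apply: (gmpure_gen cu cv u0 v0) => [|y z Ey Ez|c].
- by rewrite linear0 scaler0.
- by rewrite linearD scalerDr Ey Ez.
- rewrite linearZ /= -/x Ev1 kE.
  transitivity (c *: (ga_in (gtens_alg A B) k *: gmpure u v)); last first.
    exact: esym (ga_scal_central k c _).
  congr (_ *: _).
  have -> : gmpure u (ga_in B k *: v) = gmpure (ga_in A k *: u) v.
    by have := bz k u v cu cv.
  rewrite gtens_in_pure (gtens_act_pure (ga_in_comp A k) (ga_one B) cu cv).
  by rewrite scale1r.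
Qed.

End TensorSimple.

(** * The unit and the induced modules *)
Section UnitPair.
Context (F : fieldType) (G : groupType).
Let E := group_alg F G.

Lemma group_alg_mon k g l h :
  (mon k g : E) * mon l h = mon (k * l) (g * h)%g.
Proof. by rewrite mon_mul mulr1. Qed.

Lemma group_alg_one : 1 = mon 1 1%g :> E.
Proof.
have <- : ga_in E 1 = mon 1 1%g by rewrite [LHS]/(mon _ _) divr1.
by rewrite rmorph1.
Qed.

Lemma unit_pair_invariant : G_invariant (unit_pair F G).
Proof.
apply/G_invariantP => g; exists (fun x : E => x * mon 1 g); split=> //.
- by exists id.
- by move=> x y; rewrite mulrDl.
- by move=> a x; apply: esym (mulrA (a : E) (x : E) (mon 1 g : E)).
- by move=> h x cx; apply: ga_mul => //; apply: mon_comp.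
- exists (fun x : E => x * mon 1 g^-1%g) => x.
    by rewrite -mulrA group_alg_mon mulr1 mulgV -group_alg_one mulr1.
  by rewrite -mulrA group_alg_mon mulr1 mulVg -group_alg_one mulr1.
Qed.

Lemma unit_pair_abs_simple : abs_graded_simple (unit_pair F G).
Proof.
split.
  apply: graded_simple_intro => [|N g x gN Nx cx x0 y].
    exists (mon 1 1%g); apply/eqP => /(congr1 (coef 1%g)).
    by rewrite coef_mon => /eqP; rewrite (negbTE (oner_neq0 F)).
  move: cx x0 Nx => /group_alg_comp -> x0 Nx.
  have k0 : coef g x != 0.
    by apply: contra_neq x0 => ->; apply: mon0.
  have Ey : ((y : E) * mon (coef g x)^-1 g^-1%g) * mon (coef g x) g = y.
    rewrite -mulrA group_alg_mon mulVf // mulVg.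
    by rewrite -group_alg_one mulr1.
  have := submZ gN ((y : E) * mon (coef g x)^-1 g^-1%g) Nx.
  by rewrite [_ *: _]Ey.
move=> phi pC.
have c1 : ga_comp E 1%g (phi (1 : E)) by apply: pC; apply: ga_one.
exists (coef 1%g (phi (1 : E))) => w.
have -> : w = (w : E) *: (1 : E^o) :> unit_pair F G.
  exact: esym (mulr1 (w : E)).
rewrite linearZ /= {1}(group_alg_comp c1).
set k := coef _ _; rewrite -[RHS]/(ga_in E k * ((w : E) * 1)) mulr1 ga_central.
by rewrite [ga_in _ _]/(mon _ _) divr1.
Qed.

End UnitPair.

Section Induced.
Context (F : fieldType) (G : groupType) (A : grAlg F G).

Section OneModule.
Context (M : lmodType (base A)).
Let I := ind_mod M.
Let V := ind_bar M.
Let N0 := GSubmod (max_zero_e_sub I).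

(** The copy of [M] in degree [e]. *)
Definition ind_gen (m : M) : V := gpi N0 (ipure 1 m).

Lemma scale_gpi (a : A) (w : I) : a *: (gpi N0 w : V) = gpi N0 (a *: w).
Proof. exact: gquot_actE. Qed.

Lemma scale_ind_gen a m : a *: ind_gen m = gpi N0 (ipure a m).
Proof.
have E : ind_act a (ipure 1 m) = ipure a m by rewrite ind_actE mulr1.
by rewrite /ind_gen scale_gpi -E.
Qed.

Lemma ind_genD : {morph ind_gen : m m' / m + m'}.
Proof. by move=> m m'; rewrite /ind_gen /ipure tpureDr; apply: gpiD. Qed.

Lemma ind_genZ r m : ind_gen (r *: m) = (\val r : A) *: ind_gen m.
Proof. by rewrite scale_ind_gen /ind_gen /ipure -tpureZ mul1r. Qed.

Lemma ind_gen_comp m : gm_comp V 1%g (ind_gen m).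
Proof. by exists (ipure 1 m) => //; apply: tspan_pure => //; apply: ga_one. Qed.

Lemma ind_bar_ind (K : V -> Prop) : K 0 -> (forall x y, K x -> K y -> K (x + y)) ->
  (forall a m, K (a *: ind_gen m)) -> forall x, K x.
Proof.
move=> K0 KD Kg; elim/gquot_ind; elim/ind_ind => [|x y Kx Ky|a m].
- by rewrite gpi0.
- by rewrite gpiD; apply: KD.
- by rewrite -scale_ind_gen.
Qed.

Lemma base_act (a : A) : ga_comp A 1%g a -> exists r : base A, \val r = a.
Proof. by move=> ca; exists (Sub a (asboolT ca)); rewrite SubK. Qed.

Lemma ind_gen_surj x : gm_comp V 1%g x -> exists m, x = ind_gen m.
Proof.
move=> [w + <-]; move: w; apply: tspan_ind => [|x1 y [m Em] [m' Em']|a m ca _].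
- by exists 0; rewrite gpi0 (morphD0 ind_genD).
- by exists (m + m'); rewrite ind_genD -Em -Em' gpiD.
- have [r rE] := base_act ca; exists (r *: m).
  by rewrite ind_genZ rE scale_ind_gen.
Qed.

(** The form [(a, m) |-> a_e m] provides a retraction of the induced module onto
    [M]. *)
Lemma ipure_inj (m : M) : ipure (1 : A) m = 0 -> m = 0.
Proof.
pose e (a : A) : base A := Sub (proj (ga_grading A) 1%g a)
  (asboolT (proj_comp (ga_grading A) 1%g a)).
have bb : balanced (fun (a : A) (r : base A) => a * \val r)
    (fun (r : base A) (m : M) => r *: m) (fun a m => e a *: m).
  split; [split|] => [a b v|a v v'|a r v].
  - rewrite -scalerDl; congr (_ *: _); apply: val_inj.
    by rewrite raddfD /= projD.
  - by rewrite scalerDr.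
  - rewrite scalerA; congr (_ *: _); apply: val_inj.
    rewrite rmorphM /=.
    apply: (proj_shift (ga_grading A) (ga_grading A)
      (m := fun a => a * \val r) (sh := id)) => //.
      by move=> x y; rewrite mulrDl.
    by move=> h x cx; rewrite -[h]mulg1; apply: ga_mul => //; apply: base_comp.
move=> E; have := tlift_pure bb 1 m; rewrite -[tpure _ _ _ _]/(ipure (1 : A) m) E tlift0 //.
have -> : e 1 = 1.
  by apply: val_inj; rewrite rmorph1 /= (proj_compK _ (ga_one A)).
by rewrite scale1r => <-.
Qed.

Lemma ind_gen_inj0 m : ind_gen m = 0 -> m = 0.
Proof.
rewrite -(gpi0 N0) => /gpiP; rewrite subr0 => -[N [gN zN Nm]].
apply: ipure_inj; apply: zN Nm _.
by apply: tspan_pure => //; apply: ga_one.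
Qed.

Lemma gpi_proj g w : proj (gm_grading V) g (gpi N0 w) = gpi N0 (proj (gm_grading I) g w).
Proof.
apply: (proj_shift (gm_grading I) (gm_grading V) (m := gpi N0) (sh := id)) => //.
  exact: gpiD.
by move=> h x cx; exists x.
Qed.

(** The preimage of [N] in the induced module has no component in degree [e] and
    is therefore part of what has been divided out. *)
Lemma zero_e_submodule (N : set V) : graded_submodule N ->
  (forall x, N x -> gm_comp V 1%g x -> x = 0) -> forall x, N x -> x = 0.
Proof.
move=> gN zN; have [[sN0 sND sNZ] _] := gN.
elim/gquot_ind => w Nw; rewrite -(gpi0 N0); apply/gpiP; rewrite subr0.
exists [set w | N (gpi N0 w)]; split=> //.
- split; first split.
  + by rewrite /mkset gpi0.
  + by move=> v v' /= Nv Nv'; rewrite gpiD; apply: sND.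
  + by move=> a v /= Nv; rewrite -scale_gpi; apply: sNZ.
  + move=> v /= Nv; have [s Ev] := proj_decomp (gm_grading I) v.
    exists s, (fun g => proj (gm_grading I) g v); split=> // g.
    split; first exact: proj_comp.
    by rewrite /mkset -gpi_proj; apply: (gsub_proj (N := GSubmod gN)).
- move=> v /= Nv cv.
  have : gpi N0 v = 0 by apply: zN => //; exists v.
  rewrite -(gpi0 N0) => /gpiP; rewrite subr0 => -[N' [gN' zN' N'v]].
  exact: zN'.
Qed.

Context (irrM : irr_module M).

Lemma irr_neq0 : exists m : M, m != 0.
Proof. by have [[]] := irrM. Qed.

Lemma ind_gen_neq0 m : m != 0 -> ind_gen m != 0.
Proof. by apply: contra_neq; apply: ind_gen_inj0. Qed.

Lemma ind_bar_simple : graded_simple V.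
Proof.
have [m0 m00] := irr_neq0; have [[_ sM] _] := irrM.
split; first by exists (ind_gen m0); apply: ind_gen_neq0.
move=> N gN; have [[sN0 sND sNZ] _] := gN.
have [[x [Nx cx x0]]|Nex] := pselect (exists x, [/\ N x, gm_comp V 1%g x & x != 0]).
  right; apply/seteqP; split=> // y _; move: y.
  have [m Em] := ind_gen_surj cx.
  have [|E|E] := sM [set m | N (ind_gen m)].
  - split=> [|v w /= Nv Nw|r v /= Nv].
    + by rewrite /mkset (morphD0 ind_genD).
    + by rewrite ind_genD; apply: sND.
    + by rewrite ind_genZ; apply: sNZ.
  - have : [set m | N (ind_gen m)] m by rewrite /mkset -Em.
    by rewrite E /= => m_0; rewrite Em m_0 (morphD0 ind_genD) eqxx in x0.
  - apply: ind_bar_ind => // a m'; apply: sNZ.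
    by have : [set m | N (ind_gen m)] m' by rewrite E.
left; apply/seteqP; split=> [x Nx|x /= -> //].
apply: (zero_e_submodule gN) => // y Ny cy.
by apply: contrapT => /eqP y0; apply: Nex; exists y.
Qed.

(** An endomorphism preserves the copy of [M] in degree [e], on which it is a
    scalar by hypothesis, and this copy generates. *)
Lemma ind_bar_abs_simple : abs_graded_simple V.
Proof.
split=> [|phi pC]; first exact: ind_bar_simple.
have /choice[f fE] : forall m, exists m', phi (ind_gen m) = ind_gen m'.
  by move=> m; apply: ind_gen_surj; apply: pC; apply: ind_gen_comp.
have genI m m' : ind_gen m = ind_gen m' -> m = m'.
  by apply: (morphD_inj ind_genD) => {}m; apply: ind_gen_inj0.
have fD : {morph f : m m' / m + m'}.
  by move=> m m'; apply: genI; rewrite ind_genD -!fE ind_genD linearD.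
have fZ r m : f (r *: m) = r *: f m.
  by apply: genI; rewrite ind_genZ -!fE ind_genZ linearZ.
have [h hE] := linear_pack fD fZ.
have [_ /(_ h)[k kE]] := irrM.
have pg m : phi (ind_gen m) = ga_in A k *: ind_gen m.
  by rewrite fE -hE kE ind_genZ.
exists k; apply: ind_bar_ind => [|x y Ex Ey|a m].
- by rewrite linear0 scaler0.
- by rewrite linearD scalerDr Ex Ey.
- by rewrite linearZ /= pg ga_scal_central.
Qed.

(** A graded simple module is generated by any nonzero homogeneous element. *)
Lemma card_ind_bar : [set: V] #<= [set: A].
Proof.
have [m0 m00] := irr_neq0.
have /choice[c cE] : forall x : V, exists a : A, x = a *: ind_gen m0.
  by move=> x; apply: homog_gen ind_bar_simple (ind_gen_comp m0) (ind_gen_neq0 m00).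
by apply/card_leTTP; exists c => x y E; rewrite (cE x) E -cE.
Qed.

End OneModule.

(** By [graded_extend] it suffices to compare the annihilators in [A_e] of a
    nonzero [m] and of its image. *)
Lemma ind_bar_iso (M M' : lmodType (base A)) : irr_module M -> irr_module M' ->
  module_iso M M' -> G_equivariant (GrPair (ind_bar M)) (GrPair (ind_bar M')).
Proof.
move=> iM iM' [f fb]; have [m m0] := irr_neq0 iM.
have fm0 : f m != 0.
  by apply: contra_neq m0 => E; apply: (bij_inj fb); rewrite E linear0.
have [a ca|phi [pD pA pb pC _]] := graded_extend (ind_bar_simple iM) (ind_bar_simple iM')
    (ind_gen_comp m) (ind_gen_neq0 m0) (ind_gen_comp (f m)) (ind_gen_neq0 fm0).
  have [r <-] := base_act ca; rewrite -!ind_genZ => /ind_gen_inj0 E.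
  by rewrite -linearZ /= E linear0 (morphD0 (@ind_genD M')).
apply/G_equivariantP; exists id, phi; split=> //.
- by exists id.
- by move=> g x cx; rewrite mulg1; apply: pC.
Qed.

End Induced.

(** * Obstruction classes *)
Section Obstruction.
Context (F : fieldType) (G : groupType).
Implicit Types (A B : grAlg F G).

(** The images [u g] of the basis elements of a twisted group algebra, where the
    product of [u g] and [u h] is [u h \o u g] since endomorphisms act from the
    right. *)
Record realizes A (W : grMod A) (alpha : cocycle F G) (u : G -> W -> W) : Prop := {
  rz_deg : forall g, endr_deg (W := W) g (u g);
  rz_neq0 : forall g, exists w, u g w != 0;
  rz_mul : forall g h w, u h (u g w) = ga_in A (alpha g h) *: u (g * h)%g w }.

Lemma endr_degD A (W : grMod A) g (f : W -> W) : endr_deg g f -> {morph f : x y / x + y}.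
Proof. by move=> [lf _]; apply: linear_morphD. Qed.

Lemma endr_degZ A (W : grMod A) g (f : W -> W) : endr_deg g f ->
  forall a x, f (a *: x) = a *: f x.
Proof.
move=> df a x; have [lf _] := df.
by rewrite -[a *: x]addr0 lf (morphD0 (endr_degD df)) addr0.
Qed.

Lemma endr_degP A (W : grMod A) g (f : W -> W) : {morph f : x y / x + y} ->
  (forall a x, f (a *: x) = a *: f x) ->
  (forall h x, gm_comp W h x -> gm_comp W (h * g)%g (f x)) -> endr_deg g f.
Proof. by move=> fD fZ fC; split=> // a x y; rewrite fD fZ. Qed.

Lemma endr_deg_shift A (W : grMod A) g (f : W -> W) : endr_deg g f ->
  shift_hom g (f : mod_space W -> mod_space W).
Proof.
move=> df; split=> [|k x|h x]; first exact: endr_degD df.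
- exact: endr_degZ df _ _.
- by case: df => _; apply.
Qed.

Lemma scal_eq0 A (W : grMod A) k (w : W) : ga_in A k *: w = 0 -> w != 0 -> k = 0.
Proof.
move=> E; apply: contra_neq_eq => k0.
by rewrite -[w]scale1r -(rmorph1 (ga_in A)) -(mulVf k0) rmorphM -scalerA E scaler0.
Qed.

Lemma scal_inj A (W : grMod A) k l (w : W) : w != 0 ->
  ga_in A k *: w = ga_in A l *: w -> k = l.
Proof.
move=> w0 E; apply/eqP; rewrite -subr_eq0; apply/eqP.
by apply: scal_eq0 w0; rewrite rmorphB scalerBl E subrr.
Qed.

Section Endomorphisms.
Context A (W : grMod A) (iW : G_invariant W) (sW : abs_graded_simple W).

Lemma endr_deg_bij g : exists2 u : W -> W, endr_deg g u & bijective u.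
Proof.
have /G_invariantP/(_ g)[phi [_ _ pD pA pC b]] := iW.
by exists phi => //; apply: endr_degP.
Qed.

(** The composite of [f] with the inverse of [u] preserves degrees, so it is a
    scalar. *)
Lemma endr_deg_multiple g (u f : W -> W) : endr_deg g u -> bijective u ->
  endr_deg g f -> exists k, forall w, f w = ga_in A k *: u w.
Proof.
move=> du [v uv vu] df.
have [vD _ vC] := shift_hom_inv (endr_deg_shift du) uv vu.
have uZ := endr_degZ du; have fZ := endr_degZ df.
have vZ a x : v (a *: x) = a *: v x by apply: (can_inj uv); rewrite uZ !vu.
have [|a x|h hE] := @linear_pack A W W (v \o f).
- by move=> x y /=; rewrite (endr_degD df) vD.
- by rewrite /= fZ vZ.
have [_ /(_ h)[|k kE]] := sW.
  move=> k x cx; rewrite hE /= -[k](mulgK g); apply: vC.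
  by case: df => _; apply.
by exists k => w; apply: (can_inj vu); rewrite vZ uv -kE hE.
Qed.

Lemma endr_deg_neq0_bij g (f : W -> W) : endr_deg g f -> (exists w, f w != 0) -> bijective f.
Proof.
move=> df [w fw]; have [u du [v uv vu]] := endr_deg_bij g.
have uZ := endr_degZ du.
have [|k kE] := endr_deg_multiple du _ df; first by exists v.
have k0 : k != 0.
  by apply: contra_neq fw => k0; rewrite kE k0 rmorph0 scale0r.
have kK (k' k'' : F) (x : W) : k' * k'' = 1 -> ga_in A k' *: (ga_in A k'' *: x) = x.
  by move=> E; rewrite scalerA -rmorphM E rmorph1 scale1r.
exists (fun x => v (ga_in A k^-1 *: x)) => x.
  by rewrite kE kK ?mulVf.
by rewrite kE vu kK ?mulfV.
Qed.

Lemma abs_simple_neq0 : exists w : W, w != 0.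
Proof. by have [[]] := sW. Qed.

(** The cocycle identity compares the two ways of composing three of the chosen
    bijections. *)
Lemma exists_realization : exists alpha (u : G -> W -> W), realizes alpha u.
Proof.
have /choice[u uP] : forall g, exists u : W -> W, endr_deg g u /\ bijective u.
  by move=> g; have [u du b] := endr_deg_bij g; exists u.
have ud g : endr_deg g (u g) by case: (uP g).
have ub g : bijective (u g) by case: (uP g).
have uZ g := endr_degZ (ud g).
have [w0 w00] := abs_simple_neq0.
have u0 g w : w != 0 -> u g w != 0.
  by apply: contra_neq => E; apply: (bij_inj (ub g)); rewrite E (morphD0 (endr_degD (ud g))).
have /choice[a aP] : forall q : G * G, exists k, forall w,
    u q.2 (u q.1 w) = ga_in A k *: u (q.1 * q.2)%g w.
  move=> [g h]; apply: (endr_deg_multiple (f := u h \o u g)) => //.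
  apply: endr_degP => [x y|c x|k x cx] /=.
  - by rewrite !(endr_degD (ud _)).
  - by rewrite !uZ.
  - rewrite mulgA; case: (ud h) => _; apply; case: (ud g) => _; exact.
have a0 g h : a (g, h) != 0.
  apply/eqP => E; have := aP (g, h) w0; rewrite E rmorph0 scale0r /= => E'.
  by have := u0 h _ (u0 g _ w00); rewrite E' eqxx.
have aC g h k : a (g, h) * a (g * h, k)%g = a (h, k) * a (g, h * k)%g.
  apply: (scal_inj (u0 (g * h * k)%g _ w00)).
  transitivity (u k (u h (u g w0))).
    by rewrite (aP (g, h)) uZ (aP (g * h, k)%g) /= scalerA -rmorphM.
  by rewrite (aP (h, k)) (aP (g, h * k)%g) /= scalerA -rmorphM mulgA.
exists (Cocycle a0 aC), u; split=> //.
- by move=> g; exists w0; apply: u0.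
- by move=> g h w; rewrite (aP (g, h)).
Qed.

Lemma realizes_bij alpha (u : G -> W -> W) : realizes alpha u -> forall g, bijective (u g).
Proof. by move=> [ud u0 _] g; apply: endr_deg_neq0_bij. Qed.

Lemma realizes_cohomologous alpha beta (u v : G -> W -> W) :
  realizes alpha u -> realizes beta v -> cohomologous alpha beta.
Proof.
move=> ru rv; have [ud u0 uM] := ru; have [vd _ vM] := rv.
have vb := realizes_bij rv; have [w0 w00] := abs_simple_neq0.
have /choice[l lE] : forall g, exists k, forall w, u g w = ga_in A k *: v g w.
  by move=> g; apply: endr_deg_multiple.
have l0 g : l g != 0.
  have [w uw] := u0 g; apply: contra_neq uw => E.
  by rewrite lE E rmorph0 scale0r.
have vw g : v g w0 != 0.
  apply: contra_neq w00 => E; apply: (bij_inj (vb g)).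
  by rewrite E (morphD0 (endr_degD (vd g))).
exists l; split=> // g h.
have E : alpha g h * l (g * h)%g = l h * l g * beta g h.
  apply: (scal_inj (vw (g * h)%g)).
  rewrite rmorphM -scalerA -lE -uM !lE (endr_degZ (vd h)) vM !scalerA -!rmorphM.
  by [].
apply: (mulIf (l0 (g * h)%g)); rewrite E; field.
exact: l0.
Qed.

Lemma realizes_scale alpha beta (u : G -> W -> W) : realizes beta u ->
  cohomologous alpha beta -> exists v : G -> W -> W, realizes alpha v.
Proof.
move=> [ud u0 uM] [l [l0 E]]; exists (fun g w => ga_in A (l g) *: u g w); split.
- move=> g; have uD := endr_degD (ud g); have uZ := endr_degZ (ud g).
  apply: endr_degP => [x y|a x|h x cx].
  + by rewrite uD scalerDr.
  + by rewrite uZ ga_scal_central.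
  + by apply: gm_scale; case: (ud g) => _; apply.
- move=> g; have [w uw] := u0 g; exists w.
  by apply/eqP => /scal_eq0 /(_ uw) /eqP; rewrite (negbTE (l0 g)).
- move=> g h w; rewrite (endr_degZ (ud h)) uM !scalerA -!rmorphM.
  congr (ga_in A _ *: _); rewrite E; field.
  exact: l0.
Qed.

Lemma realizes_of_iso alpha :
  galg_iso (endr_alg W) (twisted_group_alg alpha) ->
  exists u : G -> W -> W, realizes alpha u.
Proof.
move=> /galg_isoP[psi ph [chi K K']].
have [cD cM cin cC] := galg_hom_inv ph K K'.
pose m g : twisted_group_alg alpha := mon 1 g.
exists (fun g => \val (chi (m g) : endr W)); split.
- by move=> g; apply: (cC g); apply: mon_comp.
- move=> g; apply: contrapT => /forallNP N0.
  have E : chi (m g) = 0.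
    by apply: val_inj; apply/funext => w; apply: contrapT => /eqP /N0.
  have : m g = 0 by rewrite -[m g]K' E (morphD0 (gahD ph)).
  move=> /(congr1 (fun x : tga F G => \val x g)) /= /eqP.
  by rewrite eqxx (negbTE (oner_neq0 F)).
- move=> g h w.
  have : m g * m h = ga_in (twisted_group_alg alpha) (alpha g h) * m (g * h)%g.
    by rewrite mon_mul [RHS]tga_in_mul !mul1r mulr1.
  move=> /(congr1 chi); rewrite !cM cin => /(congr1 val) /(congr1 (@^~ w)) /= ->.
  have cgh : ga_comp (twisted_group_alg alpha) (g * h)%g (m (g * h)%g).
    exact: mon_comp.
  by have := endr_degZ (cC _ _ cgh); apply.
Qed.

(** The inverse isomorphism is the linear map [v_g |-> u_g]; it is bijective as
    the endomorphisms of degree [g] are the multiples of [u_g]. *)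
Lemma iso_of_realizes alpha (u : G -> W -> W) : realizes alpha u ->
  galg_iso (endr_alg W) (twisted_group_alg alpha).
Proof.
move=> ru; have [ud u0 uM] := ru; have ub := realizes_bij ru.
pose E := endr_alg W.
have /choice[v vE] : forall g, exists v : E, \val (v : endr W) = u g.
  move=> g; have pu : endr_pred (u g).
    by apply/asboolP; apply: (homog_sum_comp (endr_deg_subgroups W) (ud g)).
  by exists (Sub (u g) pu : endr W); rewrite SubK.
pose H (x : tga F G) g : E := ga_in E (\val x g) * v g.
pose Psi (x : twisted_group_alg alpha) : E := \sum_(g <- supp (x : tga F G)) H x g.
have HD x y g : H (x + y) g = H x g + H y g.
  by rewrite /H raddfD -mulrDl -rmorphD.
have H0 x g : \val (x : tga F G) g = 0 -> H x g = 0.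
  by move=> E0; rewrite /H E0 rmorph0 mul0r.
have PsiE x s : uniq s -> {subset supp (x : tga F G) <= s} ->
    Psi x = \sum_(g <- s) H x g.
  by move=> us xs; rewrite (sum_supp us xs) // => g; apply: H0.
have PsiD : {morph Psi : x y / x + y}.
  move=> x y; pose s := undup (supp (x : tga F G) ++ supp (y : tga F G) ++ supp (x + y : tga F G)).
  rewrite !(PsiE _ s) ?undup_uniq //; last 3 first.
  - by move=> g gs; rewrite mem_undup !mem_cat gs ?orbT.
  - by move=> g gs; rewrite mem_undup !mem_cat gs ?orbT.
  - by move=> g gs; rewrite mem_undup !mem_cat gs ?orbT.
  by rewrite -big_split; apply: eq_bigr => g _; apply: HD.
have PsiM k g : Psi (mon k g) = ga_in E k * v g.
  rewrite (PsiE _ [:: g]) //; last exact: supp_mon.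
  by rewrite big_seq1 /H /= eqxx.
have vM g h : v g * v h = ga_in E (alpha g h) * v (g * h)%g.
  apply: val_inj; apply/funext => w /=.
  rewrite -[LHS]/(\val (v h : endr W) (\val (v g : endr W) w)).
  rewrite -[RHS]/(\val (v (g * h)%g : endr W) (ga_in A (alpha g h) *: w)).
  by rewrite !vE uM (endr_degZ (ud _)).
have vC g : ga_comp E g (v g) by rewrite /ga_comp /= /endr_comp /mkset vE.
have hom : galg_hom Psi.
  split=> //.
  - move=> x y; move: x; apply: tga_ind => [|x x' Ex Ex'|k g].
    + by rewrite mul0r !(morphD0 PsiD) mul0r.
    + by rewrite mulrDl !PsiD Ex Ex' mulrDl.
    move: y; apply: tga_ind => [|y y' Ey Ey'|l h].
    + by rewrite mulr0 !(morphD0 PsiD) mulr0.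
    + by rewrite mulrDr !PsiD Ey Ey' mulrDr.
    rewrite mon_mul !PsiM -[RHS]mulrA [v g * (_ * _)]mulrA -ga_central.
    by rewrite -[_ * v g * _]mulrA vM !mulrA -!rmorphM.
  - move=> k; rewrite [ga_in _ k]/(mon _ _) PsiM.
    have -> : v 1%g = ga_in E (alpha 1%g 1%g).
      apply: val_inj; apply/funext => w; rewrite vE.
      apply: (bij_inj (ub 1%g)); rewrite uM mulg1.
      by rewrite -(endr_degZ (ud _)).
    by rewrite -rmorphM divfK ?cocycle_neq0.
  - move=> g x /tga_compE ->; rewrite PsiM; apply: ga_scale; exact: vC.
have bij : bijective Psi.
  apply: inj_surj_bij => [|y].
    apply: (morphD_inj PsiD) => x Px.
    suff s0 : supp (x : tga F G) = [::] by rewrite [LHS]tga_sum s0 big_nil.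
    case Es : (supp _) => [//|g s]; have gs : g \in supp (x : tga F G).
      by rewrite Es mem_head.
    have := gr_indep (ga_grading E) (f := H x) (supp_uniq x) _ Px gs.
    move=> /(_ (fun g => ga_scale (\val (x : tga F G) g) (vC g))) Hg.
    have [w uw] := u0 g; move: gs; rewrite mem_supp => /eqP[].
    apply: (scal_eq0 (w := u g w)) => //.
    move: Hg => /(congr1 (fun y : endr W => \val y w)).
    rewrite -[X in X = _ -> _]/(\val (v g : endr W) (ga_in A (\val (x : tga F G) g) *: w)).
    by rewrite vE (endr_degZ (ud g)) raddf0.
  have [s ->] := proj_decomp (ga_grading E) y.
  have /choice[k kE] : forall g, exists k, proj (ga_grading E) g y = Psi (mon k g).
    move=> g; have dp : endr_deg g (\val (proj (ga_grading E) g y : endr W)).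
      exact: (proj_comp (ga_grading E) g y).
    have [k kE] := endr_deg_multiple (ud g) (ub g) dp.
    exists k; rewrite PsiM; apply: val_inj; apply/funext => w.
    rewrite -[RHS]/(\val (v g : endr W) (ga_in A k *: w)).
    by rewrite vE (endr_degZ (ud g)) kE.
  exists (\sum_(g <- s) (mon (k g) g : twisted_group_alg alpha)).
  by rewrite (morphD_sum PsiD); apply: eq_bigr => g _; rewrite kE.
have [chi K K'] := bij; apply/galg_isoP; exists chi; last by exists Psi.
exact: galg_hom_inv hom K K'.
Qed.

End Endomorphisms.

Lemma realizes_equivariant (P Q : grPair F G) alpha (u : G -> P -> P) : G_equivariant P Q ->
  realizes alpha u -> exists v : G -> Q -> Q, realizes alpha v.
Proof.
move=> /G_equivariantP[psi [phi pe]] [ud u0 uM].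
have [ph [psi' K K'] pD pA pC [phi' L L']] := pe.
have [_ _ pin _] := ph.
have [eD _ eC] := shift_hom_inv (pe_shift pe) L L'.
have eA a x : phi' (a *: x) = psi' a *: phi' x.
  by apply: (can_inj L); rewrite pA K' !L'.
exists (fun g x => phi (u g (phi' x))); split=> [g|g|g h x].
- apply: endr_degP => [x y|a x|h x cx].
  + by rewrite eD (endr_degD (ud g)) pD.
  + by rewrite eA (endr_degZ (ud g)) pA K'.
  + rewrite -[(h * g)%g]mulg1; apply: pC; case: (ud g) => _; apply.
    by have := eC h x cx; rewrite invg1 mulg1.
- have [w uw] := u0 g; exists (phi w); rewrite L.
  by apply: contra_neq uw => E; apply: (can_inj L); rewrite E (morphD0 pD).
- by rewrite L uM pA pin.
Qed.

(** Conjugation by an equivariance leaves the algebra automorphism trivial. *)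
Lemma G_invariant_equivariant (P Q : grPair F G) :
  G_equivariant P Q -> G_invariant P -> G_invariant Q.
Proof.
move=> /G_equivariantP[psi [phi pe]] /G_invariantP iP; apply/G_invariantP => g.
have [ph [psi' K K'] pD pA pC [phi' L L']] := pe.
have [eD _ eC] := shift_hom_inv (pe_shift pe) L L'.
have eA a x : phi' (a *: x) = psi' a *: phi' x.
  by apply: (can_inj L); rewrite pA K' !L'.
have [t [_ _ tD tA tC [t' T T']]] := iP g.
exists (phi \o t \o phi'); split=> //.
- by exists id.
- by move=> x y /=; rewrite eD tD pD.
- by move=> a x /=; rewrite eA tA pA K'.
- move=> h x cx /=; rewrite -[(h * g)%g]mulg1; apply: pC; apply: tC.
  by have := eC h x cx; rewrite invg1 mulg1.
- by exists (phi \o t' \o phi') => x /=; rewrite ?L ?T ?L' ?L ?T' ?L'.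
Qed.

(** The tensor products of [u g] and [v g] are defined by functoriality. *)
Lemma realizes_gprod A B (W : grMod A) (W' : grMod B) alpha beta (u : G -> W -> W)
    (v : G -> W' -> W') :
  abs_graded_simple W -> abs_graded_simple W' ->
  G_invariant W -> G_invariant W' ->
  realizes alpha u -> realizes beta v ->
  exists t : G -> gtens_mod W W' -> _, realizes (cocycle_mul alpha beta) t.
Proof.
move=> sW sW' iW iW' ru rv; have gM := gmtens_graded_tensor W W'.
have [ud u0 uM] := ru; have [vd v0 vM] := rv.
have /choice[t tP] : forall g, exists t : gtens_mod W W' -> gtens_mod W W',
    shift_hom g (t : mod_space (gtens_mod W W') -> mod_space (gtens_mod W W')) /\
    forall h w w', gm_comp W h w -> gm_comp W' h w' ->
      t (gmpure w w') = gmpure (u g w) (v g w').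
  move=> g; have [t th tE] := gt_map gM gM (endr_deg_shift (ud g)) (endr_deg_shift (vd g)).
  by exists t.
have th g : shift_hom g (t g : mod_space (gtens_mod W W') -> mod_space (gtens_mod W W')) by case: (tP g).
have tE g h w w' : gm_comp W h w -> gm_comp W' h w' ->
    t g (gmpure w w') = gmpure (u g w) (v g w').
  by case: (tP g) => _; apply.
have uC g h x : gm_comp W h x -> gm_comp W (h * g)%g (u g x).
  by case: (ud g) => _; apply.
have vC g h x : gm_comp W' h x -> gm_comp W' (h * g)%g (v g x).
  by case: (vd g) => _; apply.
exists t; split=> [g|g|g h].
- have [tD _ tC] := th g; apply: endr_degP => //.
  apply: (gtens_act_hom (psi := id)) => // k l a b w w' ca cb cw cw'.
  rewrite (tE g (k * l)%g); [|exact: gm_act|exact: gm_act].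
  rewrite (tE g l) // (gtens_act_pure ca cb (uC g _ _ cw) (vC g _ _ cw')).
  by rewrite (endr_degZ (ud g)) (endr_degZ (vd g)).
- have [w cw w0] := invariant_comp_neq0 iW (abs_simple_neq0 sW) 1%g.
  have [w' cw' w'0] := invariant_comp_neq0 iW' (abs_simple_neq0 sW') 1%g.
  exists (gmpure w w'); rewrite (tE g 1%g) //.
  apply: gmpure_neq0; [exact: uC cw|exact: vC cw'| |].
    apply: contra_neq w0 => E; apply: (bij_inj (realizes_bij iW sW ru g)).
    by rewrite E (morphD0 (endr_degD (ud g))).
  apply: contra_neq w'0 => E; apply: (bij_inj (realizes_bij iW' sW' rv g)).
  by rewrite E (morphD0 (endr_degD (vd g))).
- apply: (gt_ext gM) => [x y|x y|k w w' cw cw'].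
  + by rewrite !(shD (th _)).
  + by rewrite (shD (th _)) scalerDr.
  rewrite (tE g k) // (tE h (k * g)%g); auto.
  rewrite (tE (g * h)%g k) // uM vM gtens_in_pure.
  have cu := uC (g * h)%g _ _ cw; have cv := vC (g * h)%g _ _ cw'.
  rewrite (gtens_act_pure (ga_in_comp A _) (ga_one B) cu cv) scale1r.
  rewrite /= mulrC rmorphM -scalerA.
  have [_ _ bz] := gt_bal gM (k * (g * h))%g.
  have := bz (beta g h) (ga_in A (alpha g h) *: u (g * h)%g w) (v (g * h)%g w').
  by move=> /(_ (gm_scale _ cu) cv) /= <-.
Qed.

(** Right multiplications commute with the left action. *)
Lemma realizes_unit : realizes (W := unit_pair F G) (cocycle_one F G)
  (fun g (x : group_alg F G) => x * mon 1 g).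
Proof.
split=> [g|g|g h w].
- apply: endr_degP => [x y|a x|h x cx].
  + by rewrite mulrDl.
  + by apply: esym (mulrA (a : group_alg F G) (x : group_alg F G) (mon 1 g : group_alg F G)).
  + by apply: ga_mul => //; apply: mon_comp.
- exists 1; rewrite mul1r; apply/eqP => /(congr1 (coef g)).
  by rewrite coef_mon => /eqP; rewrite (negbTE (oner_neq0 F)).
- rewrite -mulrA group_alg_mon mulr1 rmorph1.
  by rewrite scale1r.
Qed.

End Obstruction.

(** * The monoid of classes *)
Section Classes.
Context (T : Type) (P : T -> Prop) (R : T -> T -> Prop).
Hypothesis R_refl : forall x, R x x.
Hypothesis R_sym : forall x y, R x y -> R y x.
Hypothesis R_trans : forall x y z, R x y -> R y z -> R x z.

Definition class_of (x : T) (Px : P x) : eqclass P R :=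
  EqClass (ex_intro (fun z => P z /\ forall y, (P y /\ R x y) <-> P y /\ R z y) x
    (conj Px (fun y => iff_refl (P y /\ R x y)))).

Lemma eqclass_inhabited (c : eqclass P R) : exists x, c x.
Proof. by have [x [Px cx]] := ec_proof c; exists x; apply/cx. Qed.

Lemma eqclass_P (c : eqclass P R) x : c x -> P x.
Proof. by have [z [Pz cz]] := ec_proof c; move=> /cz[]. Qed.

(** A class is determined by any of its members, not only by the one it was
    built from. *)
Lemma eqclassE (c : eqclass P R) x y : c x -> c y <-> P y /\ R x y.
Proof.
have [z [Pz cz]] := ec_proof c; move=> /cz[Px zx]; split=> [/cz[Py zy]|[Py xy]].
  by split=> //; apply: R_trans zy; apply: R_sym.
by apply/cz; split=> //; apply: R_trans xy.
Qed.

Lemma eqclass_eq (c c' : eqclass P R) x : c x -> c' x -> c = c'.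
Proof.
move=> cx c'x; have : c = c' :> (T -> Prop).
  by apply/funext => y; apply/propext; rewrite (eqclassE y cx) (eqclassE y c'x).
case: c c' {cx c'x} => [m mP] [m' m'P] /= E.
by case: _ / E m'P => m'P; congr EqClass; apply: Prop_irrelevance.
Qed.

End Classes.

Section Assembly.
Context (F : fieldType) (G : groupType) (Kalg Kmod : Type).
Hypothesis Kalg_inf : infinite_set [set: Kalg].
Hypothesis Kmod_inf : infinite_set [set: Kmod].
Hypothesis Kalg_F : [set: F] #<= [set: Kalg].
Hypothesis Kmod_F : [set: F] #<= [set: Kmod].
Hypothesis Kalg_G : [set: G] #<= [set: Kalg].
Hypothesis Kmod_G : [set: G] #<= [set: Kmod].

Let irr := @irr_inv F G Kalg Kmod.
Let Irr := IrrInv F G Kalg Kmod.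
Let refl := @G_equivariant_refl F G.
Let sym := @G_equivariant_sym F G.
Let trans := @G_equivariant_trans F G.

Lemma irr_inv_unit : irr (unit_pair F G).
Proof.
split; [exact: card_tga|exact: card_tga| |].
- exact: unit_pair_invariant.
- exact: unit_pair_abs_simple.
Qed.

Lemma irr_inv_gprod P Q : irr P -> irr Q -> irr (gprod P Q).
Proof.
move=> [cP mP iP sP] [cQ mQ iQ sQ]; split.
- exact: card_gtens.
- exact: card_gmtens.
- exact: gprod_invariant.
- exact: gprod_abs_simple.
Qed.

Definition irr_one : Irr := class_of (@G_equivariant F G) irr_inv_unit.

Definition irr_rep (c : Irr) : grPair F G := sval (cid (eqclass_inhabited refl c)).

Lemma irr_repP (c : Irr) : c (irr_rep c).
Proof. by rewrite /irr_rep; case: cid. Qed.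

Lemma irr_inv_rep (c : Irr) : irr (irr_rep c).
Proof. exact: eqclass_P (irr_repP c). Qed.

Definition irr_mul (c d : Irr) : Irr :=
  class_of (@G_equivariant F G) (irr_inv_gprod (irr_inv_rep c) (irr_inv_rep d)).

Lemma irr_mulP (c d : Irr) P Q : c P -> d Q -> irr_mul c d (gprod P Q).
Proof.
move=> cP dQ; split; first exact: irr_inv_gprod (eqclass_P cP) (eqclass_P dQ).
apply: gprod_congr.
  by have [_] := proj1 (eqclassE sym trans P (irr_repP c)) cP.
by have [_] := proj1 (eqclassE sym trans Q (irr_repP d)) dQ.
Qed.

Lemma irr_eq (c d : Irr) P Q : c P -> d Q -> G_equivariant P Q -> c = d.
Proof.
move=> cP dQ PQ; apply: (eqclass_eq sym trans (x := Q)) => //.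
by apply/(eqclassE sym trans _ cP); split=> //; apply: eqclass_P dQ.
Qed.

Lemma irr_mulA : associative irr_mul.
Proof.
move=> a b c; have [pa pb pc] := And3 (irr_repP a) (irr_repP b) (irr_repP c).
apply: irr_eq (irr_mulP pa (irr_mulP pb pc)) (irr_mulP (irr_mulP pa pb) pc) _.
by apply: sym; apply: gprod_assoc.
Qed.

Lemma irr_mulC : commutative irr_mul.
Proof.
move=> a b; apply: irr_eq (irr_mulP (irr_repP a) (irr_repP b)) (irr_mulP (irr_repP b) (irr_repP a)) _.
exact: gprod_comm.
Qed.

Lemma irr_oneP : irr_one (unit_pair F G).
Proof. by split; [exact: irr_inv_unit|exact: refl]. Qed.

Lemma irr_mul1 : left_id irr_one irr_mul.
Proof.
move=> a; apply: irr_eq (irr_mulP irr_oneP (irr_repP a)) (irr_repP a) _.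
exact: gprod_unit.
Qed.

Lemma irr_omega_key (c : Irr) : exists alpha, exists2 P, c P &
  exists u : G -> P -> P, realizes alpha u.
Proof.
have [_ _ iP sP] := irr_inv_rep c; have [alpha [u ru]] := exists_realization iP sP.
by exists alpha; exists (irr_rep c); [exact: irr_repP|exists u].
Qed.

Definition irr_omega (c : Irr) : H2 F G := H2class (sval (cid (irr_omega_key c))).

(** Two cocycles for isomorphic endomorphism algebras are cohomologous, and a
    realization of a cocycle can be rescaled to any cohomologous one. *)
Lemma irr_omegaP (c : Irr) (P : grPair F G) alpha : c P ->
  galg_iso (endr_alg P) (twisted_group_alg alpha) <-> irr_omega c = H2class alpha.
Proof.
move=> cP; rewrite /irr_omega; case: cid => beta /= [Q cQ [u ru]].
have [_ _ iP sP] := eqclass_P cP.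
have [_ QP] := proj1 (eqclassE sym trans P cQ) cP.
have [v rv] := realizes_equivariant QP ru.
split=> [/(realizes_of_iso)[w rw]|/H2classP ba].
  exact/H2classP/(realizes_cohomologous iP sP rv rw).
have ab : cohomologous alpha beta by apply/H2classP/esym/H2classP.
have [w rw] := realizes_scale rv ab.
exact: iso_of_realizes iP sP _ _ rw.
Qed.

Lemma irr_omega_realizes (c : Irr) (P : grPair F G) alpha (u : G -> P -> P) : c P ->
  realizes alpha u -> irr_omega c = H2class alpha.
Proof.
move=> cP ru; have [_ _ iP sP] := eqclass_P cP.
exact/(irr_omegaP _ cP)/(iso_of_realizes iP sP ru).
Qed.

Lemma irr_omega_one : irr_omega irr_one = 1%g.
Proof. exact: irr_omega_realizes irr_oneP (realizes_unit F G). Qed.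

Lemma irr_omegaM : {morph irr_omega : c d / irr_mul c d >-> (c * d)%g}.
Proof.
move=> c d; have [_ _ iP sP] := irr_inv_rep c; have [_ _ iQ sQ] := irr_inv_rep d.
have [alpha [u ru]] := exists_realization iP sP.
have [beta [v rv]] := exists_realization iQ sQ.
have [t rt] := realizes_gprod sP sQ iP iQ ru rv.
rewrite (irr_omega_realizes (irr_mulP (irr_repP c) (irr_repP d)) rt).
rewrite (irr_omega_realizes (irr_repP c) ru) (irr_omega_realizes (irr_repP d) rv).
exact: esym (H2classM alpha beta).
Qed.

Section Iota.
Context (A : grAlg F G).
Hypothesis Kalg_A : [set: A] #<= [set: Kalg].
Hypothesis Kmod_A : [set: A] #<= [set: Kmod].

Lemma module_iso_sym (R : pzRingType) (M N : lmodType R) :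
  module_iso M N -> module_iso N M.
Proof.
move=> [f [h fh hf]].
have [|a x|e eE] := @linear_pack R N M h.
- by move=> x y; apply: (can_inj fh); rewrite linearD !hf.
- by apply: (can_inj fh); rewrite linearZ /= !hf.
- by exists e; rewrite eE; exists f.
Qed.

Lemma irrG_equivariant (c : IrrG A) M M' : irrG_class c M -> irrG_class c M' ->
  G_equivariant (GrPair (ind_bar M)) (GrPair (ind_bar M')).
Proof.
have [N [iN cN]] := ec_proof (irrG_class c).
move=> /cN[iM NM] /cN[iM' NM'].
apply: (trans (Q := GrPair (ind_bar N))); last exact: ind_bar_iso.
by apply: ind_bar_iso => //; apply: module_iso_sym.
Qed.

Lemma ind_bar_irr (c : IrrG A) M : irrG_class c M -> irr (GrPair (ind_bar M)).
Proof.
move=> cM; have iM := eqclass_P cM; split=> //.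
- exact: card_le_trans (card_ind_bar iM) Kmod_A.
- have [N cN iN] := irrG_inv c.
  exact: (G_invariant_equivariant (irrG_equivariant cN cM)).
- exact: ind_bar_abs_simple.
Qed.

Lemma irrG_inhabited (c : IrrG A) : exists M, irrG_class c M.
Proof.
apply: eqclass_inhabited => M; exists idfun; exists id => //.
Qed.

Definition irr_iota (c : IrrG A) : Irr :=
  class_of (@G_equivariant F G) (ind_bar_irr (svalP (cid (irrG_inhabited c)))).

Lemma irr_iotaP (c : IrrG A) M : irrG_class c M -> irr_iota c (GrPair (ind_bar M)).
Proof.
move=> cM; split; first exact: ind_bar_irr cM.
by apply: irrG_equivariant cM; apply: svalP.
Qed.

Lemma obstruction_irr_iota (c : IrrG A) : obstruction c = irr_omega (irr_iota c).
Proof.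
rewrite /obstruction; apply: xget_unique => [|x [M [alpha [cM -> iso]]]].
  have [M cM] := irrG_inhabited c; have [_ _ iM sM] := ind_bar_irr cM.
  have [alpha [u ru]] := exists_realization iM sM.
  exists M, alpha; split=> //; last exact: iso_of_realizes ru.
  exact: irr_omega_realizes (irr_iotaP cM) ru.
exact/esym/(irr_omegaP _ (irr_iotaP cM)).
Qed.

End Iota.
End Assembly.

Theorem theoremB (F : fieldType) (G : groupType) (A : grAlg F G)
    (Kalg Kmod : Type)
    (Kalg_inf : infinite_set [set: Kalg]) (Kmod_inf : infinite_set [set: Kmod])
    (Kalg_F : [set: F] #<= [set: Kalg]) (Kmod_F : [set: F] #<= [set: Kmod])
    (Kalg_G : [set: G] #<= [set: Kalg]) (Kmod_G : [set: G] #<= [set: Kmod])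
    (Kalg_A : [set: A] #<= [set: Kalg]) (Kmod_A : [set: A] #<= [set: Kmod]) :
  exists (one : IrrInv F G Kalg Kmod) (mul : Monoid.com_law one)
         (iota : IrrG A -> IrrInv F G Kalg Kmod)
         (omega : IrrInv F G Kalg Kmod -> H2 F G),
    [/\ forall (c c' : IrrInv F G Kalg Kmod) (W W' : grPair F G),
          c W -> c' W' -> mul c c' (gprod W W'),
        forall (c : IrrG A) (M : lmodType (base A)),
          irrG_class c M -> iota c (GrPair (ind_bar M)),
        omega one = 1%g /\ {morph omega : c c' / mul c c' >-> (c * c')%g},
        forall (c : IrrInv F G Kalg Kmod) (W : grPair F G)
               (alpha : cocycle F G),
          c W ->
          (galg_iso (endr_alg W) (twisted_group_alg alpha) <->
           omega c = H2class alpha)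
      & forall c : IrrG A, obstruction c = omega (iota c)].
Proof.
pose one := irr_one Kalg_inf Kmod_inf Kalg_F Kmod_F Kalg_G Kmod_G.
pose mulf := irr_mul (F := F) (G := G) Kalg_inf Kmod_inf.
pose mul : Monoid.com_law one := HB.pack mulf
  (Monoid.isComLaw.Build _ one mulf
    (irr_mulA Kalg_inf Kmod_inf) (irr_mulC Kalg_inf Kmod_inf)
    (irr_mul1 Kalg_inf Kmod_inf Kalg_F Kmod_F Kalg_G Kmod_G)).
exists one, mul, (irr_iota Kalg_A Kmod_A), (@irr_omega F G Kalg Kmod); split.
- exact: irr_mulP.
- exact: irr_iotaP.
- by split; [exact: irr_omega_one|exact: irr_omegaM].
- by move=> c W alpha; apply: irr_omegaP.
- exact: obstruction_irr_iota.
Qed.
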